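(* Assume $m\ge 128$. Let $\eta>0$ and set $$\lambda_0:=2\sigma\,[2(1+\eta)(m-d)\log(5(m+d+1))]^{1/2}.$$ Then, with probability greater than $1-\big[\frac{1}{5(m+d)}\big]^{\eta}$, the following holds. If $\lambda\ge\lambda_0$ and $$\min\{\Delta(\mathbf T),\,2\epsilon(\mathbf T)\}\ \ge\ \frac{5\pi}{m},$$ then there exists a solution $\hat{\mathbf x}$ of the program $$\min_{\mu\in\mathbf C_d(\mathbf x)}\ \tfrac12\|\mathbf c(\mu)-\mathbf y\|_2^2+\lambda\|\mu\|_{TV}$$ with finite support, $\hat{\mathbf x}=\sum_{k=1}^{\hat s}\hat a_k\delta_{\hat t_k}$, satisfying: (i) (Global control) $$\sum_{k=1}^{\hat s}|\hat a_k|\min\Big\{m^2\min_{t\in\mathbf T}\rho(t,\hat t_k)^2;\ c_0^2\Big\}\le c_1\lambda.$$ (ii) (Local control) For all $i=1,\dots,s$, $$\Big|a_i-\sum_{\hat t_k\in\mathrm{Supp}(\hat{\mathbf x}),\ \rho(t_i,\hat t_k)\le c_0/m}\hat a_k\Big|\le c_2\lambda.$$ (iii) (Large spike localization) For all $i=1,\dots,s$ such that $|a_i|>c_2\lambda$, there exists $\hat t\in\mathrm{Supp}(\hat{\mathbf x})$ such that $$\rho(t_i,\hat t)\le\Big[\frac{c_1\lambda}{|a_i|-c_2\lambda}\Big]^{1/2}\frac1m.$$ Here $c_0=1.0361$, $c_1=235.85$ and $c_2=220.72$.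
   Context: The interval $[-1,1]$ carries the distance $\rho(u,v)=|\arccos u-\arccos v|$. Let $\mathbf x=\sum_{k=1}^s a_k\delta_{t_k}$ be a discrete signed measure on $[-1,1]$ with $a_k\in\mathbb R\setminus\{0\}$, distinct points $t_k\in[-1,1]$ ($\delta_t$ is the Dirac mass at $t$), and let $\mathbf T=\{t_1,\dots,t_s\}$ be its support. Let $m$ be a positive integer and $d$ an integer with $-1\le d<m$. Let $\varphi_0=1$ and $\varphi_k=\sqrt2\,T_k$ for $1\le k\le m$, where $T_k(t)=\cos(k\arccos t)$ is the $k$-th Chebyshev polynomial of the first kind. For a finite signed measure $\mu$ on $[-1,1]$ put $c_k(\mu)=\int_{[-1,1]}\varphi_k\,d\mu$ and $\mathbf c(\mu)=(c_k(\mu))_{k=0}^m\in\mathbb R^{m+1}$. The observation is $\mathbf y=\mathbf c(\mathbf x)+\mathbf e$, where $\mathbf e=(\varepsilon_0,\dots,\varepsilon_m)$ with $\varepsilon_k=0$ for $0\le k\le d$ and $\varepsilon_{d+1},\dots,\varepsilon_m$ i.i.d. $\mathcal N(0,\sigma^2)$, $\sigma>0$. $\mathcal M$ is the set of finite signed measures on $[-1,1]$, $\|\cdot\|_{TV}$ the total variation norm, and $\mathbf C_d(\mathbf x)=\{\mu\in\mathcal M:\ c_k(\mu)=c_k(\mathbf x)\ \text{for } k=0,\dots,d\}$ (so $\mathbf C_{-1}(\mathbf x)=\mathcal M$). The number $\lambda>0$ is a tuning parameter. For a finite set $\mathbf T\subset[-1,1]$: $$\Delta(\mathbf T)=\min_{t,t'\in\mathbf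 T,\ t\ne t'}\min\{\rho(t,t'),\ \pi-\rho(t,t')\},\qquad \epsilon(\mathbf T)=\min\{\min(\rho(t,1),\rho(t,-1)):\ t\in\mathbf T\setminus\{-1,1\}\},$$ with the convention that a minimum over an empty set is $+\infty$. *)

(* Defs.v *)
From HB Require Import structures.
From mathcomp Require Export all_boot all_order all_algebra finmap.
From mathcomp Require Export all_classical all_reals all_analysis.
Set Implicit Arguments.
Unset Strict Implicit.
Unset Printing Implicit Defensive.
Import Order.TTheory GRing.Theory Num.Theory.
Import numFieldNormedType.Exports.
Local Open Scope classical_set_scope.
Local Open Scope ring_scope.

Section signed_measures.
Context (R : realType).
Implicit Type mu : {charge set R -> \bar R}.

(* Finite signed measures on [-1, 1] are encoded as charges on the Borel line
   that vanish outside of [-1, 1]. *)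
Definition signed_measure_on_I mu : Prop :=
  forall A : set R, measurable A -> A `&` `[-1, 1] = set0 -> mu A = 0%E.

Lemma hahn_sig mu : {PN : set R * set R | hahn_decomposition mu PN.1 PN.2}.
Proof.
apply/cid; have [P [N PN]] := Hahn_decomposition mu.
by exists (P, N).
Qed.

(* The values of the next two definitions do not depend on the Hahn
   decomposition that is picked (Hahn_decomposition_uniq). *)
Definition charge_Rintegral mu (D : set R) (f : R -> R) : R :=
  (\int[jordan_pos (svalP (hahn_sig mu))]_(x in D) f x)
  - (\int[jordan_neg (svalP (hahn_sig mu))]_(x in D) f x).

Definition TV_norm mu : \bar R :=
  charge_variation (svalP (hahn_sig mu)) setT.

Definition discrete_measure (s : nat) (a t : 'I_s -> R) (A : set R) : \bar R :=
  (\sum_(k < s) (a k)%:E * \d_(t k) A)%E.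

Lemma discrete_measure_charge (s : nat) (a t : 'I_s -> R) :
  exists nu : {charge set R -> \bar R}, discrete_measure a t = nu.
Proof.
elim: s a t => [|s IH] a t.
  exists (czero : {charge set R -> \bar R}).
  by apply/funext => A; rewrite /discrete_measure big_ord0.
have [nu nuE] := IH (fun k => a (lift ord0 k)) (fun k => t (lift ord0 k)).
exists (cadd (cscale (a ord0) (charge_of_finite_measure (\d_(t ord0)))) nu).
apply/funext => A; rewrite /discrete_measure big_ord_recl.
by congr (_ + _)%E; exact: (congr1 (@^~ A) nuE).
Qed.

Section discrete_charge.
Variables (s : nat) (a t : 'I_s -> R).

Let discrete0 : discrete_measure a t set0 = 0%E.
Proof. by have [nu ->] := discrete_measure_charge a t; rewrite charge0. Qed.

Let discrete_fin A : measurable A -> discrete_measure a t A \is a fin_num.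
Proof.
by have [nu ->] := discrete_measure_charge a t; apply: fin_num_measure.
Qed.

Let discrete_sigma_additive : semi_sigma_additive (discrete_measure a t).
Proof.
by have [nu ->] := discrete_measure_charge a t;
  exact: charge_semi_sigma_additive.
Qed.

HB.instance Definition _ := isCharge.Build _ _ _ (discrete_measure a t)
  discrete0 discrete_fin discrete_sigma_additive.

End discrete_charge.

End signed_measures.

Section chebyshev_blasso.
Context (R : realType).
Implicit Types (mu nu : {charge set R -> \bar R}) (T : {fset R}).

Definition rho (u v : R) : R := `|acos u - acos v|.

Definition chebyshev (k : nat) (x : R) : R := cos (k%:R * acos x).

(* acos is unspecified outside of [-1, 1]; phi is only integrated over [-1, 1]. *)
Definition phi (k : nat) (x : R) : R :=
  if k == 0%N then 1 else Num.sqrt 2 * chebyshev k x.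

Definition moment (k : nat) mu : R := charge_Rintegral mu `[-1, 1] (phi k).

(* The unit +oo of the iterated minima is the value of an empty minimum. *)
Definition Delta T : \bar R :=
  \big[mine/+oo%E]_(u <- T) \big[mine/+oo%E]_(v <- T | u != v)
    (Num.min (rho u v) (pi - rho u v))%:E.

Definition edge_dist T : \bar R :=
  \big[mine/+oo%E]_(u <- T | (u != -1) && (u != 1))
    (Num.min (rho u 1) (rho u (-1)))%:E.

Definition feasible (d : int) nu mu : Prop :=
  signed_measure_on_I mu /\
  forall k : nat, k%:Z <= d -> moment k mu = moment k nu.

Definition objective (m : nat) (y : 'I_m.+1 -> R) (lambda : R) mu : \bar R :=
  ((2^-1 * \sum_(k < m.+1) (moment k mu - y k) ^+ 2)%:E
   + lambda%:E * TV_norm mu)%E.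

Definition is_solution (m : nat) (d : int) nu (y : 'I_m.+1 -> R) (lambda : R)
    mu : Prop :=
  feasible d nu mu /\
  forall mu' : {charge set R -> \bar R}, feasible d nu mu' ->
    (objective y lambda mu <= objective y lambda mu')%E.

End chebyshev_blasso.

Definition mutually_independent (R : realType) (disp : measure_display)
    (Omega : measurableType disp) (P : probability Omega R) (I : finType)
    (D : {set I}) (X : I -> {RV P >-> R}) : Prop :=
  forall (J : {set I}) (B : I -> set R),
    J \subset D -> (forall i, measurable (B i)) ->
    P (\bigcap_(i in [set` J]) (X i @^-1` B i))
    = (\prod_(i in J) P (X i @^-1` B i))%E.

Definition admissible_spikes (R : realType) (s : nat) (a t : 'I_s -> R) : Prop :=
  [/\ injective t, forall k, a k != 0 & forall k, -1 <= t k <= 1].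

(* Main.v *)
Require Import Defs.
From mathcomp Require Import ring lra zify measurable_realfun.
Import Order.TTheory GRing.Theory Num.Theory.
Import numFieldNormedType.Exports.
Set Implicit Arguments.
Unset Strict Implicit.
Unset Printing Implicit Defensive.
Local Open Scope classical_set_scope.
Local Open Scope ring_scope.

(** The angle [theta = acos t] turns [phi k] into [cos (k theta)], up to a constant
factor, so the functions [\sum_(k <= m) al k * phi k] become the even
trigonometric polynomials of degree at most [m]. The hypothesis on [Delta] and
[edge_dist] says that the points [+- theta_i] are [5 pi / m]-separated on the
circle: [Delta] separates [theta_i] from [+- theta_j], and twice the edge
distance separates [theta_i] from [- theta_i].

Dual certificates. For every choice of signs [v_i] there is an even
trigonometric polynomial [D] of degree at most [m], bounded by 1, with
[D (theta_i) = v_i], such that [1 - |D|] dominates a multiple of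
[min (m^2 dist (., theta)^2, c^2)] ([dual_certificate]). It comes from a
polynomial of the form
[\sum_j (al_j J (theta - tau_j) + b_j J' (theta - tau_j))] on the circle
([torus_certificate]), made even by averaging ([even_certificate]). Here [J] is
the square of a Fejer kernel of degree about [m / 2]. Away from the origin [J]
and its derivatives decay like the fourth power of the distance
([jackson_tail]), so the separation makes the contribution of distant points
small ([packing]) and the interpolation conditions diagonally dominant
([interpolant_coef]). Since [D] is bounded by 1, Parseval's formula bounds by 1
the Euclidean norm of its coefficients [al] ([parseval_cos]).

Recovery. Write [r] for the difference between the moments of the solution and
those of the spikes. Optimality of the solution against the spikes themselves,
together with [|e| <= lambda / 2] for the noise vector [e], gives
[|r|^2 / 2 + lambda * gap <= <r, e - lambda al> <= 3/2 lambda |r|], where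
[gap >= 0] is the total variation of the solution minus the integral of [D]
against it. Hence [|r| <= 3 lambda] and [gap <= 9/8 lambda]; as [1 - |D|] is
bounded below, the gap controls the weighted distances in (i)
([gap_and_residual]). For (ii), half the difference of two certificates whose
signs differ at [theta_i] only equals [+- 1] at [theta_i] and 0 at the other
spikes; integrating it against both measures compares [a_i] with the mass of
the solution near [theta_i] ([local_control]). If no atom of the solution were
near a large spike, (ii) would put so much mass at a positive distance that (i)
would fail, which is (iii) ([large_spike]).

Existence. Any [m + 1] moments of a signed measure are those of [m + 1]
weighted atoms with no more total variation ([represent], [charge_atoms]). The
program can thus be solved over a compact set of weights and angles
([blasso_solution]).

Noise. A Gaussian tail bound and a union bound over the [m - d] noisy
coordinates give [|e| <= lambda0 / 2] with the announced probability
([noise_event]). *)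

(** * Bounds for sine and cosine *)

Section calculus.
Variable R : realType.
Implicit Types (f g : R -> R) (x y u : R).

Lemma is_derive_continuous f df : (forall x, is_derive x (1:R) f (df x)) ->
  continuous f.
Proof.
move=> fd x; apply/differentiable_continuous/derivable1_diffP.
by have [] := fd x.
Qed.

Lemma le_of_derive f df a b : (forall x, is_derive x (1:R) f (df x)) ->
  (forall x, a <= x <= b -> 0 <= df x) -> a <= b -> f a <= f b.
Proof.
move=> fd df0; rewrite le_eqVlt => /predU1P[->//|ab].
have [|c] := @MVT R f df a b ab (fun x _ => fd x).
  by apply: continuous_subspaceT; apply: is_derive_continuous fd.
rewrite in_itv /= => /andP[ac cb] E; rewrite -subr_ge0 E.
by rewrite mulr_ge0 ?subr_ge0 ?df0 ?(ltW ac) ?(ltW cb) ?(ltW ab).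
Qed.

Lemma sin_le y : 0 <= y -> sin y <= y.
Proof.
move=> y0; rewrite -subr_ge0.
suff : (fun x => x - sin x) 0 <= (fun x => x - sin x) y by rewrite /= sin0 subrr.
have d x : is_derive x (1 : R) (fun x => x - sin x) (1 - cos x).
  by apply: is_derive_eq.
apply: (le_of_derive d _ y0) => x _.
by rewrite subr_ge0 cos_le1.
Qed.

(** This bound and the next four integrate one another in turn, starting from
[cos <= 1]: the difference vanishes at 0 and the previous bound signs its
derivative. *)
Lemma cos_ge2 y : 1 - y ^+ 2 / 2 <= cos y.
Proof.
wlog y0 : y / 0 <= y.
  move=> H; have [|/ltW y0] := leP 0 y; first exact: H.
  by have := H (- y); rewrite cosN sqrrN; apply; lra.
rewrite -subr_ge0.
suff : (fun x => cos x - (1 - x ^+ 2 / 2)) 0 <= (fun x => cos x - (1 - x ^+ 2 / 2)) y.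
  by rewrite /= cos0; lra.
have d x : is_derive x (1 : R) (fun x => cos x - (1 - x ^+ 2 / 2)) (x - sin x).
  by apply: is_derive_eq; rewrite /GRing.scale /=; field.
apply: (le_of_derive d _ y0) => x /andP[x0 _].
by rewrite subr_ge0 sin_le.
Qed.

Lemma sin_ge3 y : 0 <= y -> y - y ^+ 3 / 6 <= sin y.
Proof.
move=> y0; rewrite -subr_ge0.
suff : (fun x => sin x - (x - x ^+ 3 / 6)) 0 <= (fun x => sin x - (x - x ^+ 3 / 6)) y.
  by rewrite /= sin0; lra.
have d x : is_derive x (1 : R) (fun x => sin x - (x - x ^+ 3 / 6)) (cos x - (1 - x ^+ 2 / 2)).
  by apply: is_derive_eq; rewrite /GRing.scale /=; field.
apply: (le_of_derive d _ y0) => x _.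
by rewrite subr_ge0 cos_ge2.
Qed.

Lemma cos_le4 y : cos y <= 1 - y ^+ 2 / 2 + y ^+ 4 / 24.
Proof.
wlog y0 : y / 0 <= y.
  move=> H; have [|/ltW y0] := leP 0 y; first exact: H.
  have := H (- y); rewrite cosN sqrrN (_ : (- y) ^+ 4 = y ^+ 4); last by ring.
  by apply; lra.
rewrite -subr_ge0.
pose F x := 1 - x ^+ 2 / 2 + x ^+ 4 / 24 - cos x.
suff : F 0 <= F y by rewrite /F cos0; lra.
have d x : is_derive x (1 : R) (F) (sin x - (x - x ^+ 3 / 6)).
  by apply: is_derive_eq; rewrite /GRing.scale /=; field.
apply: (le_of_derive d _ y0) => x /andP[x0 _].
by rewrite subr_ge0 sin_ge3.
Qed.

Lemma sin_le5 y : 0 <= y -> sin y <= y - y ^+ 3 / 6 + y ^+ 5 / 120.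
Proof.
move=> y0; rewrite -subr_ge0.
pose F x := x - x ^+ 3 / 6 + x ^+ 5 / 120 - sin x.
suff : F 0 <= F y by rewrite /F sin0; lra.
have d x : is_derive x (1 : R) (F) (1 - x ^+ 2 / 2 + x ^+ 4 / 24 - cos x).
  by apply: is_derive_eq; rewrite /GRing.scale /=; field.
apply: (le_of_derive d _ y0) => x _.
by rewrite subr_ge0 cos_le4.
Qed.

Lemma cos_ge6 y : 0 <= y ->
  1 - y ^+ 2 / 2 + y ^+ 4 / 24 - y ^+ 6 / 720 <= cos y.
Proof.
move=> y0; rewrite -subr_ge0.
have [c c120] : {c : R | c = 120^-1} by exists 120^-1.
pose F x := cos x - (1 - x ^+ 2 / 2 + x ^+ 4 / 24 - x ^+ 6 * (c / 6)).
have -> : y ^+ 6 / 720 = y ^+ 6 * (c / 6).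
  by congr (_ * _); rewrite c120 -invfM -natrM.
suff : F 0 <= F y by rewrite /F cos0; lra.
have d x : is_derive x (1 : R) F (x - x ^+ 3 / 6 + x ^+ 5 * c - sin x).
  by apply: is_derive_eq; rewrite /GRing.scale /=; field.
apply: (le_of_derive d _ y0) => x /andP[x0 _].
by rewrite subr_ge0 c120 sin_le5.
Qed.

(** [cos] is positive at [31 / 20], by its Taylor bound of order 6, so its zero
[pi / 2] lies beyond. *)
Lemma pi_ge31 : 31 / 10 <= pi :> R.
Proof.
rewrite leNgt; apply/negP => pi31.
have cpos : 0 < cos (31 / 20 : R).
  by apply: lt_le_trans (@cos_ge6 (31 / 20) _); lra.
have hpi : 0 < pi / 2 :> R by rewrite divr_gt0 ?pi_gt0.
have : cos (31 / 20 : R) < cos (pi / 2).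
  by rewrite ltr_cos ?in_itv/=; have := pi_ge2 R; lra.
by rewrite cos_pihalf; lra.
Qed.

Lemma norm_sin_le y : `|sin y| <= `|y|.
Proof.
wlog y0 : y / 0 <= y.
  move=> H; have [|/ltW y0] := leP 0 y; first exact: H.
  by have := H (- y); rewrite sinN !normrN; apply; lra.
rewrite (ger0_norm y0) ler_norml sin_le // andbT.
have [y1|y1] := leP y 1; last first.
  have := sin_geN1 y; lra.
have := sin_ge3 y0; have : 0 <= y ^+ 3 <= y ; last lra.
by rewrite exprn_ge0 //= exprS ler_piMr // expr_le1.
Qed.

End calculus.

(** * The Fejer kernel and its derivatives *)

Section kernel.
Variables (R : realType) (n : nat).
Hypothesis n0 : (0 < n)%N.
Implicit Types (u x : R) (r : nat).

Let n_neq0 : n%:R != 0 :> R. Proof. by rewrite pnatr_eq0 -lt0n. Qed.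

(** Coefficients of the Fejer kernel of degree less than [n], scaled so that the
kernel is 1 at the origin ([fejer_coef_sums]). *)
Definition fejer_coef (k : nat) : R :=
  (if k == 0%N then n%:R else 2 * (n%:R - k%:R)) / n%:R ^+ 2.

(** The derivative of order [r] of the Fejer kernel with respect to [n * u]: each
derivation shifts the phase by [pi / 2] and brings a factor [k / n]. *)
Definition fejer r u : R :=
  \sum_(k < n) fejer_coef k * (k%:R / n%:R) ^+ r * cos (k%:R * u + r%:R * (pi / 2)).

Lemma fejer_coef_ge0 k : (k < n)%N -> 0 <= fejer_coef k.
Proof.
move=> kn; rewrite /fejer_coef mulr_ge0 ?invr_ge0 ?exprn_ge0 //.
by case: ifP => // _; rewrite mulr_ge0 // subr_ge0 ler_nat ltnW.
Qed.

Lemma is_derive_fejer r u : is_derive u (1 : R) (fejer r) (n%:R * fejer r.+1 u).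
Proof.
have -> : fejer r = \sum_(k < n)
    (fun u => fejer_coef k * (k%:R / n%:R) ^+ r * cos (k%:R * u + r%:R * (pi / 2))).
  by apply/funext => x; rewrite fct_sumE.
have -> : n%:R * fejer r.+1 u = \sum_(k < n) fejer_coef k * (k%:R / n%:R) ^+ r *
    (- sin (k%:R * u + r%:R * (pi / 2)) * k%:R).
  rewrite /fejer mulr_sumr; apply: eq_bigr => k _.
  rewrite -[r.+1%:R]natr1 mulrDl mul1r addrA cosDpihalf exprS.
  by field.
apply: is_derive_sum => k.
have d1 : is_derive u (1 : R) (fun u => k%:R * u + r%:R * (pi / 2)) k%:R.
  by apply: is_derive_eq; rewrite /GRing.scale /= mulr1 addr0.
have d2 := is_derive1_comp (is_derive_cos _) d1.
have := is_deriveZ (fejer_coef k * (k%:R / n%:R) ^+ r) d2.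
by [].
Qed.

Lemma fejer0E u : fejer 0 u = \sum_(k < n) fejer_coef k * cos (k%:R * u).
Proof. by apply: eq_bigr => k _; rewrite expr0 mulr1 mul0r addr0. Qed.

Lemma fejer1E u : fejer 1 u = - \sum_(k < n) fejer_coef k * (k%:R / n%:R) * sin (k%:R * u).
Proof.
rewrite -sumrN; apply: eq_bigr => k _.
by rewrite expr1 mul1r cosDpihalf mulrN.
Qed.

Lemma fejer2E u : fejer 2 u = - \sum_(k < n) fejer_coef k * (k%:R / n%:R) ^+ 2 * cos (k%:R * u).
Proof.
rewrite -sumrN; apply: eq_bigr => k _.
by rewrite (_ : 2 * (pi / 2) = pi :> R) ?cosDpi ?mulrN //; field.
Qed.

Lemma fejer3E u : fejer 3 u = \sum_(k < n) fejer_coef k * (k%:R / n%:R) ^+ 3 * sin (k%:R * u).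
Proof.
apply: eq_bigr => k _.
rewrite (_ : k%:R * u + 3 * (pi / 2) = k%:R * u + pi / 2 + pi); last by field.
by rewrite cosDpi cosDpihalf opprK.
Qed.

(** The classical closed form [(sin (n u / 2) / (n sin (u / 2)))^2], freed of its
denominator so that it can be differentiated at every point. The next three
lemmas are its successive derivatives. *)
Lemma fejer_closed u : n%:R ^+ 2 * fejer 0 u * (1 - cos u) = 1 - cos (n%:R * u).
Proof.
(* Summation by the Dirichlet kernel, then over its order. *)
have dirichlet j : (1 + \sum_(1 <= k < j.+1) 2 * cos (k%:R * u)) * (1 - cos u)
    = cos (j%:R * u) - cos (j.+1%:R * u).
  elim: j => [|j IH]; first by rewrite big_nil mul0r cos0 mul1r addr0 mul1r.
  rewrite big_nat_recr //= addrA mulrDl IH.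
  have -> : j%:R * u = j.+1%:R * u - u by rewrite -natr1; ring.
  have -> : j.+2%:R * u = j.+1%:R * u + u by rewrite -(natr1 j.+1); ring.
  by rewrite cosB cosD; ring.
have fejer_dirichlet j : j%:R + \sum_(1 <= k < j) 2 * (j%:R - k%:R) * cos (k%:R * u)
    = \sum_(0 <= i < j) (1 + \sum_(1 <= k < i.+1) 2 * cos (k%:R * u)).
  elim: j => [|j IH]; first by rewrite 2?big_geq // addr0.
  rewrite [RHS]big_nat_recr //= -IH -natr1.
  case: j {IH} => [|j]; first by rewrite 3?big_geq // ; ring.
  rewrite !(@big_nat_recr _ _ _ j.+1) //=.
  under eq_bigr do rewrite addrAC mulrDr mulrDl mulr1.
  rewrite big_split /=; ring.
have -> : n%:R ^+ 2 * fejer 0 u =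
    n%:R + \sum_(1 <= k < n) 2 * (n%:R - k%:R) * cos (k%:R * u).
  rewrite fejer0E -(big_mkord xpredT (fun k => fejer_coef k * cos (k%:R * u))).
  rewrite big_ltn // mulrDr mul0r cos0 /fejer_coef eqxx; congr (_ + _); first by field.
  rewrite mulr_sumr; apply: eq_big_nat => k /andP[k1 _].
  by rewrite eqn0Ngt k1 /=; field.
rewrite fejer_dirichlet mulr_suml.
under eq_bigr do rewrite dirichlet -opprB.
by rewrite sumrN telescope_sumr // mul0r cos0 opprB.
Qed.

Lemma fejer_closed1 u :
  n%:R ^+ 2 * fejer 1 u * (1 - cos u) + n%:R * fejer 0 u * sin u = sin (n%:R * u).
Proof.
pose F u := n%:R ^+ 2 * fejer 0 u * (1 - cos u) - (1 - cos (n%:R * u)).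
have F0 : F = cst 0 by apply/funext => x; rewrite /F fejer_closed subrr.
have dn : is_derive u (1 : R) (fun u => n%:R * u : R) n%:R.
  by apply: is_derive_eq; rewrite /GRing.scale /= mulr1.
have dc := is_derive1_comp (is_derive_cos _) dn.
have df := is_derive_fejer 0 u.
have : is_derive u (1 : R) F (n%:R * (n%:R ^+ 2 * fejer 1 u * (1 - cos u) +
    n%:R * fejer 0 u * sin u - sin (n%:R * u))).
  by apply: is_derive_eq; rewrite /GRing.scale /=; ring.
rewrite F0 => d0; have := @derive_val _ _ _ _ _ _ _ d0.
rewrite derive_cst => /esym/eqP; rewrite mulf_eq0 (negbTE n_neq0) /=.
by rewrite subr_eq0 => /eqP.
Qed.

Lemma fejer_closed2 u :
  n%:R ^+ 2 * fejer 2 u * (1 - cos u) + 2 * n%:R * fejer 1 u * sin u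
  + fejer 0 u * cos u = cos (n%:R * u).
Proof.
pose F u := n%:R ^+ 2 * fejer 1 u * (1 - cos u) + n%:R * fejer 0 u * sin u
  - sin (n%:R * u).
have F0 : F = cst 0 by apply/funext => x; rewrite /F fejer_closed1 subrr.
have dn : is_derive u (1 : R) (fun u => n%:R * u : R) n%:R.
  by apply: is_derive_eq; rewrite /GRing.scale /= mulr1.
have dc := is_derive1_comp (is_derive_sin _) dn.
have df := is_derive_fejer 0 u.
have df1 := is_derive_fejer 1 u.
have : is_derive u (1 : R) F (n%:R * (n%:R ^+ 2 * fejer 2 u * (1 - cos u) +
    2 * n%:R * fejer 1 u * sin u + fejer 0 u * cos u - cos (n%:R * u))).
  by apply: is_derive_eq; rewrite /GRing.scale /=; ring.
rewrite F0 => d0; have := @derive_val _ _ _ _ _ _ _ d0.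
rewrite derive_cst => /esym/eqP; rewrite mulf_eq0 (negbTE n_neq0) /=.
by rewrite subr_eq0 => /eqP.
Qed.

Lemma fejer_closed3 u :
  n%:R ^+ 2 * fejer 3 u * (1 - cos u) + 3 * n%:R * fejer 2 u * sin u
  + 3 * fejer 1 u * cos u - fejer 0 u * sin u / n%:R = - sin (n%:R * u).
Proof.
pose F u := n%:R ^+ 2 * fejer 2 u * (1 - cos u) + 2 * n%:R * fejer 1 u * sin u
  + fejer 0 u * cos u - cos (n%:R * u).
have F0 : F = cst 0 by apply/funext => x; rewrite /F fejer_closed2 subrr.
have dn : is_derive u (1 : R) (fun u => n%:R * u : R) n%:R.
  by apply: is_derive_eq; rewrite /GRing.scale /= mulr1.
have dc := is_derive1_comp (is_derive_cos _) dn.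
have df := is_derive_fejer 0 u.
have df1 := is_derive_fejer 1 u.
have df2 := is_derive_fejer 2 u.
have : is_derive u (1 : R) F (n%:R * (n%:R ^+ 2 * fejer 3 u * (1 - cos u) +
    3 * n%:R * fejer 2 u * sin u + 3 * fejer 1 u * cos u
    - fejer 0 u * sin u / n%:R + sin (n%:R * u))).
  by apply: is_derive_eq; rewrite /GRing.scale /=; field.
rewrite F0 => d0; have := @derive_val _ _ _ _ _ _ _ d0.
rewrite derive_cst => /esym/eqP; rewrite mulf_eq0 (negbTE n_neq0) /=.
by rewrite addr_eq0 => /eqP.
Qed.

(** These moments give the Taylor expansion of the kernel at the origin. *)
Lemma fejer_coef_sums : [/\ \sum_(k < n) fejer_coef k = 1,
  \sum_(k < n) fejer_coef k * (k%:R / n%:R) ^+ 2 = (1 - n%:R ^- 2) / 6 &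
  \sum_(k < n) fejer_coef k * (k%:R / n%:R) ^+ 4 =
    (n%:R ^+ 4 - n%:R ^+ 2 * (5 / 2) + 3 / 2) / (15 * n%:R ^+ 4)].
Proof.
have sums j : [/\ \sum_(0 <= k < j) (k%:R : R) = j%:R * (j%:R - 1) / 2,
    \sum_(0 <= k < j) (k%:R ^+ 2 : R) = j%:R * (j%:R - 1) * (2 * j%:R - 1) / 6,
    \sum_(0 <= k < j) (k%:R ^+ 3 : R) = j%:R ^+ 2 * (j%:R - 1) ^+ 2 / 4,
    \sum_(0 <= k < j) (k%:R ^+ 4 : R) =
      j%:R ^+ 5 / 5 - j%:R ^+ 4 / 2 + j%:R ^+ 3 / 3 - j%:R / 30 &
    \sum_(0 <= k < j) (k%:R ^+ 5 : R) =
      j%:R ^+ 6 / 6 - j%:R ^+ 5 / 2 + j%:R ^+ 4 * (5 / 12) - j%:R ^+ 2 / 12].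
  elim: j => [|j [I1 I2 I3 I4 I5]]; first by rewrite !big_geq //; split; field.
  by rewrite !big_nat_recr //= I1 I2 I3 I4 I5 -natr1; split; field.
have [s1 s2 s3 s4 s5] := sums n.
have E r : \sum_(k < n) fejer_coef k * (k%:R / n%:R) ^+ r =
    (n%:R * (0 ^+ r) - 2 * n%:R * 0 ^+ r
     + 2 * (n%:R * \sum_(0 <= k < n) (k%:R ^+ r : R)
     - \sum_(0 <= k < n) (k%:R ^+ r.+1 : R))) / n%:R ^+ (r + 2).
  rewrite -(big_mkord xpredT (fun k => fejer_coef k * (k%:R / n%:R) ^+ r)).
  rewrite mulr_sumr -sumrB big_ltn // [in RHS]big_ltn //.
  rewrite mulr0n mul0r /fejer_coef eqxx.
  have -> : \sum_(1 <= k < n) (if k == 0%N then n%:R else 2 * (n%:R - k%:R))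
      / n%:R ^+ 2 * (k%:R / n%:R) ^+ r
    = 2 * (\sum_(1 <= k < n) (n%:R * k%:R ^+ r - (k%:R : R) ^+ r.+1)) / n%:R ^+ (r + 2).
    rewrite mulr_sumr mulr_suml; apply: eq_big_nat => k /andP[k1 _].
    rewrite eqn0Ngt k1 /= exprD [_ ^+ r.+1]exprS expr_div_n; field.
    by rewrite n_neq0 expf_neq0.
  rewrite [0 ^+ r.+1]exprS [n%:R ^+ (r + 2)]exprD; case: r => [|r]; last first.
    by rewrite ![0 ^+ r.+1]exprS !mul0r; field; rewrite n_neq0 expf_neq0.
  by rewrite !expr0; field.
split.
- transitivity (\sum_(k < n) fejer_coef k * (k%:R / n%:R) ^+ 0).
    by apply: eq_bigr => k _; rewrite expr0 mulr1.
  have -> : \sum_(k < n) fejer_coef k * (k%:R / n%:R) ^+ 0 =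
    (n%:R - 2 * n%:R + 2 * (n%:R * n%:R - n%:R * (n%:R - 1) / 2)) / n%:R ^+ 2.
    rewrite E s1 !expr0 !mulr1; congr ((_ + 2 * (n%:R * _ - _)) / _).
    by under eq_bigr do rewrite expr0; rewrite sumr_const_nat subn0.
  by field.
- by rewrite E s2 s3 !exprS !mul0r expr0; field.
- by rewrite E s4 s5 [0 ^+ 4]exprS !mul0r; field.
Qed.

End kernel.

Section kernel_bounds.
Variables (R : realType) (n : nat).
Hypothesis n65 : (65 <= n)%N.
Implicit Types (u x : R) (r : nat).

Let n_gt0 : (0 < n)%N. Proof. exact: leq_trans n65. Qed.
Let nR : 65 <= n%:R :> R. Proof. by rewrite (ler_nat R 65). Qed.
Let n_neq0 : n%:R != 0 :> R. Proof. by rewrite pnatr_eq0 -lt0n. Qed.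

Lemma sum_coef_le (f g : 'I_n -> R) : (forall k, f k <= g k) ->
  \sum_(k < n) fejer_coef R n k * f k <= \sum_(k < n) fejer_coef R n k * g k.
Proof. by move=> fg; apply: ler_sum => k _; rewrite ler_wpM2l ?fejer_coef_ge0. Qed.

Lemma fejer0_norm u : `|fejer n 0 u| <= 1.
Proof.
have [<- _ _] := fejer_coef_sums R n_gt0.
rewrite fejer0E (le_trans (ler_norm_sum _ _ _))//; apply: ler_sum => k _.
by rewrite normrM ger0_norm ?fejer_coef_ge0// ler_piMr ?fejer_coef_ge0 ?cos_max.
Qed.

Let scaled k u : k%:R * u = (k%:R / n%:R) * (n%:R * u).
Proof. by field. Qed.

Lemma fejer0_ge u : 1 - (n%:R * u) ^+ 2 / 12 <= fejer n 0 u.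
Proof.
have [s0 s2 _] := fejer_coef_sums R n_gt0.
rewrite fejer0E.
apply: (@le_trans _ _ (\sum_(k < n) fejer_coef R n k * (1 - (k%:R * u) ^+ 2 / 2))); last first.
  by apply: sum_coef_le => k; exact: cos_ge2.
have -> : \sum_(k < n) fejer_coef R n k * (1 - (k%:R * u) ^+ 2 / 2) =
   (\sum_(k < n) fejer_coef R n k) - (n%:R * u) ^+ 2 / 2 *
   (\sum_(k < n) fejer_coef R n k * (k%:R / n%:R) ^+ 2).
  rewrite mulr_sumr -sumrB; apply: eq_bigr => k _.
  by rewrite scaled; ring.
rewrite s0 s2 lerD2l lerN2.
have := sqr_ge0 (n%:R * u); set X := _ ^+ 2 => X0.
have : 0 <= n%:R ^- 2 :> R by rewrite invr_ge0 exprn_ge0.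
set w := n%:R ^- 2 => w0; have := mulr_ge0 X0 w0; lra.
Qed.

Lemma sum_coef4_le : \sum_(k < n) fejer_coef R n k * (k%:R / n%:R) ^+ 4 <= 15^-1.
Proof.
have [_ _ ->] := fejer_coef_sums R n_gt0.
have n2 : 65 * 65 <= n%:R ^+ 2 :> R by rewrite expr2 ler_pM.
rewrite ler_pdivrMr ?mulr_gt0 ?exprn_gt0 ?ltr0n //; lra.
Qed.

Lemma fejer0_le u :
  fejer n 0 u <= 1 - (n%:R * u) ^+ 2 * (1 - n%:R ^- 2) / 12 + (n%:R * u) ^+ 4 / 360.
Proof.
have [s0 s2 s4] := fejer_coef_sums R n_gt0.
rewrite fejer0E.
apply: (@le_trans _ _ (\sum_(k < n) fejer_coef R n k * (1 - (k%:R * u) ^+ 2 / 2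
    + (k%:R * u) ^+ 4 / 24))).
  by apply: sum_coef_le => k; exact: cos_le4.
have -> : \sum_(k < n) fejer_coef R n k * (1 - (k%:R * u) ^+ 2 / 2 + (k%:R * u) ^+ 4 / 24) =
   (\sum_(k < n) fejer_coef R n k) - (n%:R * u) ^+ 2 / 2 *
   (\sum_(k < n) fejer_coef R n k * (k%:R / n%:R) ^+ 2) + (n%:R * u) ^+ 4 / 24 *
   (\sum_(k < n) fejer_coef R n k * (k%:R / n%:R) ^+ 4).
  rewrite !mulr_sumr -sumrB -big_split /=; apply: eq_bigr => k _.
  by rewrite scaled; field.
rewrite s0 s2; have : 0 <= (n%:R * u) ^+ 4 by rewrite exprn_even_ge0.
by move=> /ler_wpM2l /(_ _ _ sum_coef4_le); lra.
Qed.

Lemma fejer1_norm u : `|fejer n 1 u| <= `|n%:R * u| / 6.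
Proof.
have [_ s2 _] := fejer_coef_sums R n_gt0.
have : `|fejer n 1 u| <= `|n%:R * u| * \sum_(k < n) fejer_coef R n k * (k%:R / n%:R) ^+ 2.
  rewrite fejer1E normrN mulr_sumr (le_trans (ler_norm_sum _ _ _))//.
  apply: ler_sum => k _; have k0 := fejer_coef_ge0 R (ltn_ord k).
  rewrite normrM (ger0_norm (mulr_ge0 k0 _)) ?divr_ge0 //.
  have -> : `|n%:R * u| * (fejer_coef R n k * (k%:R / n%:R) ^+ 2) =
     (fejer_coef R n k * (k%:R / n%:R)) * (k%:R / n%:R * `|n%:R * u|) by ring.
  rewrite ler_wpM2l ?(mulr_ge0 k0) ?divr_ge0 //.
  have kn0 : 0 <= k%:R / n%:R :> R by rewrite divr_ge0.
  by rewrite (le_trans (norm_sin_le _)) // scaled normrM ler_wpM2r // ger0_norm.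
move/le_trans; apply; rewrite s2 ler_wpM2l //.
have : 0 <= n%:R ^- 2 :> R by rewrite invr_ge0 exprn_ge0.
lra.
Qed.

Lemma fejer2_norm u : `|fejer n 2 u| <= 6^-1.
Proof.
have [_ s2 _] := fejer_coef_sums R n_gt0.
rewrite fejer2E normrN (le_trans (ler_norm_sum _ _ _))//.
apply: (@le_trans _ _ (\sum_(k < n) fejer_coef R n k * (k%:R / n%:R) ^+ 2)).
  apply: ler_sum => k _; have k0 := fejer_coef_ge0 R (ltn_ord k).
  rewrite normrM ger0_norm ?(mulr_ge0 k0) ?sqr_ge0 // ler_piMr ?cos_max //.
  by rewrite (mulr_ge0 k0) ?sqr_ge0.
have : 0 <= n%:R ^- 2 :> R by rewrite invr_ge0 exprn_ge0.
rewrite s2; lra.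
Qed.

Lemma fejer2_le u : fejer n 2 u <= - (1 - n%:R ^- 2) / 6 + (n%:R * u) ^+ 2 / 30.
Proof.
have [_ s2 s4] := fejer_coef_sums R n_gt0.
rewrite fejer2E.
have : \sum_(k < n) fejer_coef R n k * ((k%:R / n%:R) ^+ 2 * (1 - (k%:R * u) ^+ 2 / 2))
    <= \sum_(k < n) fejer_coef R n k * ((k%:R / n%:R) ^+ 2 * cos (k%:R * u)).
  by apply: sum_coef_le => k; rewrite ler_wpM2l ?sqr_ge0 ?cos_ge2.
under [X in _ <= X]eq_bigr do rewrite mulrA.
have -> : \sum_(k < n) fejer_coef R n k * ((k%:R / n%:R) ^+ 2 * (1 - (k%:R * u) ^+ 2 / 2)) =
   (\sum_(k < n) fejer_coef R n k * (k%:R / n%:R) ^+ 2) - (n%:R * u) ^+ 2 / 2 *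
   (\sum_(k < n) fejer_coef R n k * (k%:R / n%:R) ^+ 4).
  rewrite !mulr_sumr -sumrB; apply: eq_bigr => k _.
  by rewrite scaled; field.
rewrite s2; have := sqr_ge0 (n%:R * u); move=> /ler_wpM2l /(_ _ _ sum_coef4_le); lra.
Qed.

Lemma fejer3_norm u : `|fejer n 3 u| <= `|n%:R * u| / 15.
Proof.
have : `|fejer n 3 u| <= `|n%:R * u| * \sum_(k < n) fejer_coef R n k * (k%:R / n%:R) ^+ 4.
  rewrite fejer3E mulr_sumr (le_trans (ler_norm_sum _ _ _))//.
  apply: ler_sum => k _; have k0 := fejer_coef_ge0 R (ltn_ord k).
  have kn0 : 0 <= k%:R / n%:R :> R by rewrite divr_ge0.
  rewrite normrM (ger0_norm (mulr_ge0 k0 _)) ?exprn_ge0 //.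
  have -> : `|n%:R * u| * (fejer_coef R n k * (k%:R / n%:R) ^+ 4) =
     (fejer_coef R n k * (k%:R / n%:R) ^+ 3) * (k%:R / n%:R * `|n%:R * u|) by ring.
  rewrite ler_wpM2l ?(mulr_ge0 k0) ?exprn_ge0 //.
  by rewrite (le_trans (norm_sin_le _)) // scaled normrM ler_wpM2r // ger0_norm.
by move/le_trans; apply; rewrite ler_wpM2l ?sum_coef4_le.
Qed.

End kernel_bounds.

(** * The squared Fejer kernel *)

Section jackson.
Variables (R : realType) (n : nat).
Hypothesis n65 : (65 <= n)%N.
Implicit Types (u x zeta : R) (r : nat).

Let n_gt0 : (0 < n)%N. Proof. exact: leq_trans n65. Qed.
Let nR : 65 <= n%:R :> R. Proof. by rewrite (ler_nat R 65). Qed.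
Let n_neq0 : n%:R != 0 :> R. Proof. by rewrite pnatr_eq0 -lt0n. Qed.

(** The square of the Fejer kernel and its first three derivatives with respect to
[n * u], by Leibniz' rule. *)
Definition jackson r u : R :=
  match r with
  | 0 => fejer n 0 u ^+ 2
  | 1 => 2 * fejer n 0 u * fejer n 1 u
  | 2 => 2 * fejer n 1 u ^+ 2 + 2 * fejer n 0 u * fejer n 2 u
  | _ => 6 * fejer n 1 u * fejer n 2 u + 2 * fejer n 0 u * fejer n 3 u
  end.

Lemma is_derive_jackson r u : (r < 3)%N ->
  is_derive u (1 : R) (jackson r) (n%:R * jackson r.+1 u).
Proof.
have d0 := is_derive_fejer n_gt0 0 u.
have d1 := is_derive_fejer n_gt0 1 u.
have d2 := is_derive_fejer n_gt0 2 u.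
by case: r => [|[|[|//]]] _; apply: is_derive_eq; rewrite /GRing.scale /=; ring.
Qed.

(** The bounds that [fejer_tail] gives for the derivatives of the Fejer kernel,
combined as in [jackson]. *)
Definition tail_coef (zeta : R) r : R :=
  let a1 := 2^-1 + zeta in
  let a2 := (1 + 4 * zeta * a1 + zeta ^+ 2) / 2 in
  let a3 := (1 + 6 * zeta * a2 + 3 * zeta ^+ 2 * a1 + zeta / 40) / 2 in
  match r with
  | 0 => 1
  | 1 => 2 * a1
  | 2 => 2 * a1 ^+ 2 + 2 * a2
  | _ => 6 * a1 * a2 + 2 * a3
  end.

(** With [z = n |sin (u / 2)|] one has [n^2 (1 - cos u) = 2 z^2] and
[n |sin u| <= 2 z]. Each differentiated closed form therefore bounds a
derivative of the kernel, times [2 z^2], by a bounded trigonometric term plus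
the bounds on the lower derivatives. *)
Lemma fejer_tail zeta u : 0 < `|n%:R * sin (u / 2)| ->
  `|n%:R * sin (u / 2)|^-1 <= zeta ->
  let w := (n%:R * sin (u / 2)) ^- 2 in
  let a1 := 2^-1 + zeta in
  let a2 := (1 + 4 * zeta * a1 + zeta ^+ 2) / 2 in
  let a3 := (1 + 6 * zeta * a2 + 3 * zeta ^+ 2 * a1 + zeta / 40) / 2 in
  [/\ `|fejer n 0 u| <= w, `|fejer n 1 u| <= a1 * w,
      `|fejer n 2 u| <= a2 * w & `|fejer n 3 u| <= a3 * w].
Proof.
set z := `|n%:R * sin (u / 2)| => z0 zz w a1 a2 a3.
have zi0 : 0 < z^-1 by rewrite invr_gt0.
have zz1 : z * z^-1 = 1 by rewrite mulfV ?gt_eqF.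
have wE : w = z^-1 * z^-1.
  by rewrite /w -[X in X ^- 2]/(n%:R * sin (u / 2)) -real_normK ?num_real // expr2 invfM.
have cE : n%:R ^+ 2 * (1 - cos u) = 2 * z ^+ 2.
  rewrite /z real_normK ?num_real // exprMn sin2cos2.
  have -> : u = (u / 2) *+ 2 by rewrite -mulr_natr; field.
  rewrite cos_mulr2n (_ : (u / 2) *+ 2 / 2 = u / 2); last by rewrite -mulr_natr; field.
  by ring.
have sE : n%:R * `|sin u| <= 2 * z.
  rewrite /z normrM (ger0_norm (ler0n _ _)).
  have -> : u = (u / 2) *+ 2 by rewrite -mulr_natr; field.
  rewrite sin_mulr2n (_ : (u / 2) *+ 2 / 2 = u / 2); last by rewrite -mulr_natr; field.
  rewrite normrMn normrM -mulr_natl.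
  have := cos_max (u / 2); have := normr_ge0 (sin (u / 2)).
  have n0 : 0 <= n%:R :> R by [].
  move=> s0 c1; have := ler_wpM2r s0 c1; rewrite mul1r => h.
  by have := ler_wpM2l n0 h; lra.
(* [a] is the derivative to be bounded and [b] collects the terms already bounded. *)
have key (a b c : R) : n%:R ^+ 2 * a * (1 - cos u) = b -> `|b| <= c ->
    `|a| <= c / 2 * w.
  move=> E bc; have := congr1 Num.norm E.
  have -> : n%:R ^+ 2 * a * (1 - cos u) = a * (2 * z ^+ 2) by rewrite -cE; ring.
  rewrite normrM (ger0_norm (_ : 0 <= 2 * z ^+ 2)); last by rewrite mulr_ge0 ?sqr_ge0.
  move=> E2; have -> : `|a| = `|a| * (2 * z ^+ 2) / 2 * w.
    have -> : `|a| * (2 * z ^+ 2) / 2 * w = `|a| * (z * z^-1) ^+ 2.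
      by rewrite wE; field; rewrite gt_eqF.
    by rewrite zz1 expr1n mulr1.
  by rewrite E2 !ler_wpM2r // wE mulr_ge0 // ltW.
have w0 : 0 <= w by rewrite wE mulr_ge0 // ltW.
have wz : w * z = z^-1 by rewrite wE -mulrA mulVf ?gt_eqF // mulr1.
have wzz : w <= zeta ^+ 2 by rewrite wE expr2 ler_pM // ltW.
have zeta0 : 0 <= zeta by rewrite (le_trans _ zz) // ltW.
have sz (x c : R) : `|x| <= c * w -> 0 <= c -> `|n%:R * x * sin u| <= 2 * c * zeta.
  move=> xc c0; rewrite (_ : n%:R * x * sin u = x * (n%:R * sin u)); last by ring.
  rewrite normrM (normrM n%:R) (ger0_norm (ler0n _ _)).
  apply: (@le_trans _ _ (c * w * (2 * z))); first exact: ler_pM.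
  rewrite (_ : c * w * (2 * z) = 2 * c * (w * z)); last by ring.
  by rewrite wz ler_wpM2l ?mulr_ge0.
have cz (x c : R) : `|x| <= c * w -> 0 <= c -> `|x * cos u| <= c * zeta ^+ 2.
  move=> xc c0; rewrite normrM.
  apply: (@le_trans _ _ (c * w * 1)); first by rewrite ler_pM ?cos_max.
  by rewrite mulr1 ler_wpM2l.
have a10 : 0 <= a1 by rewrite /a1; lra.
have a20 : 0 <= a2.
  by rewrite /a2 divr_ge0 // addr_ge0 ?sqr_ge0 // addr_ge0 // !mulr_ge0.
have f0 : `|fejer n 0 u| <= 1 * w.
  rewrite (_ : 1 = 2 / 2 :> R); last by field.
  apply: key (fejer_closed n_gt0 u) _.
  by have := cos_geN1 (n%:R * u); have := cos_le1 (n%:R * u); rewrite ler_norml; lra.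
have f1 : `|fejer n 1 u| <= a1 * w.
  have -> : a1 = (1 + 2 * zeta) / 2 by rewrite /a1; field.
  have E := fejer_closed1 n_gt0 u.
  apply: (key _ (sin (n%:R * u) - n%:R * fejer n 0 u * sin u)); first by rewrite -E; ring.
  apply: le_trans (ler_normB _ _) _; apply: lerD; first exact: sin_max.
  by have := sz _ _ f0 ler01; lra.
have f2 : `|fejer n 2 u| <= a2 * w.
  have E := fejer_closed2 n_gt0 u.
  apply: (key _ (cos (n%:R * u) - 2 * (n%:R * fejer n 1 u * sin u) - fejer n 0 u * cos u)).
    by rewrite -E; ring.
  apply: le_trans (ler_normB _ _) _; apply: lerD; last first.
    by have := cz _ _ f0 ler01; lra.
  apply: le_trans (ler_normB _ _) _; apply: lerD; first exact: cos_max.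
  by rewrite normrM ger0_norm //; have := sz _ _ f1 a10; lra.
split=> //; first by rewrite -[w]mul1r.
have E := fejer_closed3 n_gt0 u.
apply: (key _ (- sin (n%:R * u) - 3 * (n%:R * fejer n 2 u * sin u)
   - 3 * (fejer n 1 u * cos u) + n%:R * fejer n 0 u * sin u / n%:R ^+ 2)).
  by rewrite -E; field.
apply: le_trans (ler_normD _ _) _; apply: lerD; last first.
  rewrite normrM; have := sz _ _ f0 ler01.
  (* Source of the term [zeta / 40] in [a3]: [2 * zeta / 80]. *)
  have n2 : `|n%:R ^- 2| <= 80^-1 :> R.
    rewrite ger0_norm ?invr_ge0 ?exprn_ge0 // lef_pV2 ?posrE ?exprn_gt0 ?ltr0n //.
    by have : 65 * 65 <= n%:R ^+ 2 :> R; [rewrite expr2 ler_pM | lra].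
  move=> h; have := ler_pM (normr_ge0 _) (normr_ge0 _) h n2; lra.
apply: le_trans (ler_normB _ _) _; apply: lerD; last first.
  by rewrite normrM ger0_norm //; have := cz _ _ f1 a10; lra.
apply: le_trans (ler_normB _ _) _; apply: lerD; last first.
  by rewrite normrM ger0_norm //; have := sz _ _ f2 a20; lra.
by rewrite normrN sin_max.
Qed.

(** The product of two functions of size [(n sin (u / 2))^-2] has size
[(n sin (u / 2))^-4], whose sums over separated points are small. *)
Lemma jackson_tail zeta u r : 0 < `|n%:R * sin (u / 2)| ->
  `|n%:R * sin (u / 2)|^-1 <= zeta -> (r <= 3)%N ->
  `|jackson r u| <= tail_coef zeta r * (n%:R * sin (u / 2)) ^- 4.
Proof.
move=> z0 zz; have zeta0 : 0 <= zeta by rewrite (le_trans _ zz) // invr_ge0.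
have := fejer_tail z0 zz => /=.
set w := _ ^- 2; rewrite /tail_coef.
set a1 := 2^-1 + zeta; set a2 := (1 + _ + _) / 2; set a3 := (_ + zeta / 40) / 2.
have -> : (n%:R * sin (u / 2)) ^- 4 = w * w by rewrite /w -exprVn -exprD exprVn.
have w0 : 0 <= w by rewrite invr_ge0 sqr_ge0.
have prod (a b c d : R) : `|a| <= c * w -> `|b| <= d * w -> `|a * b| <= c * d * (w * w).
  move=> ac bd; rewrite normrM (_ : c * d * (w * w) = (c * w) * (d * w)); last by ring.
  exact: ler_pM.
rewrite -[X in `|_| <= X]mul1r => -[f0 f1 f2 f3].
case: r => [|[|[|[|//]]]] _ /=.
- by have := prod _ _ _ _ f0 f0; rewrite expr2; lra.
- rewrite -mulrA normrM ger0_norm //; have := prod _ _ _ _ f0 f1; lra.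
- apply: le_trans (ler_normD _ _) _; rewrite [X in _ <= X]mulrDl; apply: lerD.
    rewrite normrM ger0_norm // !expr2; have := prod _ _ _ _ f1 f1; lra.
  rewrite -mulrA normrM ger0_norm //; have := prod _ _ _ _ f0 f2; lra.
- apply: le_trans (ler_normD _ _) _; rewrite [X in _ <= X]mulrDl; apply: lerD.
    rewrite -mulrA normrM ger0_norm //; have := prod _ _ _ _ f1 f2; lra.
  rewrite -mulrA normrM ger0_norm //; have := prod _ _ _ _ f0 f3; lra.
Qed.

End jackson.

Section kernel_numeric.
Variable R : realFieldType.

Lemma num_jackson2 (a b c : R) : 11 / 12 <= a -> a <= 1 -> 0 <= b -> b <= 36^-1 ->
  - 6^-1 <= c -> c <= - (133 / 10 ^+ 3) ->
  - (39 / 100) <= 2 * b + 2 * a * c <= - (188 / 10 ^+ 3).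
Proof. by move=> *; apply/andP; split; nra. Qed.

Lemma num_fejer2_near (f w x2 : R) : 0 <= w <= 65 ^- 2 -> x2 <= 1 -> f <= - (1 - w) / 6 + x2 / 30 ->
  f <= - (133 / 10 ^+ 3).
Proof. lra. Qed.

Lemma num_fejer0_near (f x2 : R) : x2 <= 1 -> 1 - x2 / 12 <= f -> 11 / 12 <= f.
Proof. lra. Qed.

Lemma num_fejer0_mid (f w y : R) : 0 <= w <= 65 ^- 2 -> 1 <= y <= 3 ->
  f <= 1 - y ^+ 2 * (1 - w) / 12 + y ^+ 4 / 360 -> f <= 1 - 8 / 100 * y.
Proof.
move=> w0 y13 fy.
have y2 : y ^+ 2 * w <= y ^+ 2 * 65 ^- 2 by rewrite ler_wpM2l ?sqr_ge0 //; lra.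
have q : 0 <= y * (1 - 65 ^- 2) / 12 - y ^+ 3 / 360 - 8 / 100 by nra.
have := mulr_ge0 (_ : 0 <= y) q; move=> /(_ ltac:(lra)).
move: fy y2; clear => *; lra.
Qed.

Lemma num_fejer0_mid_ge0 (f y : R) : 1 <= y <= 3 -> 1 - y ^+ 2 / 12 <= f -> 0 <= f.
Proof. nra. Qed.

Lemma num_fejer0_mid_le (f y : R) : 1 <= y -> f <= 1 - 8 / 100 * y -> f <= 92 / 100.
Proof. lra. Qed.

Lemma num_jackson1_mid (f g y : R) : f * g <= 92 / 100 * (y / 6) -> 2 * f * g <= 92 / 100 * (y / 3).
Proof. lra. Qed.

Lemma num_jackson2_0 (f w : R) : 0 <= w <= 65 ^- 2 -> f <= - (1 - w) / 6 + 0 ->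
   2 * 0 ^+ 2 + 2 * 1 * f <= - (333 / 10 ^+ 3).
Proof. rewrite expr0n /=; lra. Qed.

Lemma num_fejer13_near (x a b : R) : x <= 1 -> a <= x / 6 -> b <= x / 15 -> a <= 6^-1 /\ b <= 15^-1.
Proof. lra. Qed.

Lemma num_jackson3_near (a b : R) : a <= 6^-1 * 6^-1 -> b <= 1 * 15^-1 -> 6 * a + 2 * b <= 3 / 10.
Proof. lra. Qed.

End kernel_numeric.

Section jackson_near.
Variables (R : realType) (n : nat).
Hypothesis n65 : (65 <= n)%N.
Implicit Types (u x zeta : R) (r : nat).

Let n_gt0 : (0 < n)%N. Proof. exact: leq_trans n65. Qed.
Let nR : 65 <= n%:R :> R. Proof. by rewrite (ler_nat R 65). Qed.

Lemma n_inv2 : 0 <= (n%:R ^- 2 : R) <= 65 ^- 2.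
Proof.
rewrite invr_ge0 exprn_ge0 //= lef_pV2 ?posrE ?exprn_gt0 ?ltr0n //.
by have : 65 * 65 <= n%:R ^+ 2 :> R; [rewrite expr2 ler_pM | lra].
Qed.

Lemma fejer0_0 : fejer n 0 0 = 1 :> R.
Proof.
have [<- _ _] := fejer_coef_sums R n_gt0.
by rewrite fejer0E; apply: eq_bigr => k _; rewrite mulr0 cos0 mulr1.
Qed.

Lemma fejer1_0 : fejer n 1 0 = 0 :> R.
Proof.
rewrite fejer1E big1 ?oppr0 // => k _.
by rewrite mulr0 sin0 mulr0.
Qed.

Lemma jackson0_0 : jackson n 0 0 = 1 :> R.
Proof. by rewrite /= fejer0_0 expr1n. Qed.

Lemma jackson1_0 : jackson n 1 0 = 0 :> R.
Proof. by rewrite /= fejer1_0 mulr0. Qed.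

Lemma jackson2_0 : jackson n 2 0 <= - (333 / 10 ^+ 3) :> R.
Proof.
rewrite /= fejer1_0 fejer0_0; apply: num_jackson2_0 n_inv2 _.
by have := fejer2_le n65 (0 : R); rewrite mulr0 (expr0n _ 2) mul0r.
Qed.

(** A uniformly negative second derivative within distance [1 / n] of the origin:
the certificate inherits its curvature from it. *)
Lemma jackson2_near u : `|n%:R * u| <= 1 ->
  - (39 / 100) <= jackson n 2 u <= - (188 / 10 ^+ 3).
Proof.
move=> x1; have x2 : (n%:R * u) ^+ 2 <= 1 by rewrite -real_normK ?num_real // expr_le1.
have f0l : fejer n 0 u <= 1 by exact: le_trans (ler_norm _) (fejer0_norm n65 u).
have := fejer2_norm n65 u; rewrite ler_norml => /andP[f2g _].
have f1 : fejer n 1 u ^+ 2 <= 36^-1.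
  rewrite -real_normK ?num_real // (_ : 36^-1 = (6^-1) ^+ 2); last by field.
  rewrite ler_sqr ?nnegrE //; apply: le_trans (fejer1_norm n65 u) _.
  by rewrite ler_piMl.
apply: num_jackson2 => //; first exact: num_fejer0_near x2 (fejer0_ge n65 u).
  exact: sqr_ge0.
exact: num_fejer2_near n_inv2 x2 (fejer2_le n65 u).
Qed.

Lemma jackson3_near u : `|n%:R * u| <= 1 -> `|jackson n 3 u| <= 3 / 10.
Proof.
move=> x1 /=; apply: le_trans (ler_normD _ _) _.
have f0 := fejer0_norm n65 u; have f2 := fejer2_norm n65 u.
have [f1 f3] := num_fejer13_near x1 (fejer1_norm n65 u) (fejer3_norm n65 u).
rewrite !normrM !(ger0_norm (ler0n _ _)) -!mulrA.
apply: num_jackson3_near; exact: ler_pM.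
Qed.

(** At distance between [1 / n] and [3 / n] of a node the kernel is neither near its
maximum nor in its tail; the Taylor bounds of order 4 still keep it away from 1. *)
Lemma jackson_mid u : 1 <= `|n%:R * u| <= 3 ->
  `|jackson n 0 u| <= 92 / 100 * (1 - 8 / 100 * `|n%:R * u|) /\
  `|jackson n 1 u| <= 92 / 100 * (`|n%:R * u| / 3).
Proof.
have f0l := fejer0_le n65 u; have f0g := fejer0_ge n65 u; have f1 := fejer1_norm n65 u.
move: f0l f0g f1; rewrite -[(n%:R * u) ^+ 4]/((n%:R * u) ^+ (2 * 2)) exprM.
rewrite -(@real_normK _ (n%:R * u)) ?num_real //.
set y := `|n%:R * u|; rewrite -exprM /= => f0l f0g f1 y13.
have y1 : 1 <= y by case/andP: y13.
have f0 := num_fejer0_mid n_inv2 y13 f0l; have f92 := num_fejer0_mid_le y1 f0.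
have f0' := num_fejer0_mid_ge0 y13 f0g.
split; first by rewrite /= ger0_norm ?sqr_ge0 // expr2; apply: ler_pM.
rewrite /= !normrM ger0_norm // (ger0_norm f0').
by apply: num_jackson1_mid; exact: ler_pM.
Qed.

End jackson_near.

(** * Trigonometric polynomials *)

Section trigonometric_polynomials.
Variable R : realType.
Implicit Types (f g : R -> R) (N : nat).

(** Phases are allowed, so that translations preserve this class. *)
Inductive trigpoly N : (R -> R) -> Prop :=
| trigpoly_cos k c : (k <= N)%N -> trigpoly N (fun x => cos (k%:R * x + c))
| trigpoly_add f g : trigpoly N f -> trigpoly N g -> trigpoly N (fun x => f x + g x)
| trigpoly_scale a f : trigpoly N f -> trigpoly N (fun x => a * f x).

Lemma trigpoly_ext N f g : trigpoly N f -> f =1 g -> trigpoly N g.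
Proof. by move=> tf /funext <-. Qed.

Lemma trigpoly0 N : trigpoly N (fun=> 0).
Proof.
apply: trigpoly_ext (trigpoly_scale 0 (trigpoly_cos 0 (leq0n N))) _ => x.
by rewrite mul0r.
Qed.

Lemma trigpoly_sum N (I : Type) (s : seq I) (P : pred I) (F : I -> R -> R) :
  (forall i, P i -> trigpoly N (F i)) -> trigpoly N (fun x => \sum_(i <- s | P i) F i x).
Proof.
move=> tF; elim: s => [|i s IH].
  by apply: trigpoly_ext (trigpoly0 N) _ => x; rewrite big_nil.
have [Pi|nPi] := boolP (P i).
  by apply: trigpoly_ext (trigpoly_add (tF _ Pi) IH) _ => x; rewrite big_cons Pi.
by apply: trigpoly_ext IH _ => x; rewrite big_cons (negbTE nPi).
Qed.

Lemma trigpoly_shift N f t : trigpoly N f -> trigpoly N (fun x => f (x - t)).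
Proof.
elim=> [k c kN|{}f g _ tf _ tg|a {}f _ tf].
- apply: trigpoly_ext (trigpoly_cos (c - k%:R * t) kN) _ => x.
  by congr cos; ring.
- exact: trigpoly_add.
- exact: trigpoly_scale.
Qed.

Lemma trigpoly_mul M N f g : trigpoly M f -> trigpoly N g ->
  trigpoly (M + N) (fun x => f x * g x).
Proof.
move=> tf tg; elim: tf => [k c kM|{}f f' _ tf _ tf'|a {}f _ tf].
- elim: tg => [l d lN|{}g g' _ tg _ tg'|a {}g _ tg].
  + have t1 : trigpoly (M + N) (fun x => cos ((k + l)%:R * x + (c + d))).
      by apply: trigpoly_cos; exact: leq_add.
    have t2 : trigpoly (M + N) (fun x => cos (k%:R * x + c - (l%:R * x + d))).
      have [kl|/ltnW kl] := leqP l k.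
        apply: trigpoly_ext (@trigpoly_cos (M + N) (k - l) (c - d) _) _ => [|x].
          by rewrite (leq_trans (leq_subr _ _)) // (leq_trans kM) // leq_addr.
        by rewrite natrB //; congr cos; ring.
      apply: trigpoly_ext (@trigpoly_cos (M + N) (l - k) (d - c) _) _ => [|x].
        by rewrite (leq_trans (leq_subr _ _)) // (leq_trans lN) // leq_addl.
      by rewrite natrB // -cosN; congr cos; ring.
    apply: trigpoly_ext (trigpoly_scale 2^-1 (trigpoly_add t1 t2)) _ => x.
    have -> : (k + l)%:R * x + (c + d) = k%:R * x + c + (l%:R * x + d).
      by rewrite natrD; ring.
    by rewrite cosD cosB; field.
  + by apply: trigpoly_ext (trigpoly_add tg tg') _ => x; rewrite mulrDr.
  + by apply: trigpoly_ext (trigpoly_scale a tg) _ => x; rewrite mulrCA.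
- by apply: trigpoly_ext (trigpoly_add tf tf') _ => x; rewrite mulrDl.
- by apply: trigpoly_ext (trigpoly_scale a tf) _ => x; rewrite mulrA.
Qed.

(** Averaging a cosine with its reflection removes its phase. *)
Lemma trigpoly_even N f : trigpoly N f ->
  exists p : nat -> R, forall x,
    (f x + f (- x)) / 2 = \sum_(k < N.+1) p k * cos (k%:R * x).
Proof.
elim=> [k c kN|{}f g _ [p pE] _ [q qE]|a {}f _ [p pE]].
- exists (fun j => if j == k then cos c else 0) => x.
  rewrite (bigD1 (Ordinal (kN : (k < N.+1)%N))) //= eqxx big1 ?addr0 //.
    by rewrite mulrN cosD [cos (- _ + _)]cosD cosN sinN; field.
  by move=> j; rewrite -(inj_eq val_inj) /= => /negPf ->; rewrite mul0r.
- exists (fun k => p k + q k) => x.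
  transitivity ((f x + f (- x)) / 2 + (g x + g (- x)) / 2); first by field.
  rewrite pE qE -big_split /=.
  by apply: eq_bigr => k _; rewrite mulrDl.
- exists (fun k => a * p k) => x.
  transitivity (a * ((f x + f (- x)) / 2)); first by field.
  by rewrite pE mulr_sumr; apply: eq_bigr => k _; rewrite mulrA.
Qed.

Variable n : nat.

Lemma trigpoly_fejer r : trigpoly n.-1 (fejer n r : R -> R).
Proof.
apply: trigpoly_sum => k _; apply: trigpoly_scale.
by apply: trigpoly_cos; rewrite -ltnS; case: n k => [[]|] //.
Qed.

Lemma trigpoly_jackson r : trigpoly (n.-1 + n.-1) (jackson n r : R -> R).
Proof.
have F (a : R) i j : trigpoly (n.-1 + n.-1) (fun x : R => a * (fejer n i x * fejer n j x)).
  by apply: trigpoly_scale; apply: trigpoly_mul; exact: trigpoly_fejer.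
case: r => [|[|[|r]]].
- by apply: trigpoly_ext (F 1 0%N 0%N) _ => x; rewrite /= mul1r expr2.
- by apply: trigpoly_ext (F 2 0%N 1%N) _ => x; rewrite /= mulrA.
- by apply: trigpoly_ext (trigpoly_add (F 2 1%N 1%N) (F 2 0%N 2%N)) _ => x; rewrite /= expr2 !mulrA.
- by apply: trigpoly_ext (trigpoly_add (F 6 1%N 2%N) (F 2 0%N 3%N)) _ => x; rewrite /= !mulrA.
Qed.

End trigonometric_polynomials.

(** * Sums over separated points of the circle *)

Section packing.
Variable R : realType.

(** Equivalent to [y cos y <= sin y], since [(sin y)^-2 = 1 + (cos y / sin y)^2]. *)
Lemma inv_sqr_sin (y : R) : 0 < y <= pi / 2 -> (sin y) ^- 2 <= 1 + y ^- 2.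
Proof.
move=> /andP[y0 y2].
have pi0 := pi_gt0 R.
have s0 : 0 < sin y by apply: sin_gt0_pi; rewrite y0 /=; lra.
have c0 : 0 <= cos y by apply: cos_ge0_pihalf; rewrite y2 andbT; lra.
have ysc : y * cos y <= sin y.
  rewrite -subr_ge0.
  pose F x : R := sin x - x * cos x.
  suff : F 0 <= F y by rewrite /F sin0 mul0r subr0.
  have d x : is_derive x (1 : R) F (x * sin x).
    by apply: is_derive_eq; rewrite /GRing.scale /=; ring.
  apply: (le_of_derive d _ (ltW y0)) => x /andP[x0 xy].
  by rewrite mulr_ge0 // sin_ge0_pi // x0 /=; lra.
have h : (y * cos y) ^+ 2 <= sin y ^+ 2 by rewrite ler_sqr ?nnegrE // ?mulr_ge0 // ltW.
have -> : (sin y) ^- 2 = (cos y ^+ 2 + sin y ^+ 2) * (sin y) ^- 2.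
  by rewrite cos2Dsin2 mul1r.
rewrite mulrDl mulfV ?expf_neq0 ?gt_eqF // addrC lerD2l ler_pdivrMr ?exprn_gt0 //.
by rewrite mulrC ler_pdivlMr ?exprn_gt0 // mulrC -exprMn.
Qed.

(** Compared with a telescoping sum, as in the next lemma. *)
Lemma sum_inv_sqr N : \sum_(0 <= k < N) (k.+1%:R ^- 2 : R) <= 2.
Proof.
suff : \sum_(0 <= k < N.+1) (k.+1%:R ^- 2 : R) <= 2 - N.+1%:R^-1.
  rewrite big_nat_recr //= => h; apply: le_trans (le_trans _ h) _.
    by rewrite lerDl invr_ge0 exprn_ge0.
  by rewrite gerBl invr_ge0.
elim: N => [|N IH]; first by rewrite big_nat1 expr1n invr1; lra.
rewrite big_nat_recr //=; apply: le_trans (lerD IH (lexx _)) _.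
rewrite -[N.+2%:R]natr1; have : 0 < N.+1%:R :> R by rewrite ltr0n.
move: (N.+1%:R : R) => y y0.
have -> : 2 - y^-1 + (y + 1) ^- 2 = 2 - (y + 1)^-1 - y^-1 * (y + 1) ^- 2.
  by field; rewrite !gt_eqF // addr_gt0.
by rewrite gerBl mulr_ge0 ?invr_ge0 ?exprn_ge0 // ltW // addr_gt0.
Qed.

Lemma sum_inv_pow4 N : \sum_(0 <= k < N) (k.+1%:R ^- 4 : R) <= 9 / 8.
Proof.
suff : \sum_(0 <= k < N.+2) (k.+1%:R ^- 4 : R) <= 9 / 8 - N.+2%:R ^- 2 / 4.
  do 2 rewrite big_nat_recr //=; move=> h; apply: le_trans (le_trans _ h) _.
    by rewrite -addrA lerDl addr_ge0 ?invr_ge0 ?exprn_ge0.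
  by rewrite gerBl mulr_ge0 ?invr_ge0 ?exprn_ge0.
elim: N => [|N IH]; first by rewrite big_nat_recr //= big_nat1 expr1n invr1; lra.
rewrite big_nat_recr //=; apply: le_trans (lerD IH (lexx _)) _.
rewrite -[N.+3%:R]natr1; have : 0 < N.+2%:R :> R by rewrite ltr0n.
move: (N.+2%:R : R) => y y0.
have y1 : 0 < y + 1 by rewrite addr_gt0.
rewrite -subr_ge0.
have -> : 9 / 8 - (y + 1) ^- 2 / 4 - (9 / 8 - y ^- 2 / 4 + (y + 1) ^- 4)
   = (2 * y ^+ 3 + y ^+ 2 + 4 * y + 1) / 4 * y ^- 2 * (y + 1) ^- 4.
  by field; rewrite !gt_eqF.
by rewrite !mulr_ge0 ?invr_ge0 ?exprn_ge0 ?addr_ge0 ?mulr_ge0 ?exprn_ge0 // ltW.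
Qed.

End packing.

Lemma num_packing (R : realType) (x rho : R) : 65 <= x -> 0 < rho -> rho <= 10 ->
  36 * rho ^- 4 + 32 * (rho ^- 2 * x ^- 2) + 16 * (rho^-1 * x ^- 3)
    <= 36 * rho ^- 4 + rho ^- 2 / 100.
Proof.
move=> x65 rho0 rho10.
have xi : x^-1 <= 65^-1 by rewrite lef_pV2 ?posrE //; lra.
have xi0 : 0 <= x^-1 by rewrite invr_ge0; lra.
have x2 : x ^- 2 <= 65 ^- 2.
  have -> : 65 ^- 2 = 65^-1 * 65^-1 :> R by field.
  by rewrite -exprVn expr2 ler_pM.
have x20 : 0 <= x ^- 2 by rewrite invr_ge0 exprn_ge0; lra.
have x3 : x ^- 3 <= 65^-1 * 65 ^- 2.
  have -> : x ^- 3 = x^-1 * x ^- 2 by rewrite -!exprVn -exprS.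
  exact: ler_pM.
have r2 : 0 <= rho ^- 2 by rewrite invr_ge0 exprn_ge0 // ltW.
have r1 : rho^-1 <= 10 * rho ^- 2.
  have -> : rho^-1 = rho * rho ^- 2 by field; rewrite gt_eqF.
  by rewrite ler_wpM2r.
have h1 := ler_wpM2l r2 x2.
have h2 : rho^-1 * x ^- 3 <= 10 * rho ^- 2 * (65^-1 * 65 ^- 2).
  by apply: ler_pM => //; rewrite ?invr_ge0 ?exprn_ge0 //; lra.
move: h1 h2; clear - r2; move: (rho ^- 4) (rho ^- 2 * _) (rho^-1 * _) => *; lra.
Qed.

Section packing_sum.
Variables (R : realType) (n : nat).
Hypothesis n65 : (65 <= n)%N.

Let n_gt0 : (0 < n)%N. Proof. exact: leq_trans n65. Qed.
Let nR : 65 <= n%:R :> R. Proof. by rewrite (ler_nat R 65). Qed.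
Let nR0 : 0 < n%:R :> R. Proof. by rewrite ltr0n. Qed.

(** Each interval [[k r, (k + 1) r)] contains at most one of the separated points, so
the sum is bounded by one term for each [k], and [inv_sqr_sin] turns these terms
into the series of [k^-2] and [k^-4]. *)
Lemma packing_side (I : finType) (P : pred I) (u : I -> R) (r : R) :
  0 < r -> r <= pi -> (forall i, P i -> r <= u i <= pi) ->
  (forall i j, P i -> P j -> i != j -> r <= `|u i - u j|) ->
  \sum_(i | P i) (n%:R * sin (u i / 2)) ^- 4 <=
    18 * (n%:R * r) ^- 4 + 16 * ((n%:R * r) ^- 2 * n%:R ^- 2) + 8 * ((n%:R * r)^-1 * n%:R ^- 3).
Proof.
move=> r0 rpi uP sep.
pose N := Num.truncn (pi / r).
pose a : R := n%:R ^- 2; pose b : R := 4 * (n%:R * r) ^- 2.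
pose g (k : nat) : R := (a + b * k.+1%:R ^- 2) ^+ 2.
(* [h] is the bin of a point; bins are counted from 1, since [r <= u i]. *)
pose h (i : I) := (Num.truncn (u i / r)).-1.
have a0 : 0 <= a by rewrite invr_ge0 exprn_ge0.
have b0 : 0 <= b by rewrite mulr_ge0 // invr_ge0 exprn_ge0 // mulr_ge0 // ltW.
have hP i : P i -> (h i).+1%:R * r <= u i < (h i).+2%:R * r.
  move=> /uP /andP[ru upi].
  have u1 : 1 <= u i / r by rewrite ler_pdivlMr // mul1r.
  have k0 : (0 < Num.truncn (u i / r))%N by rewrite truncn_gt0.
  rewrite /h prednK // -ler_pdivlMr // -ltr_pdivrMr //.
  by apply: truncn_itv; apply: le_trans u1.
have hN i : P i -> (h i < N.+1)%N.
  move=> Pi; rewrite ltnS /h; apply: leq_trans (leq_pred _) _.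
  apply: le_truncn; have /andP[_ upi] := uP i Pi.
  by rewrite ler_wpM2r // invr_ge0 ltW.
have hinj i j : P i -> P j -> h i = h j -> i = j.
  move=> Pi Pj hij; apply/eqP/negPn/negP => ij.
  have := sep _ _ Pi Pj ij; have := hP _ Pi; have := hP _ Pj; rewrite hij.
  rewrite -[(h j).+2%:R]natr1 mulrDl mul1r => /andP[j1 j2] /andP[i1 i2].
  by rewrite leNgt => /negP; apply; rewrite ltr_norml; apply/andP; split; lra.
have term i : P i -> (n%:R * sin (u i / 2)) ^- 4 <= g (h i).
  move=> Pi; have /andP[ru upi] := uP i Pi; have /andP[hu _] := hP i Pi.
  have u0 : 0 < u i by exact: lt_le_trans ru.
  have -> : (n%:R * sin (u i / 2)) ^- 4 = (n%:R ^- 2 * (sin (u i / 2)) ^- 2) ^+ 2.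
    by rewrite -!exprVn -exprMn -invfM -exprM.
  have s2 : (sin (u i / 2)) ^- 2 <= 1 + (u i / 2) ^- 2.
    by apply: inv_sqr_sin; apply/andP; split; lra.
  rewrite ler_sqr ?nnegrE; last 2 first.
  - by rewrite mulr_ge0 // invr_ge0 sqr_ge0.
  - by rewrite addr_ge0 // mulr_ge0 // invr_ge0 exprn_ge0.
  apply: le_trans (ler_wpM2l a0 s2) _.
  rewrite mulrDr mulr1 lerD2l.
  have -> : a * (u i / 2) ^- 2 = 4 * n%:R ^- 2 * u i ^- 2.
    by rewrite /a; field; rewrite !gt_eqF.
  have -> : b * (h i).+1%:R ^- 2 = 4 * n%:R ^- 2 * ((h i).+1%:R * r) ^- 2.
    by rewrite /b; field; rewrite !gt_eqF // pnatr_eq0.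
  rewrite ler_wpM2l ?mulr_ge0 //.
  have hr0 : 0 < (h i).+1%:R * r by rewrite mulr_gt0.
  by rewrite lef_pV2 ?posrE ?exprn_gt0 // ler_sqr ?nnegrE // ltW.
apply: le_trans (ler_sum _ term) _.
apply: (@le_trans _ _ (\sum_(0 <= k < N.+1) g k)).
  pose A := [set i | P i]%SET; pose h' i : 'I_N.+1 := inord (h i).
  have E : \sum_(i | P i) g (h i) = \sum_(i in A) g (h' i).
    by apply: eq_big => [i|i Pi]; rewrite ?inE // /h' inordK ?hN.
  rewrite E -(big_imset (fun k : 'I_N.+1 => g k)) /=; last first.
    move=> i j; rewrite !inE => Pi Pj /(congr1 val) /=.
    by rewrite !inordK ?hN //; exact: hinj.
  rewrite big_mkord [X in _ <= X](bigID (mem (h' @: A))) /= lerDl.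
  by apply: sumr_ge0 => k _; exact: sqr_ge0.
have -> : \sum_(0 <= k < N.+1) g k = a ^+ 2 * N.+1%:R
   + 2 * a * b * \sum_(0 <= k < N.+1) k.+1%:R ^- 2
   + b ^+ 2 * \sum_(0 <= k < N.+1) k.+1%:R ^- 4.
  have -> : a ^+ 2 * N.+1%:R = \sum_(0 <= k < N.+1) a ^+ 2.
    by rewrite sumr_const_nat subn0 mulr_natr.
  rewrite !mulr_sumr -!big_split /=; apply: eq_bigr => k _.
  have -> : k.+1%:R ^- 4 = k.+1%:R ^- 2 * k.+1%:R ^- 2 :> R by rewrite -invfM -exprD.
  by rewrite /g; ring.
have N8 : N.+1%:R <= 8 / r.
  have pi4 : pi / r <= 4 / r by rewrite ler_wpM2r ?invr_ge0 1?ltW //; have := pihalf_lt2 R; lra.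
  have N1 : 1 <= pi / r by rewrite ler_pdivlMr // mul1r.
  have : N%:R <= pi / r.
    by have /andP[] := truncn_itv (le_trans ler01 N1).
  by rewrite -natr1 mulrDl in pi4 N1 *; lra.
have h1 := ler_wpM2l (sqr_ge0 a) N8.
have h2 := ler_wpM2l (mulr_ge0 (mulr_ge0 (ler0n R 2) a0) b0) (sum_inv_sqr R N.+1).
have h3 := ler_wpM2l (sqr_ge0 b) (sum_inv_pow4 R N.+1).
apply: le_trans (lerD (lerD h1 h2) h3) _.
rewrite le_eqVlt; apply/orP; left; apply/eqP.
by rewrite /a /b; field; rewrite !gt_eqF.
Qed.

(** The two sides of the origin are treated alike by symmetry. The terms of lower
order in [n] are absorbed by [(n r)^-2 / 100], because [n >= 65] and
[n r <= 10]. *)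
Lemma packing (I : finType) (P : pred I) (u : I -> R) (r : R) :
  0 < r -> r <= pi -> n%:R * r <= 10 -> (forall i, P i -> r <= `|u i| <= pi) ->
  (forall i j, P i -> P j -> i != j -> r <= `|u i - u j|) ->
  \sum_(i | P i) (n%:R * sin (u i / 2)) ^- 4 <=
    36 * (n%:R * r) ^- 4 + (n%:R * r) ^- 2 / 100.
Proof.
move=> r0 rpi r10 uP sep.
rewrite (bigID (fun i => 0 <= u i)) /=.
have h1 : \sum_(i | P i && (0 <= u i)) (n%:R * sin (u i / 2)) ^- 4 <=
    18 * (n%:R * r) ^- 4 + 16 * ((n%:R * r) ^- 2 * n%:R ^- 2) + 8 * ((n%:R * r)^-1 * n%:R ^- 3).
  apply: packing_side => // [i /andP[Pi u0]|i j /andP[Pi _] /andP[Pj _]].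
    by have := uP _ Pi; rewrite ger0_norm.
  exact: sep.
have h2 : \sum_(i | P i && ~~ (0 <= u i)) (n%:R * sin (u i / 2)) ^- 4 <=
    18 * (n%:R * r) ^- 4 + 16 * ((n%:R * r) ^- 2 * n%:R ^- 2) + 8 * ((n%:R * r)^-1 * n%:R ^- 3).
  have E i : (n%:R * sin (u i / 2)) ^- 4 = (n%:R * sin (- u i / 2)) ^- 4.
    by rewrite mulNr sinN mulrN exprNn -signr_odd expr0 mul1r.
  under eq_bigr do rewrite E.
  apply: packing_side => // [i /andP[Pi u0]|i j /andP[Pi _] /andP[Pj _] ij].
    by have := uP _ Pi; rewrite -normrN ger0_norm // oppr_ge0 ltW // ltNge.
  by rewrite -opprD normrN; exact: sep.
apply: le_trans (lerD h1 h2) _.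
apply: le_trans (num_packing nR (mulr_gt0 nR0 r0) r10).
by rewrite le_eqVlt; apply/orP; left; apply/eqP; ring.
Qed.

End packing_sum.

(** * Periodicity, linear systems and a Taylor estimate *)

Section periodicity.
Variable R : realType.

Lemma cosD2piz (x : R) (k : int) : cos (x + 2 * pi * k%:~R) = cos x.
Proof.
have H y (j : nat) : cos (y + 2 * pi * j%:R) = cos y :> R.
  have -> : y + 2 * pi * j%:R = y + pi *+ 2 *+ j.
    by rewrite -[pi *+ 2 *+ j]mulr_natr -[pi *+ 2]mulr_natr (mulrC 2).
  by apply: periodicn; exact: cosD2pi.
case: k => j; first exact: H.
by rewrite NegzE mulrNz mulrN -pmulrn -[LHS](H _ j.+1) subrK.
Qed.

Lemma fejerD2piz n r (x : R) (k : int) : fejer n r (x + 2 * pi * k%:~R) = fejer n r x.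
Proof.
apply: eq_bigr => j _; congr (_ * _).
rewrite -(cosD2piz (_ * x + _) (j%:Z * k)); congr cos.
by rewrite intrM; ring.
Qed.

Lemma jacksonD2piz n r (x : R) (k : int) :
  jackson n r (x + 2 * pi * k%:~R) = jackson n r x.
Proof. by case: r => [|[|[|r]]]; rewrite /= !fejerD2piz. Qed.

Lemma torus_rep (x : R) : exists k : int, `|x + 2 * pi * k%:~R| <= pi.
Proof.
have p0 := pi_gt0 R; pose y := (x + pi) / (2 * pi).
exists (- Num.floor y).
have := floor_itv y; rewrite intrD mulrNz.
have -> : x = y * (2 * pi) - pi by rewrite /y mulfVK ?addrK // mulf_neq0 ?gt_eqF.
move: ((Num.floor y)%:~R : R) => z /andP[zy yz].
rewrite ler_norml mulrN; apply/andP; split; first by nra.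
by nra.
Qed.

End periodicity.

Section linear_systems.
Variable R : fieldType.

(** A square system is solvable once its homogeneous form has only the null
solution. *)
Lemma solve_system (I : finType) (A : I -> I -> R) (c : I -> R) :
  (forall x : I -> R, (forall i, \sum_j A i j * x j = 0) -> forall j, x j = 0) ->
  exists x : I -> R, forall i, \sum_j A i j * x j = c i.
Proof.
move=> inj; pose M := \matrix_(j < #|I|, i < #|I|) A (enum_val i) (enum_val j).
have sumE (y : 'rV[R]_#|I|) i : (y *m M) 0 (enum_rank i) =
    \sum_j A i j * y 0 (enum_rank j).
  rewrite mxE (reindex _ (onW_bij _ (@enum_rank_bij I))) /=.
  by apply: eq_bigr => j _; rewrite mxE !enum_rankK mulrC.
have Munit : M \in unitmx.
  rewrite -row_free_unit -kermx_eq0; apply/eqP/row_matrixP => k.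
  rewrite row0; apply/rowP => j; rewrite [RHS]mxE.
  have := inj (fun j => row k (kermx M) 0 (enum_rank j)).
  move=> /(_ _ (enum_val j)); rewrite enum_valK; apply => i.
  by rewrite -sumE -row_mul mulmx_ker row0 mxE.
exists (fun j => (\row_j c (enum_val j) *m invmx M) 0 (enum_rank j)) => i.
by rewrite -sumE mulmxKV // mxE enum_rankK.
Qed.

End linear_systems.

Section taylor.
Variable R : realType.

(** The bound on the second derivative, integrated twice from the origin. The
factor [nn] is there because the derivatives of the kernels are taken with
respect to [n * u]. *)
Lemma taylor2 (nn c1 c2 : R) (f g h : R -> R) :
  0 < nn ->
  (forall x, is_derive x (1 : R) f (nn * g x)) ->
  (forall x, is_derive x (1 : R) g (nn * h x)) ->
  f 0 = 1 -> g 0 = 0 -> (forall x, `|nn * x| <= 1 -> - c2 <= h x <= - c1) ->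
  forall x, `|nn * x| <= 1 ->
    1 - c2 / 2 * (nn * x) ^+ 2 <= f x <= 1 - c1 / 2 * (nn * x) ^+ 2.
Proof.
move=> nn0.
have pos f' g' h' : (forall x, is_derive x (1 : R) f' (nn * g' x)) ->
  (forall x, is_derive x (1 : R) g' (nn * h' x)) ->
  f' 0 = 1 -> g' 0 = 0 -> (forall x, `|nn * x| <= 1 -> - c2 <= h' x <= - c1) ->
  forall x, 0 <= x -> `|nn * x| <= 1 ->
    1 - c2 / 2 * (nn * x) ^+ 2 <= f' x <= 1 - c1 / 2 * (nn * x) ^+ 2.
  move=> df dg f0 g0 hb x x0 nx.
  have small y : 0 <= y <= x -> `|nn * y| <= 1.
    move=> /andP[y0 yx]; apply: le_trans nx.
    by rewrite !ger0_norm ?mulr_ge0 ?ler_pM2l // ltW.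
  have gb y : 0 <= y <= x -> - c2 * (nn * y) <= g' y <= - c1 * (nn * y).
    move=> /andP[y0 yx]; apply/andP; split; rewrite -subr_ge0.
      have d z : is_derive z (1 : R) (fun z => g' z - - c2 * (nn * z)) (nn * h' z + c2 * nn).
        by have dz := dg z; apply: is_derive_eq; rewrite /GRing.scale /=; ring.
      have := le_of_derive d _ y0; rewrite g0 !mulr0 subrr; apply => z /andP[z0 zy].
      have /hb /andP[h1 _] : `|nn * z| <= 1 by apply: small; rewrite z0 (le_trans zy).
      by rewrite [c2 * nn]mulrC -mulrDr; apply: mulr_ge0; [exact: ltW | lra].
    have d z : is_derive z (1 : R) (fun z => - c1 * (nn * z) - g' z) (- c1 * nn - nn * h' z).
      by have dz := dg z; apply: is_derive_eq; rewrite /GRing.scale /=; ring.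
    have := le_of_derive d _ y0; rewrite g0 !mulr0 subrr; apply => z /andP[z0 zy].
    have /hb /andP[_ h1] : `|nn * z| <= 1 by apply: small; rewrite z0 (le_trans zy).
    by rewrite [- c1 * nn]mulrC -mulrBr; apply: mulr_ge0; [exact: ltW | lra].
  apply/andP; split; rewrite -subr_ge0.
    have d z : is_derive z (1 : R) (fun z => f' z - (1 - c2 / 2 * (nn * z) ^+ 2))
        (nn * (g' z + c2 * (nn * z))).
      by have dz := df z; apply: is_derive_eq; rewrite /GRing.scale /=; field.
    have := le_of_derive d _ x0; rewrite f0 mulr0 expr0n mulr0 subr0 subrr; apply => z zx.
    by have /andP[h1 _] := gb _ zx; apply: mulr_ge0; [exact: ltW | lra].
  have d z : is_derive z (1 : R) (fun z => (1 - c1 / 2 * (nn * z) ^+ 2) - f' z)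
      (nn * (- c1 * (nn * z) - g' z)).
    by have dz := df z; apply: is_derive_eq; rewrite /GRing.scale /=; field.
  have := le_of_derive d _ x0; rewrite f0 mulr0 expr0n mulr0 subr0 subrr; apply => z zx.
  by have /andP[_ h1] := gb _ zx; apply: mulr_ge0; [exact: ltW | lra].
move=> df dg f0 g0 hb x nx.
have [x0|/ltW x0] := leP 0 x; first exact: pos hb _ x0 nx.
have dN (z : R) : is_derive z (1 : R) (fun y : R => - y) (- 1).
  by apply: is_derive_eq.
have dfN z : is_derive z (1 : R) (fun y => f (- y)) (nn * - g (- z)).
  have := is_derive1_comp (df (- z)) (dN z).
  by rewrite mulrN1 mulrN.
have dgN z : is_derive z (1 : R) (fun y => - g (- y)) (nn * h (- z)).
  have dz := is_derive1_comp (dg (- z)) (dN z).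
  have := is_deriveN dz.
  by rewrite mulrN1 opprK.
have := @pos _ _ (fun y => h (- y)) dfN dgN; rewrite !oppr0 g0 oppr0 => /(_ f0 erefl).
move=> /(_ _ (- x)); rewrite !mulrN !opprK normrN sqrrN; apply => //; last by rewrite oppr_ge0.
by move=> y ny; apply: hb; rewrite mulrN normrN.
Qed.

End taylor.

(** * Contribution of distant points *)

Section certificate_numeric.
Variable R : realFieldType.
Implicit Types A B S V x : R.

(** The diagonal dominance of the interpolation system: [A] and [B] bound the two
families of coefficients, [V] the prescribed values, and [S0], [S1], [S2] the sums
of the distant contributions. *)
Lemma num_system V A B S0 S1 S2 : 0 <= A -> 0 <= B ->
  S0 <= 176 / 10 ^+ 4 -> S1 <= 281 / 10 ^+ 4 -> S2 <= 582 / 10 ^+ 4 ->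
  A <= V + (S0 * A + S1 * B) -> 333 / 10 ^+ 3 * B <= S1 * A + S2 * B ->
  A <= 1021 / 10 ^+ 3 * V /\ B <= 105 / 10 ^+ 3 * V.
Proof.
move=> A0 B0 h0 h1 h2 hA hB.
have hB' : B <= 1023 / 10 ^+ 4 * A.
  have := ler_wpM2r A0 h1; have := ler_wpM2r B0 h2; lra.
have hA' : A <= 1021 / 10 ^+ 3 * V.
  have := ler_wpM2r A0 h0; have := ler_wpM2r B0 h1; lra.
by split=> //; lra.
Qed.

End certificate_numeric.

Section half_angle.
Variable R : realType.

Lemma sin_half_gt0 (x : R) : 0 < x <= pi -> 0 < sin (x / 2).
Proof. by move=> /andP[x0 xp]; rewrite sin_gt0_pi //; apply/andP; split; lra. Qed.

Lemma norm_sin_half (x : R) : `|x| <= pi -> `|sin (x / 2)| = sin (`|x| / 2).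
Proof.
wlog x0 : x / 0 <= x.
  move=> H; have [|/ltW x0] := leP 0 x; first exact: H.
  move=> xp; have := H (- x); rewrite oppr_ge0 mulNr sinN !normrN.
  by apply.
rewrite (ger0_norm x0) => xp; rewrite ger0_norm // sin_ge0_pi //.
by apply/andP; split; lra.
Qed.

Lemma inv_sqr_sin_half (x : R) : 0 < x <= pi -> (sin (x / 2)) ^- 2 <= 1 + (x / 2) ^- 2.
Proof. by move=> /andP[x0 xp]; apply: inv_sqr_sin; apply/andP; split; lra. Qed.

End half_angle.

Section torus_certificate.
Variables (R : realType) (m : nat) (I : finType) (tau : I -> R).
Hypothesis m128 : (128 <= m)%N.
Hypothesis sep : forall i j, i != j -> forall k : int,
  5 * pi / m%:R <= `|tau i - tau j + 2 * pi * k%:~R|.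

Let n := m./2.+1.
Let n65 : (65 <= n)%N.
Proof. by rewrite /n ltnS; have := half_leq m128. Qed.
Let nR0 : 0 < n%:R :> R. Proof. by rewrite ltr0n. Qed.

Let delta : R := 5 * pi / m%:R.

(** With [n] just above [m / 2], a separation of [5 pi / m] exceeds [31 / (4 n)]. *)
Lemma n_delta : 31 / 4 <= n%:R * delta.
Proof.
have mR : m%:R <= 2 * n%:R :> R.
  rewrite -natrM ler_nat /n mulnS -[X in (X <= _)%N]odd_double_half -mul2n.
  by rewrite leq_add2r; case: odd.
have m0 : 0 < m%:R :> R by rewrite ltr0n (leq_trans _ m128).
rewrite /delta mulrA ler_pdivlMr //; have := pi_ge31 R; nra.
Qed.

(** The tail bounds involve [sin (u / 2)], so differences of angles are brought back
to [[-pi, pi]]. *)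
Definition representatives theta (u : I -> R) :=
  forall i, `|u i| <= pi /\ exists k : int, u i = theta - tau i + 2 * pi * k%:~R.

Lemma representatives_exist theta : exists u, representatives theta u.
Proof.
have /choice[k kP] : forall i, exists k : int, `|theta - tau i + 2 * pi * k%:~R| <= pi.
  by move=> i; exact: torus_rep.
by exists (fun i => theta - tau i + 2 * pi * (k i)%:~R) => i; split => //; exists (k i).
Qed.

Lemma representatives_jackson theta u r i : representatives theta u ->
  jackson n r (theta - tau i) = jackson n r (u i).
Proof. by move=> /(_ i)[_ [k ->]]; rewrite jacksonD2piz. Qed.

Lemma representatives_sep theta u i j : representatives theta u -> i != j -> delta <= `|u i - u j|.
Proof.
move=> up ij; have [_ [k ->]] := up i; have [_ [l ->]] := up j.
have := sep ij (l - k); rewrite -normrN; congr (_ <= `|_|).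
by rewrite intrB; ring.
Qed.

(** Combines the decay of the kernel with the packing bound. The separation enters
through [n_delta]: all angles are at least [rho / n] apart because
[rho <= 31 / 4]. *)
Lemma tails theta u (P : pred I) rho zeta S r : representatives theta u ->
  3 <= rho <= 31 / 4 -> (forall i, P i -> rho <= `|n%:R * u i|) ->
  0 <= zeta -> 65 ^- 2 + 4 * rho ^- 2 <= zeta ^+ 2 ->
  36 * rho ^- 4 + rho ^- 2 / 100 <= S -> (r <= 3)%N ->
  \sum_(i | P i) `|jackson n r (theta - tau i)| <= tail_coef zeta r * S.
Proof.
move=> up /andP[rho3 rho7] uP zeta0 zetaP SP r3.
have rho0 : 0 < rho by apply: lt_le_trans rho3.
pose q := rho / n%:R.
have nq : n%:R * q = rho by rewrite /q mulrC mulfVK // gt_eqF.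
have q0 : 0 < q by rewrite divr_gt0.
have uq i : P i -> q <= `|u i|.
  by move/uP; rewrite normrM ger0_norm // /q ler_pdivrMr // mulrC.
have qd : q <= delta by rewrite -(ler_pM2l nR0) nq (le_trans rho7) // n_delta.
have zz i : P i -> 0 < `|n%:R * sin (u i / 2)| /\ `|n%:R * sin (u i / 2)|^-1 <= zeta.
  move=> Pi; have [upi _] := up i.
  have ui0 : 0 < `|u i| by exact: lt_le_trans (uq i Pi).
  have E := norm_sin_half upi.
  have upi' : 0 < `|u i| <= pi by rewrite ui0.
  have s0 : 0 < `|sin (u i / 2)| by rewrite E sin_half_gt0.
  have h := inv_sqr_sin_half upi'; rewrite -E in h.
  rewrite normrM (ger0_norm (ltW nR0)) mulr_gt0 //; split => //.
  rewrite -ler_sqr ?nnegrE ?invr_ge0 ?mulr_ge0 ?(ltW nR0) //.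
  apply: le_trans zetaP; rewrite exprVn exprMn invfM.
  have /andP[w0 w1] := n_inv2 R n65.
  apply: le_trans (ler_wpM2l w0 h) _; rewrite mulrDr mulr1; apply: lerD => //.
  have -> : n%:R ^- 2 * (`|u i| / 2) ^- 2 = 4 * (n%:R * `|u i|) ^- 2.
    by field; rewrite !gt_eqF.
  have nu : rho <= n%:R * `|u i|.
    by have := uP i Pi; rewrite normrM (ger0_norm (ltW nR0)).
  have nu0 : 0 < n%:R * `|u i| by rewrite mulr_gt0.
  by rewrite ler_wpM2l // lef_pV2 ?posrE ?exprn_gt0 // ler_sqr ?nnegrE // ltW.
have pk : \sum_(i | P i) (n%:R * sin (u i / 2)) ^- 4 <= S.
  apply: le_trans SP; rewrite -nq.
  have [i0 Pi0|P0] := pickP P; last first.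
    by rewrite big_pred0 // addr_ge0 ?mulr_ge0 ?invr_ge0 ?exprn_ge0 ?mulr_ge0 // ltW.
  apply: packing => //.
  - by have [+ _] := up i0; apply: le_trans; exact: uq.
  - by rewrite nq (le_trans rho7) //; lra.
  - by move=> i Pi; rewrite uq //=; have [] := up i.
  - by move=> i j _ _ ij; exact: le_trans qd (representatives_sep up ij).
have tc0 : 0 <= tail_coef zeta r.
  rewrite /tail_coef.
  by case: r r3 => [|[|[|r]]] _ //=; rewrite ?(addr_ge0, mulr_ge0, sqr_ge0, invr_ge0).
apply: le_trans (ler_wpM2l tc0 pk); rewrite mulr_sumr.
apply: ler_sum => i Pi; have [z0 zi] := zz i Pi.
by rewrite (representatives_jackson _ _ up); exact: jackson_tail.
Qed.

(** For a point within [1 / n] of a node, the other nodes are at distance at least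
[(31 / 4 - 1) / n]. The entries are the bounds of [tails] for [rho = 27 / 4],
rounded up. *)
Lemma tails_near theta u (P : pred I) r : representatives theta u ->
  (forall i, P i -> 27 / 4 <= `|n%:R * u i|) -> (r <= 3)%N ->
  \sum_(i | P i) `|jackson n r (theta - tau i)| <=
  nth 0 [:: 176 / 10 ^+ 4; 281 / 10 ^+ 4; 582 / 10 ^+ 4; 139 / 10 ^+ 3] r.
Proof.
move=> up uP r3.
have := @tails theta u P (27 / 4) (297 / 10 ^+ 3) (1757 / 10 ^+ 5) r up.
move=> /(_ _ uP _ _ _ r3); move=> /(_ ltac:(lra) ltac:(lra) ltac:(lra) ltac:(lra)).
move/le_trans; apply; rewrite /tail_coef; case: r r3 => [|[|[|[|//]]]] _ /=; lra.
Qed.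

(** For a point within [3 / n] of a node, [rho = 31 / 4 - 3] for the other nodes. *)
Lemma tails_mid theta u (P : pred I) r : representatives theta u ->
  (forall i, P i -> 19 / 4 <= `|n%:R * u i|) -> (r <= 1)%N ->
  \sum_(i | P i) `|jackson n r (theta - tau i)| <= nth 0 [:: 712 / 10 ^+ 4; 1313 / 10 ^+ 4] r.
Proof.
move=> up uP r1; have r3 : (r <= 3)%N by exact: leq_trans r1 _.
have := @tails theta u P (19 / 4) (422 / 10 ^+ 3) (712 / 10 ^+ 4) r up.
move=> /(_ _ uP _ _ _ r3); move=> /(_ ltac:(lra) ltac:(lra) ltac:(lra) ltac:(lra)).
move/le_trans; apply; rewrite /tail_coef; case: r r1 {r3} => [|[|//]] _ /=; lra.
Qed.

Lemma tails_far theta u (P : pred I) r : representatives theta u ->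
  (forall i, P i -> 3 <= `|n%:R * u i|) -> (r <= 1)%N ->
  \sum_(i | P i) `|jackson n r (theta - tau i)| <= nth 0 [:: 446 / 10 ^+ 3; 1041 / 10 ^+ 3] r.
Proof.
move=> up uP r1; have r3 : (r <= 3)%N by exact: leq_trans r1 _.
have := @tails theta u P 3 (667 / 10 ^+ 3) (446 / 10 ^+ 3) r up.
move=> /(_ _ uP _ _ _ r3); move=> /(_ ltac:(lra) ltac:(lra) ltac:(lra) ltac:(lra)).
move/le_trans; apply; rewrite /tail_coef; case: r r1 {r3} => [|[|//]] _ /=; lra.
Qed.

End torus_certificate.

(** * Interpolation on the circle *)

Section certificate_bounds.
Variable R : realFieldType.
Implicit Types A B V x : R.

Lemma num_alpha A B V e : A <= 1021 / 10 ^+ 3 * V -> B <= 105 / 10 ^+ 3 * V -> 0 <= V ->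
  e <= 176 / 10 ^+ 4 * A + 281 / 10 ^+ 4 * B -> e <= 21 / 10 ^+ 3 * V.
Proof. lra. Qed.

(** The second derivative of the certificate near a node: the main term [a * j2],
with [a] close to 1, dominates all the others. *)
Lemma num_curvature (a b j2 j3 t : R) : `|a - 1| <= 21 / 10 ^+ 3 -> `|b| <= 105 / 10 ^+ 3 ->
  - (39 / 100) <= j2 <= - (188 / 10 ^+ 3) -> `|j3| <= 3 / 10 ->
  `|t - (a * j2 + b * j3)| <= 582 / 10 ^+ 4 * (1021 / 10 ^+ 3) + 139 / 10 ^+ 3 * (105 / 10 ^+ 3) ->
  - (52 / 100) <= t <= - (78 / 10 ^+ 3).
Proof.
move=> ha hb /andP[j2l j2u] hj3 ht.
have hbj : `|b * j3| <= 105 / 10 ^+ 3 * (3 / 10) by rewrite normrM ler_pM.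
have haj : `|(a - 1) * j2| <= 21 / 10 ^+ 3 * (- j2).
  have j20 : j2 <= 0 by lra.
  by rewrite normrM (ler0_norm j20) ler_wpM2r // oppr_ge0.
move: haj hbj ht; rewrite !ler_norml => /andP[h1 h2] /andP[h3 h4] /andP[h5 h6].
by apply/andP; split; lra.
Qed.

Lemma num_far_one (a b j0 j1 y t : R) : `|a| <= 1021 / 10 ^+ 3 -> `|b| <= 105 / 10 ^+ 3 -> 1 <= y ->
  j0 <= 92 / 100 * (1 - 8 / 100 * y) -> j1 <= 92 / 100 * (y / 3) -> 0 <= j0 -> 0 <= j1 ->
  t <= `|a| * j0 + `|b| * j1 + (712 / 10 ^+ 4 * (1021 / 10 ^+ 3) + 1313 / 10 ^+ 4 * (105 / 10 ^+ 3)) ->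
  t <= 983 / 10 ^+ 3.
Proof.
move=> ha hb y1 h0 h1 j00 j10 ht.
have k0 := ler_pM (normr_ge0 a) j00 ha h0.
have k1 := ler_pM (normr_ge0 b) j10 hb h1.
by lra.
Qed.

Lemma num_far_none (t : R) :
  t <= 446 / 10 ^+ 3 * (1021 / 10 ^+ 3) + 1041 / 10 ^+ 3 * (105 / 10 ^+ 3) ->
  t <= 983 / 10 ^+ 3.
Proof. lra. Qed.

Lemma num_near_dist (nd x y : R) : 31 / 4 <= nd -> nd <= x + y -> x <= 1 -> 27 / 4 <= y.
Proof. lra. Qed.

Lemma num_mid_dist (nd x y : R) : 31 / 4 <= nd -> nd <= x + y -> x <= 3 -> 19 / 4 <= y.
Proof. lra. Qed.

Lemma decimal_ge0 (a k : nat) : 0 <= a%:R / 10 ^+ k :> R.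
Proof. by rewrite divr_ge0 ?exprn_ge0. Qed.

Lemma decimal_gt0 (a k : nat) : 0 < a.+1%:R / 10 ^+ k :> R.
Proof. by rewrite divr_gt0 ?exprn_gt0. Qed.

End certificate_bounds.

Section torus_interpolation.
Variables (R : realType) (m : nat) (I : finType) (tau : I -> R).
Hypothesis m128 : (128 <= m)%N.
Hypothesis sep : forall i j, i != j -> forall k : int,
  5 * pi / m%:R <= `|tau i - tau j + 2 * pi * k%:~R|.

Let n := m./2.+1.
Let n65 : (65 <= n)%N.
Proof. by rewrite /n ltnS; have := half_leq m128. Qed.
Let nR0 : 0 < n%:R :> R. Proof. by rewrite ltr0n. Qed.

(** The derivative of order [r], with respect to [n * theta], of a combination of
translates of the squared kernel and of its derivative. *)
Definition interpolant (al b : I -> R) r theta : R :=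
  \sum_j (al j * jackson n r (theta - tau j) + b j * jackson n r.+1 (theta - tau j)).

Lemma trigpoly_interpolant al b r : trigpoly m (interpolant al b r).
Proof.
have nm : (n.-1 + n.-1 <= m)%N.
  by rewrite /n /= addnn -[X in (_ <= X)%N]odd_double_half leq_addl.
have up f : trigpoly (n.-1 + n.-1) f -> trigpoly m f.
  elim=> [k c kn|{}f g _ tf _ tg|a {}f _ tf]; last exact: trigpoly_scale.
    by apply: trigpoly_cos; exact: leq_trans nm.
  exact: trigpoly_add.
apply: trigpoly_sum => j _; apply: trigpoly_add; apply: trigpoly_scale;
  by apply: (@trigpoly_shift _ _ (jackson n _)); apply: up; exact: trigpoly_jackson.
Qed.

Lemma is_derive_interpolant al b r theta : (r < 2)%N ->
  is_derive theta (1 : R) (interpolant al b r) (n%:R * interpolant al b r.+1 theta).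
Proof.
move=> r2.
have -> : interpolant al b r = \sum_(k < #|I|)
   (fun x => al (enum_val k) * jackson n r (x - tau (enum_val k))
     + b (enum_val k) * jackson n r.+1 (x - tau (enum_val k))).
  apply/funext => x; rewrite fct_sumE /interpolant.
  by rewrite (reindex _ (onW_bij _ (@enum_val_bij I))).
have -> : n%:R * interpolant al b r.+1 theta = \sum_(k < #|I|)
   (al (enum_val k) * (n%:R * jackson n r.+1 (theta - tau (enum_val k)))
     + b (enum_val k) * (n%:R * jackson n r.+2 (theta - tau (enum_val k)))).
  rewrite /interpolant (reindex _ (onW_bij _ (@enum_val_bij I))) mulr_sumr.
  by apply: eq_bigr => k _; ring.
apply: is_derive_sum => k.
have d0 : is_derive theta (1 : R) (fun x => x - tau (enum_val k)) 1.
  by apply: is_derive_eq; rewrite subr0.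
have d1 := @is_derive1_comp R _ (fun x => x - tau (enum_val k)) theta _ _
  (is_derive_jackson n65 (theta - tau (enum_val k)) (leqW r2)) d0.
have d2 := @is_derive1_comp R _ (fun x => x - tau (enum_val k)) theta _ _
  (is_derive_jackson n65 (theta - tau (enum_val k)) (r2 : (r.+1 < 3)%N)) d0.
rewrite !mulr1 in d1 d2.
have := is_deriveD (is_deriveZ (al (enum_val k)) d1) (is_deriveZ (b (enum_val k)) d2).
by [].
Qed.

Lemma representatives_at i u0 : `|u0| <= pi ->
  exists2 u, representatives tau (tau i + u0) u & u i = u0.
Proof.
move=> u0pi; have [u up] := representatives_exist tau (tau i + u0).
exists (fun j => if j == i then u0 else u j); last by rewrite eqxx.
move=> j; case: eqVneq => [->|_]; last exact: up.
by split => //; exists 0; rewrite mulr0 addr0 addrC addKr.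
Qed.

Lemma small_le_pi x : `|n%:R * x| <= 3 -> `|x| <= pi :> R.
Proof.
rewrite normrM ger0_norm // => nx.
have : `|x| <= n%:R * `|x| by rewrite ler_peMl // ler1n.
by move/le_trans/(_ nx)/le_trans; apply; have := pi_ge31 R; lra.
Qed.

Lemma representatives_other theta u i j : representatives tau theta u -> j != i ->
  31 / 4 <= n%:R * (5 * pi / m%:R) :> R /\
  n%:R * (5 * pi / m%:R) <= `|n%:R * u i| + `|n%:R * u j|.
Proof.
move=> up ji; split; first exact: n_delta m128.
rewrite !normrM ger0_norm // -mulrDr ler_wpM2l //.
by apply: le_trans (representatives_sep sep up ji) _; rewrite [X in _ <= X]addrC; exact: ler_normB.
Qed.

Let C : seq R := [:: 176 / 10 ^+ 4; 281 / 10 ^+ 4; 582 / 10 ^+ 4; 139 / 10 ^+ 3].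

(** Near the node [tau i] only the terms of index [i] count; the others are bounded
by [tails_near]. *)
Lemma interpolant_near al b A B r i u0 : (r <= 2)%N -> `|n%:R * u0| <= 1 ->
  (forall j, `|al j| <= A) -> (forall j, `|b j| <= B) ->
  `|interpolant al b r (tau i + u0)
    - (al i * jackson n r u0 + b i * jackson n r.+1 u0)| <= nth 0 C r * A + nth 0 C r.+1 * B.
Proof.
move=> r2 nu0 hA hB.
have A0 : 0 <= A by exact: le_trans (normr_ge0 _) (hA i).
have B0 : 0 <= B by exact: le_trans (normr_ge0 _) (hB i).
have [u up ui] : exists2 u, representatives tau (tau i + u0) u & u i = u0.
  by apply: representatives_at; apply: small_le_pi; apply: le_trans nu0 _; rewrite ler1n.
have far j : j != i -> 27 / 4 <= `|n%:R * u j|.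
  move=> ji; have [h1 h2] := representatives_other up ji.
  by apply: num_near_dist h1 h2 _ => //; rewrite ui.
have t0 := tails_near m128 sep up far (leqW r2).
have t1 := tails_near m128 sep up far (r2 : (r.+1 <= 3)%N).
rewrite /interpolant (bigD1 i) //= [tau i + u0 - tau i]addrC addKr addrAC subrr add0r.
rewrite big_split /=; apply: le_trans (ler_normD _ _) _.
rewrite [nth 0 C r * A]mulrC [_ * B]mulrC; apply: lerD.
  apply: le_trans (ler_wpM2l A0 t0); rewrite mulr_sumr.
  apply: le_trans (ler_norm_sum _ _ _) _; apply: ler_sum => j _.
  by rewrite normrM ler_wpM2r.
apply: le_trans (ler_wpM2l B0 t1); rewrite mulr_sumr.
apply: le_trans (ler_norm_sum _ _ _) _; apply: ler_sum => j _.
by rewrite normrM ler_wpM2r.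
Qed.

Lemma interpolant_at al b A B r i : (r <= 2)%N ->
  (forall j, `|al j| <= A) -> (forall j, `|b j| <= B) ->
  `|interpolant al b r (tau i) - (al i * jackson n r 0 + b i * jackson n r.+1 0)|
    <= nth 0 C r * A + nth 0 C r.+1 * B.
Proof.
move=> r2 hA hB; have := @interpolant_near al b A B r i 0 r2.
by rewrite addr0 mulr0 normr0; apply.
Qed.

Let C_ge0 r : 0 <= nth 0 C r.
Proof.
case: r => [|[|[|[|r]]]]; [exact: (@decimal_ge0 R 176 4) | exact: (@decimal_ge0 R 281 4) | exact: (@decimal_ge0 R 582 4) | exact: (@decimal_ge0 R 139 3) |].
by rewrite /= nth_nil.
Qed.

(** At [tau i] the squared kernel is 1 with null derivative, and its second
derivative is at most [-333 / 1000]. The conditions at the nodes thus determine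
[al i] and [b i] up to the contributions of the other nodes, which are small
multiples of the largest coefficients. *)
Lemma interpolant_coef al b V : 0 <= V ->
  (forall i, `|interpolant al b 0 (tau i)| <= V) ->
  (forall i, interpolant al b 1 (tau i) = 0) ->
  [/\ forall i, `|al i| <= 1021 / 10 ^+ 3 * V, forall i, `|b i| <= 105 / 10 ^+ 3 * V &
      forall i, `|al i - interpolant al b 0 (tau i)| <= 21 / 10 ^+ 3 * V].
Proof.
move=> V0 h0 h1.
pose A := \big[Num.max/0]_i `|al i|; pose B := \big[Num.max/0]_i `|b i|.
have hA i : `|al i| <= A by exact: le_bigmax.
have hB i : `|b i| <= B by exact: le_bigmax.
have A0 : 0 <= A by exact: bigmax_ge_id.
have B0 : 0 <= B by exact: bigmax_ge_id.
have e0 i : `|al i - interpolant al b 0 (tau i)| <= nth 0 C 0 * A + nth 0 C 1 * B.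
  have := @interpolant_at al b A B 0 i isT hA hB.
  by rewrite jackson0_0 // jackson1_0 // mulr0 mulr1 addr0 distrC.
have hA' : A <= V + (nth 0 C 0 * A + nth 0 C 1 * B).
  apply: bigmax_le => [|i _].
    by apply: addr_ge0 V0 (addr_ge0 _ _); exact: mulr_ge0.
  rewrite -[al i](subrK (interpolant al b 0 (tau i))) addrC.
  by apply: le_trans (ler_normD _ _) _; exact: lerD.
have hB' : 333 / 10 ^+ 3 * B <= nth 0 C 1 * A + nth 0 C 2 * B.
  have j2 := jackson2_0 R n65.
  have := @decimal_gt0 R 332 3.
  move: (333 / 10 ^+ 3) j2 => w j2 w0.
  rewrite -ler_pdivlMl //; apply: bigmax_le => [|i _].
    by apply: mulr_ge0 (addr_ge0 _ _); [rewrite invr_ge0 ltW | exact: mulr_ge0 ..].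
  rewrite ler_pdivlMl //.
  have := @interpolant_at al b A B 1 i isT hA hB.
  rewrite h1 jackson1_0 // mulr0 !add0r normrN normrM; apply: le_trans.
  rewrite mulrC ler_wpM2l // ler0_norm; last by apply: le_trans j2 _; rewrite oppr_le0 ltW.
  by rewrite lerNr.
have [a1 b1] := num_system A0 B0 (lexx _) (lexx _) (lexx _) hA' hB'.
split=> i; [exact: le_trans a1|exact: le_trans b1|].
exact: num_alpha a1 b1 V0 (e0 i).
Qed.

(** Solvability is injectivity, and injectivity is the bound of [interpolant_coef]
for null values. *)
Lemma interpolation (v : I -> R) : (forall i, `|v i| <= 1) ->
  exists al b, [/\ forall i, interpolant al b 0 (tau i) = v i,
    forall i, interpolant al b 1 (tau i) = 0,
    forall i, `|al i| <= 1021 / 10 ^+ 3, forall i, `|b i| <= 105 / 10 ^+ 3 &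
    forall i, `|al i - v i| <= 21 / 10 ^+ 3].
Proof.
move=> hv.
(* Unknowns [(j, true)] are the [al j], unknowns [(j, false)] the [b j]; equations
   [(i, true)] prescribe values, equations [(i, false)] null derivatives. *)
pose M (p q : I * bool) : R :=
  jackson n ((if p.2 then 0 else 1) + (if q.2 then 0 else 1)) (tau p.1 - tau q.1).
have ME (x : I * bool -> R) p : \sum_q M p q * x q =
    interpolant (fun j => x (j, true)) (fun j => x (j, false)) (if p.2 then 0 else 1)%N (tau p.1).
  transitivity (\sum_j \sum_c M p (j, c) * x (j, c)).
    by rewrite pair_bigA; apply: eq_bigr => -[].
  apply: eq_bigr => j _; rewrite big_bool /M /=.
  by rewrite addn0 addn1 mulrC [X in _ + X]mulrC.
have [|x xP] := @solve_system _ _ M (fun p => if p.2 then v p.1 else 0).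
  move=> x x0.
  have [//| | |a0 b0 _] := @interpolant_coef (fun j => x (j, true)) (fun j => x (j, false)) 0.
  - by move=> i; have := x0 (i, true); rewrite ME /= => ->; rewrite normr0.
  - by move=> i; have := x0 (i, false); rewrite ME.
  move=> [j c]; apply/eqP; rewrite -normr_le0.
  by case: c; [have := a0 j|have := b0 j]; rewrite mulr0.
exists (fun j => x (j, true)), (fun j => x (j, false)).
have i0 i := xP (i, true); have i1 i := xP (i, false).
have {}i0 i : interpolant (fun j => x (j, true)) (fun j => x (j, false)) 0 (tau i) = v i.
  by have := i0 i; rewrite ME.
have {}i1 i : interpolant (fun j => x (j, true)) (fun j => x (j, false)) 1 (tau i) = 0.
  by have := i1 i; rewrite ME.
have [//| | |a1 b1 e1] := @interpolant_coef (fun j => x (j, true)) (fun j => x (j, false)) 1.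
- by move=> i; rewrite i0.
- by [].
by split => // i; [have := a1 i|have := b1 i|have := e1 i; rewrite i0]; rewrite mulr1.
Qed.

Lemma interpolant_bound al b A B theta (P : pred I) s0 s1 : 0 <= A -> 0 <= B ->
  (forall j, `|al j| <= A) -> (forall j, `|b j| <= B) ->
  \sum_(i | P i) `|jackson n 0 (theta - tau i)| <= s0 ->
  \sum_(i | P i) `|jackson n 1 (theta - tau i)| <= s1 ->
  `|\sum_(j | P j) (al j * jackson n 0 (theta - tau j) + b j * jackson n 1 (theta - tau j))|
    <= s0 * A + s1 * B.
Proof.
move=> A0 B0 hA hB h0 h1; rewrite big_split /=; apply: le_trans (ler_normD _ _) _.
apply: lerD; apply: le_trans (ler_norm_sum _ _ _) _.
  apply: le_trans (ler_wpM2r A0 h0); rewrite mulr_suml; apply: ler_sum => j _.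
  by rewrite normrM mulrC ler_wpM2l.
apply: le_trans (ler_wpM2r B0 h1); rewrite mulr_suml; apply: ler_sum => j _.
by rewrite normrM mulrC ler_wpM2l.
Qed.

(** The interpolant with null derivative at the nodes. Near a node its second
derivative is governed by that of the squared kernel, which gives the quadratic
bounds. Elsewhere at most one node is within [3 / n], where [jackson_mid]
applies, and the other nodes contribute little. *)
Lemma torus_certificate (v : I -> R) : (forall i, v i = 1 \/ v i = - 1) ->
  exists D, [/\ trigpoly m D,
    forall i u, `|n%:R * u| <= 1 ->
      1 - 26 / 100 * (n%:R * u) ^+ 2 <= v i * D (tau i + u) <= 1 - 39 / 10 ^+ 3 * (n%:R * u) ^+ 2 &
    forall theta, (forall i (k : int), 1 <= `|n%:R * (theta - tau i + 2 * pi * k%:~R)|) ->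
      `|D theta| <= 983 / 10 ^+ 3].
Proof.
move=> hv.
have nv i : `|v i| = 1 by case: (hv i) => ->; rewrite ?normrN normr1.
have vv i : v i * v i = 1 by case: (hv i) => ->; rewrite ?mulrNN mulr1.
have [|al [b [i0 i1 ha hb hav]]] := @interpolation v; first by move=> i; rewrite nv.
exists (interpolant al b 0); split; first exact: trigpoly_interpolant.
- move=> i u nu.
  pose F r x := v i * interpolant al b r (tau i + x).
  have dF r x : (r < 2)%N -> is_derive x (1 : R) (F r) (n%:R * F r.+1 x).
    move=> r2.
    have d0 : is_derive x (1 : R) (fun x => tau i + x) 1.
      by apply: is_derive_eq (add0r _).
    have d1 := @is_derive1_comp R _ (fun x => tau i + x) x _ _
      (is_derive_interpolant al b (tau i + x) r2) d0.
    have := is_deriveZ (v i) d1; rewrite mulr1 /F => d2.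
    by rewrite mulrCA.
  have := @taylor2 R n%:R (78 / 10 ^+ 3) (52 / 100) (F 0%N) (F 1%N) (F 2%N) nR0.
  move=> /(_ (fun x => dF 0%N x isT) (fun x => dF 1%N x isT)).
  rewrite /F !addr0 i0 i1 vv mulr0 => /(_ erefl erefl _ u nu) h.
  have -> : 26 / 100 = 52 / 100 / 2 :> R by field.
  have -> : 39 / 10 ^+ 3 = 78 / 10 ^+ 3 / 2 :> R by field.
  apply: h => x nx.
  have := @interpolant_near al b _ _ 2 i x isT nx ha hb => /= h.
  apply: (@num_curvature _ (v i * al i) (v i * b i) (jackson n 2 x) (jackson n 3 x)).
  + have -> : v i * al i - 1 = v i * (al i - v i) by rewrite mulrBr vv.
    by rewrite normrM nv mul1r; exact: hav.
  + by rewrite normrM nv mul1r; exact: hb.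
  + exact: jackson2_near.
  + exact: jackson3_near.
  + have -> : v i * interpolant al b 2 (tau i + x) -
        (v i * al i * jackson n 2 x + v i * b i * jackson n 3 x) =
      v i * (interpolant al b 2 (tau i + x) - (al i * jackson n 2 x + b i * jackson n 3 x)).
      by ring.
    by rewrite normrM nv mul1r.
- move=> theta far.
  have A0 := @decimal_ge0 R 1021 3.
  have B0 := @decimal_ge0 R 105 3.
  have [u up] := representatives_exist tau theta.
  have uge i : 1 <= `|n%:R * u i| by have [_ [k ->]] := up i; exact: far.
  have [[i ui]|no] := pselect (exists i, `|n%:R * u i| <= 3); last first.
    have u3 i : xpredT i -> 3 <= `|n%:R * u i|.
      by move=> _; rewrite leNgt; apply/negP => /ltW h; apply: no; exists i.
    apply: num_far_none.
    by apply: interpolant_bound A0 B0 ha hb _ _; [exact: (tails_far m128 sep up u3 (isT : (0 <= 1)%N))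
                     |exact: (tails_far m128 sep up u3 (isT : (1 <= 1)%N))].
  have other j : j != i -> 19 / 4 <= `|n%:R * u j|.
    move=> ji; have [h1 h2] := representatives_other up ji.
    by apply: num_mid_dist h1 h2 _.
  have t0 := tails_mid m128 sep up other (isT : (0 <= 1)%N).
  have t1 := tails_mid m128 sep up other (isT : (1 <= 1)%N).
  have u13 : 1 <= `|n%:R * u i| <= 3 by rewrite uge.
  have [j0 j1] := jackson_mid n65 u13.
  apply: num_far_one (ha i) (hb i) (uge i) j0 j1 (normr_ge0 _) (normr_ge0 _) _.
  rewrite /interpolant (bigD1 i) // !(representatives_jackson m _ _ up) -!normrM.
  apply: le_trans (ler_normD _ _) _; apply: lerD; first exact: ler_normD.
  exact: interpolant_bound A0 B0 ha hb t0 t1.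
Qed.

End torus_interpolation.

(** * Even certificates and their coefficients *)

Section parseval.
Variable R : realType.

(** Multiplied by [sin (h / 2)], where [h] is the step, the sum telescopes. *)
Lemma sum_cos_roots (N q : nat) : (0 < q < N)%N ->
  \sum_(0 <= l < N) cos (l%:R * (2 * pi * q%:R / N%:R)) = 0 :> R.
Proof.
move=> /andP[q0 qN]; have N0 : 0 < N%:R :> R by rewrite ltr0n (leq_ltn_trans _ qN).
set h := 2 * pi * q%:R / N%:R.
have s0 : 0 < sin (h / 2).
  have -> : h / 2 = pi * (q%:R / N%:R) by rewrite /h; field; rewrite gt_eqF.
  have qN0 : 0 < q%:R / N%:R :> R by rewrite divr_gt0 // ltr0n.
  rewrite sin_gt0_pi // mulr_gt0 ?pi_gt0 //=.
  by rewrite gtr_pMr ?pi_gt0 // ltr_pdivrMr // mul1r ltr_nat.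
apply: (mulfI (lt0r_neq0 s0)); rewrite mulr0 mulr_sumr.
have E (l : nat) : sin (h / 2) * cos (l%:R * h) =
    (sin (l.+1%:R * h - h / 2) - sin (l%:R * h - h / 2)) / 2.
  have -> : l.+1%:R * h - h / 2 = l%:R * h + h / 2 by rewrite -natr1; field.
  by rewrite sinD sinB; field.
under eq_bigr do rewrite E.
rewrite -mulr_suml telescope_sumr // mul0r add0r sinN opprK.
have -> : N%:R * h - h / 2 = - (h / 2) + 2 * pi * q%:Z%:~R.
  by rewrite /h -pmulrn; field; rewrite gt_eqF.
have sinD2piz (x : R) (k : int) : sin (x + 2 * pi * k%:~R) = sin x.
  by rewrite -!cosBpihalf addrAC cosD2piz.
by rewrite sinD2piz sinN addNr mul0r.
Qed.

Definition cos_sum (m : nat) (p : nat -> R) x : R := \sum_(k < m.+1) p k * cos (k%:R * x).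

(** The mean of [cos (k x) ^ 2] over a period. *)
Definition cos_weight (k : nat) : R := if k == 0%N then 1 else 2^-1.

(** Integration over a period is replaced by an average over [2 m + 1] equidistant
points, which is exact for products of two cosines of degree at most [m]. *)
Lemma parseval_cos (m : nat) (p : nat -> R) : (forall x, `|cos_sum m p x| <= 1) ->
  \sum_(k < m.+1) cos_weight k * p k ^+ 2 <= 1.
Proof.
move=> pb; pose N := (2 * m).+1.
have N0 : 0 < N%:R :> R by rewrite ltr0n.
pose x (l : nat) : R := l%:R * (2 * pi / N%:R).
have orth (j k : 'I_m.+1) : \sum_(0 <= l < N) cos (j%:R * x l) * cos (k%:R * x l)
    = (j == k)%:R * (N%:R * cos_weight k).
  have S q : (q < N)%N -> \sum_(0 <= l < N) cos (q%:R * x l) = (q == 0)%N%:R * N%:R :> R.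
    case: q => [|q] qN.
      rewrite mul1r; under eq_bigr do rewrite mul0r cos0.
      by rewrite sumr_const_nat subn0.
    rewrite mul0r; apply: etrans (@sum_cos_roots N q.+1 qN); apply: eq_bigr => l _.
    by congr cos; rewrite /x; ring.
  wlog jk : j k / (k <= j)%N.
    move=> H; have [|/ltnW kj] := leqP k j; first exact: H.
    under eq_bigr do rewrite mulrC; rewrite (H _ _ kj) eq_sym.
    by case: eqVneq => [->|]; rewrite ?mul0r.
  have E l : cos (j%:R * x l) * cos (k%:R * x l) =
     (cos ((j + k)%N%:R * x l) + cos ((j - k)%N%:R * x l)) / 2.
    have -> : (j + k)%N%:R * x l = j%:R * x l + k%:R * x l by rewrite natrD; ring.
    have -> : (j - k)%N%:R * x l = j%:R * x l - k%:R * x l by rewrite natrB //; ring.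
    by rewrite cosD cosB; field.
  under eq_bigr do rewrite E.
  rewrite -mulr_suml big_split /= !S; last 2 first.
  - by rewrite /N ltnS (leq_trans (leq_subr _ _)) // (leq_trans (leq_ord j)) // leq_pmull.
  - by rewrite /N ltnS mul2n -addnn leq_add // leq_ord.
  rewrite addn_eq0 subn_eq0 /cos_weight -(inj_eq val_inj) /=.
  have -> : (j <= k)%N = (val j == val k) by rewrite eqn_leq jk andbT.
  case: (eqVneq (val j) (val k)) => [->|jk'].
    by rewrite andbb; case: eqP => _; rewrite /= ?mulr1n ?mulr0n; field.
  have -> : (val j == 0%N) && (val k == 0%N) = false.
    by apply/negP => /andP[/eqP j0 /eqP k0]; rewrite j0 k0 eqxx in jk'.
  by rewrite !mul0r addr0 mul0r.
have : \sum_(0 <= l < N) cos_sum m p (x l) ^+ 2 <= \sum_(0 <= l < N) 1.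
  apply: ler_sum => l _; rewrite -real_normK ?num_real //.
  by rewrite expr_le1.
rewrite sumr_const_nat subn0.
have -> : \sum_(0 <= l < N) cos_sum m p (x l) ^+ 2 =
    N%:R * \sum_(k < m.+1) cos_weight k * p k ^+ 2.
  transitivity (\sum_(j < m.+1) \sum_(k < m.+1) p j * p k *
      \sum_(0 <= l < N) cos (j%:R * x l) * cos (k%:R * x l)).
    transitivity (\sum_(0 <= l < N) \sum_(j < m.+1) \sum_(k < m.+1) p j * p k *
        (cos (j%:R * x l) * cos (k%:R * x l))).
      apply: eq_bigr => l _; rewrite expr2 /cos_sum mulr_suml.
      apply: eq_bigr => j _; rewrite mulr_sumr; apply: eq_bigr => k _.
      by rewrite mulrACA.
    rewrite exchange_big; apply: eq_bigr => j _ /=.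
    rewrite exchange_big; apply: eq_bigr => k _ /=.
    by rewrite mulr_sumr.
  rewrite mulr_sumr; apply: eq_bigr => j _.
  under eq_bigr do rewrite orth.
  rewrite (bigD1 j) //= [X in _ + X]big1; last first.
    by move=> k kj; rewrite eq_sym (negbTE kj) mul0r mulr0.
  by rewrite eqxx mulr1n mul1r addr0; ring.
by rewrite -[X in _ <= X](mulr1 N%:R) ler_pM2l.
Qed.

End parseval.

Section even_certificate.
Variables (R : realType) (m s : nat) (th : 'I_s -> R).
Hypothesis m128 : (128 <= m)%N.
Let delta : R := 5 * pi / m%:R.
Let n := m./2.+1.
Hypothesis th_itv : forall i, 0 <= th i <= pi.
Hypothesis th_sep : forall i j, i != j -> delta <= `|th i - th j|.
Hypothesis th_edge : forall i, th i != 0 -> th i != pi -> delta <= 2 * th i <= 2 * pi - delta.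

Let n_gt0 : 0 < n%:R :> R. Proof. by rewrite ltr0n. Qed.

Let delta_le : delta <= pi.
Proof.
have m0 : 0 < m%:R :> R by rewrite ltr0n (leq_trans _ m128).
rewrite /delta ler_pdivrMr // mulrC ler_wpM2l ?pi_ge0 // (ler_nat R 5).
exact: leq_trans m128.
Qed.

(** A lower bound for the distance on the circle between an angle in [[0, 2 pi]]
and the origin. *)
Lemma shift_ge (a d : R) (k : int) : 0 <= a -> d <= a -> d <= 2 * pi - a -> d <= `|a + 2 * pi * k%:~R|.
Proof.
move=> a0 da dpa; have p0 := pi_gt0 R.
have [k0|] := leP 0 k.
  apply: le_trans da _; apply: le_trans (ler_norm _).
  by rewrite lerDl !mulr_ge0 ?ler0z // ltW.
move=> k0; have k1 : (k%:~R : R) <= -1.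
  by rewrite -[-1]/((-1)%:~R) ler_int; lia.
have h : a + 2 * pi * k%:~R <= a - 2 * pi.
  by rewrite lerD2l -[X in _ <= X]mulrN1 ler_wpM2l // mulr_ge0 // ltW.
by apply: le_trans (_ : - (a + 2 * pi * k%:~R) <= _); [lra | rewrite -normrN ler_norm].
Qed.

Lemma shift_ge_pi (a d : R) (k : int) : `|a| <= pi -> d <= `|a| -> d <= pi ->
  d <= `|a + 2 * pi * k%:~R|.
Proof.
wlog a0 : a k / 0 <= a.
  move=> H; have [|/ltW a0] := leP 0 a; first exact: H.
  have := H (- a) (- k); rewrite oppr_ge0 normrN => /(_ a0) H' h1 h2 h3.
  by rewrite -normrN opprD -mulrN -mulrNz; exact: H'.
rewrite (ger0_norm a0) => api da dpi; apply: shift_ge => //.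
by have := lerD dpi (lexx (- a)); lra.
Qed.

Lemma trigpoly_periodic N (f : R -> R) x (k : int) : trigpoly N f ->
  f (x + 2 * pi * k%:~R) = f x.
Proof.
elim=> [j c _|g h _ gE _ hE|c g _ gE]; last by rewrite gE.
  rewrite -(cosD2piz (_ * x + _) (j%:Z * k)); congr cos.
  by rewrite intrM; ring.
by rewrite gE hE.
Qed.

(** The circle certificate for the points [+- theta_i], with the same sign at both,
averaged with its reflection. A spike at 0 or [pi] is its own reflection, so it
yields one point only. *)
Theorem even_certificate (v : 'I_s -> R) : (forall i, v i = 1 \/ v i = -1) ->
  exists p, [/\ forall x, `|cos_sum m p x| <= 1,
    forall i x, `|n%:R * (x - th i)| <= 1 ->
      1 - 26 / 100 * (n%:R * (x - th i)) ^+ 2 <= v i * cos_sum m p x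
        <= 1 - 39 / 10 ^+ 3 * (n%:R * (x - th i)) ^+ 2 &
    forall x, 0 <= x <= pi -> (forall i, 1 <= `|n%:R * (x - th i)|) ->
      `|cos_sum m p x| <= 983 / 10 ^+ 3].
Proof.
move=> hv; have p0 := pi_gt0 R.
(* The index [(i, true)] stands for [th i] and [(i, false)] for [- th i]. *)
pose ok (q : 'I_s * bool) := q.2 || (th q.1 != 0) && (th q.1 != pi).
pose I := {q : 'I_s * bool | ok q}.
pose tau (x : I) : R := if (val x).2 then th (val x).1 else - th (val x).1.
have th0 i : 0 <= th i by case/andP: (th_itv i).
have thpi i : th i <= pi by case/andP: (th_itv i).
have mixed i j (k : int) : th j != 0 -> th j != pi -> delta <= `|th i + th j + 2 * pi * k%:~R|.
  move=> j0 jpi; have [h1 h2] := andP (th_edge j0 jpi).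
  apply: shift_ge; first exact: addr_ge0.
    have [->|ij] := eqVneq i j; first by have := h1; lra.
    apply: le_trans (th_sep ij) _; rewrite ler_norml.
    by have := th0 i; have := th0 j; move=> *; apply/andP; split; lra.
  have [->|ij] := eqVneq i j; first by have := h2; lra.
  apply: le_trans (th_sep ij) _; rewrite ler_norml.
  by have := thpi i; have := thpi j; move=> *; apply/andP; split; lra.
have dth i j : `|th i - th j| <= pi.
  rewrite ler_norml; have := th0 i; have := th0 j; have := thpi i; have := thpi j.
  by move=> *; apply/andP; split; lra.
have sep (x y : I) : x != y -> forall k : int,
    5 * pi / m%:R <= `|tau x - tau y + 2 * pi * k%:~R|.
  case: x y => [[i b] /= oki] [[j c] /= okj]; rewrite -(inj_eq val_inj) /= xpair_eqE => ijbc k.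
  move: oki okj ijbc; rewrite /ok /tau /=; case: b; case: c => /= oki okj.
  - by rewrite andbT => ij; apply: shift_ge_pi => //; exact: th_sep.
  - by move=> _; rewrite opprK; have /andP[j0 jpi] := okj; exact: mixed.
  - move=> _; have /andP[i0 ipi] := oki.
    by rewrite -normrN opprD -mulrN -mulrNz opprB opprK; exact: mixed.
  - rewrite andbT => ij; rewrite -normrN opprD -mulrN -mulrNz !opprK opprD opprK.
    by apply: shift_ge_pi => //; exact: th_sep.
have [D [tD Dnear Dfar]] := torus_certificate m128 sep (fun x : I => hv (val x).1).
have [p pE] := trigpoly_even tD.
have Dper x k : D (x + 2 * pi * k%:~R) = D x by exact: trigpoly_periodic tD.
have D1 x : `|D x| <= 1.
  have [[i [k ik]]|no] := pselect (exists i : I, exists k : int, `|n%:R * (x - tau i + 2 * pi * k%:~R)| <= 1).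
    have /andP[h1 h2] := Dnear i _ ik.
    have -> : D x = D (tau i + (x - tau i + 2 * pi * k%:~R)).
      by rewrite -[LHS](Dper _ k); congr D; ring.
    move: h1 h2 ik; set u := n%:R * _ => h1 h2 ik.
    have u2 : u ^+ 2 <= 1 by rewrite -real_normK ?num_real // expr_le1.
    have u20 := sqr_ge0 u.
    have : `|v (val i).1 * D (tau i + (x - tau i + 2 * pi * k%:~R))| <= 1.
      by rewrite ler_norml; apply/andP; split; lra.
    by rewrite normrM; case: (hv (val i).1) => ->; rewrite ?normrN normr1 mul1r.
  apply: le_trans (Dfar x _) _; last by lra.
  by move=> i k; rewrite leNgt; apply/negP => /ltW h; apply: no; exists i, k.
have Dp x : (D x + D (- x)) / 2 = cos_sum m p x by exact: pE.
exists p; split.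
- move=> x; rewrite -Dp; have := D1 x; have := D1 (- x); rewrite !ler_norml.
  by move=> /andP[h1 h2] /andP[h3 h4]; apply/andP; split; lra.
- move=> i x nx; rewrite -Dp.
  have h1 := Dnear (exist _ (i, true) isT : I) _ nx; rewrite /tau /= subrKC in h1.
  have h2 : 1 - 26 / 100 * (n%:R * (x - th i)) ^+ 2 <= v i * D (- x)
        <= 1 - 39 / 10 ^+ 3 * (n%:R * (x - th i)) ^+ 2.
    have nx' : `|n%:R * - (x - th i)| <= 1 by rewrite mulrN normrN.
    have [okf|] := boolP (ok (i, false)).
      have := Dnear (exist _ (i, false) okf : I) _ nx'; rewrite /tau /= mulrN sqrrN.
      by rewrite opprB addrA addNr add0r.
    rewrite /ok /= negb_and !negbK.
    have := Dnear (exist _ (i, true) isT : I) _ nx'; rewrite /tau /= mulrN sqrrN.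
    move=> h3 /orP[]/eqP thE.
      by move: h3; rewrite thE subr0 add0r.
    move: h3; rewrite thE; have -> : pi - (x - pi) = - x + 2 * pi * 1%:~R by ring.
    by rewrite Dper.
  have -> : v i * ((D x + D (- x)) / 2) = (v i * D x + v i * D (- x)) / 2 by ring.
  move: h1 h2; set S := (n%:R * _) ^+ 2; move: (v i * D x) (v i * D (- x)) => a b.
  by move=> /andP[h1 h2] /andP[h3 h4]; apply/andP; split; lra.
- move=> x /andP[x0 xpi] far.
  have n1pi i : `|x - th i| <= pi.
    rewrite ler_norml; have := th0 i; have := thpi i.
    by move=> *; apply/andP; split; lra.
  have far' i : n%:R^-1 <= `|x - th i|.
    have := far i; rewrite normrM ger0_norm ?(ltW n_gt0) //.
    by rewrite -[n%:R^-1]mulr1 ler_pdivrMl.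
  have farm i (k : int) : n%:R^-1 <= `|x - th i + 2 * pi * k%:~R|.
    by apply: shift_ge_pi (n1pi i) (far' i) (le_trans (far' i) (n1pi i)).
  have farp i (k : int) : n%:R^-1 <= `|x + th i + 2 * pi * k%:~R|.
    apply: shift_ge; first exact: addr_ge0.
      apply: le_trans (far' i) _; rewrite ler_norml; have := th0 i.
      by move=> *; apply/andP; split; lra.
    apply: le_trans (far' i) _; rewrite ler_norml; have := thpi i.
    by move=> *; apply/andP; split; lra.
  have scale (a : R) : n%:R^-1 <= `|a| -> 1 <= `|n%:R * a|.
    move=> h; rewrite normrM (ger0_norm (ltW n_gt0)).
    by have := ler_wpM2l (ltW n_gt0) h; rewrite mulfV // gt_eqF.
  have d1 : `|D x| <= 983 / 10 ^+ 3.
    apply: Dfar => [[[i b] okib] k]; apply: scale; rewrite /tau /=; case: b {okib} => //.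
    by rewrite opprK.
  have d2 : `|D (- x)| <= 983 / 10 ^+ 3.
    apply: Dfar => [[[i b] okib] k]; apply: scale; rewrite /tau /=; case: b {okib}.
      by rewrite -normrN !opprD !opprK -mulrN -mulrNz.
    by rewrite -normrN !opprD !opprK -mulrN -mulrNz.
  rewrite -Dp; move: d1 d2; rewrite !ler_norml => /andP[h1 h2] /andP[h3 h4].
  by apply/andP; split; lra.
Qed.

End even_certificate.

(** * Chebyshev moments of signed measures *)

Section chebyshev_functions.
Variable R : realType.
Implicit Types x : R.

Let I11 : set R := `[-1, 1]%classic.

Lemma phi_acos k x : phi k x = (if k == 0%N then 1 else Num.sqrt 2) * cos (k%:R * acos x).
Proof. by case: k => [|k]; rewrite /phi /= ?mul0r ?cos0 ?mulr1. Qed.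

Lemma phi_bound k x : `|phi k x| <= 2.
Proof.
rewrite phi_acos normrM -[2]mulr1 ler_pM ?cos_max //.
case: ifP => _; first by rewrite normr1 ler1n.
by rewrite ger0_norm ?sqrtr_ge0 // -(ler_sqr (sqrtr_ge0 _)) ?nnegrE // sqr_sqrtr //; lra.
Qed.

(** By the three-term recurrence: on [[-1, 1]] these functions are polynomials. *)
Lemma measurable_chebyshev k : measurable_fun I11 (@chebyshev R k).
Proof.
have mI : measurable I11 by exact: measurable_itv.
suff : measurable_fun I11 (@chebyshev R k) /\ measurable_fun I11 (@chebyshev R k.+1) by case.
elim: k => [|k [IH0 IH1]]; split => //.
- refine (@eq_measurable_fun _ _ R R _ (fun=> 1) _ _ _) => [x _|]; first by rewrite /chebyshev mul0r cos0.
  exact: measurable_cst.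
- refine (@eq_measurable_fun _ _ R R _ id _ _ _) => [x|]; last exact: measurable_id.
  by rewrite inE /= => xI; rewrite /chebyshev mul1r acosK.
- refine (@eq_measurable_fun _ _ R R _ (fun x => 2 * x * chebyshev k.+1 x - chebyshev k x) _ _ _) => [x|].
    rewrite inE /= => xI; rewrite /chebyshev.
    have -> : 2 * x = 2 * cos (acos x) by rewrite acosK.
    have -> : k.+2%:R * acos x = k.+1%:R * acos x + acos x by rewrite -[k.+2%:R]natr1; ring.
    have -> : k%:R * acos x = k.+1%:R * acos x - acos x by rewrite -natr1; ring.
    rewrite (cosB (k.+1%:R * acos x)) (cosD (k.+1%:R * acos x) (acos x)). ring.
  by apply: measurable_funB => //; apply: measurable_funM.
Qed.

Lemma measurable_phi k : measurable_fun I11 (@phi R k).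
Proof.
case: k => [|k]; first exact: measurable_cst.
by apply: measurable_funM; [exact: measurable_cst | exact: measurable_chebyshev].
Qed.

Lemma integrable_phi (mu : {finite_measure set R -> \bar R}) k :
  mu.-integrable I11 (EFin \o phi k).
Proof.
apply: measurable_bounded_integrable; first exact: measurable_itv.
- by rewrite ltey_eq fin_num_measure //; exact: measurable_itv.
- exact: measurable_phi.
- exists 2; split; first exact: num_real.
  by move=> M M2 x _ /=; apply: le_trans (phi_bound k x) (ltW M2).
Qed.

Lemma Rintegral_phi_sum (mu : {finite_measure set R -> \bar R}) n (q : nat -> R) :
  mu.-integrable I11 (EFin \o (fun x => \sum_(k < n) q k * phi k x)) /\
  (\int[mu]_(x in I11) (\sum_(k < n) q k * phi k x)) =
   \sum_(k < n) q k * \int[mu]_(x in I11) phi k x.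
Proof.
have mI : measurable I11 by exact: measurable_itv.
have Zint (a : R) k : mu.-integrable I11 (EFin \o (fun x => a * phi k x)).
  have := integrableZl mI a (integrable_phi mu k).
  by apply: eq_integrable => // x _ /=; rewrite EFinM.
elim: n => [|n [IH1 IH2]].
  have E x : \sum_(k < 0) q k * phi k x = 0 * phi 0 x by rewrite big_ord0 mul0r.
  split; first by apply: eq_integrable (Zint 0 0%N) => // x _ /=; rewrite E.
  under eq_Rintegral do rewrite E.
  by rewrite RintegralZl //; [rewrite mul0r big_ord0 | exact: integrable_phi].
have E x : \sum_(k < n.+1) q k * phi k x = \sum_(k < n) q k * phi k x + q n * phi n x.
  by rewrite big_ord_recr.
split.
  have := integrableD mI IH1 (Zint (q n) n).
  by apply: eq_integrable => // x _ /=; rewrite E EFinD.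
under eq_Rintegral do rewrite E.
rewrite RintegralD // RintegralZl //; last exact: integrable_phi.
by rewrite IH2 big_ord_recr.
Qed.

Lemma Rintegral_phi_bound (mu : {finite_measure set R -> \bar R}) n (q : nat -> R) C :
  (forall x, I11 x -> `|\sum_(k < n) q k * phi k x| <= C) -> 0 <= C ->
  `|\sum_(k < n) q k * \int[mu]_(x in I11) phi k x| <= C * fine (mu setT).
Proof.
move=> qC C0; have mI : measurable I11 by exact: measurable_itv.
have [qi <-] := Rintegral_phi_sum mu n q.
have cint (c : R) : mu.-integrable I11 (EFin \o (fun=> c)).
  apply: measurable_bounded_integrable => //.
    by rewrite ltey_eq fin_num_measure.
  by exists `|c|; split; [exact: num_real | move=> M M2 x _ /=; exact: ltW].
apply: (@le_trans _ _ (C * fine (mu I11))).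
  rewrite ler_norml; apply/andP; split; rewrite -?mulNr -Rintegral_cst //;
    apply: le_Rintegral => // x /qC; rewrite ler_norml => /andP[] //.
rewrite ler_wpM2l // fine_le ?fin_num_measure //.
by apply: le_measure; rewrite ?inE.
Qed.

Variable mu : {charge set R -> \bar R}.

Let mupos := jordan_pos (svalP (hahn_sig mu)).
Let muneg := jordan_neg (svalP (hahn_sig mu)).

Lemma TV_norm_fine : TV_norm mu = (fine (mupos setT) + fine (muneg setT))%:E.
Proof. by rewrite EFinD !fineK ?fin_num_measure. Qed.

Lemma TV_norm_ge0 : (0 <= TV_norm mu)%E.
Proof. by rewrite TV_norm_fine lee_fin addr_ge0 // fine_ge0. Qed.

(** Total variation is dual to the supremum norm; applied to the Jordan parts. *)
Lemma moment_bound n (q : nat -> R) C :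
  (forall x, I11 x -> `|\sum_(k < n) q k * phi k x| <= C) -> 0 <= C ->
  `|\sum_(k < n) q k * moment k mu| <= C * fine (TV_norm mu).
Proof.
move=> qC C0; rewrite TV_norm_fine /= mulrDr.
have h1 := Rintegral_phi_bound mupos qC C0.
have h2 := Rintegral_phi_bound muneg qC C0.
apply: le_trans (lerD h1 h2); apply: le_trans (ler_normB _ _).
by rewrite -sumrB le_eqVlt; apply/orP; left; apply/eqP; congr `|_|;
  apply: eq_bigr => k _; rewrite mulrBr.
Qed.

End chebyshev_functions.

Section discrete_measures.
Variables (R : realType) (s : nat) (a t : 'I_s -> R).
Hypothesis adm : admissible_spikes a t.

Let I11 : set R := `[-1, 1]%classic.
Let tI k : I11 (t k). Proof. by case: adm => _ _ /(_ k) h; rewrite /I11 /= in_itv. Qed.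
Let t_inj : injective t. Proof. by case: adm. Qed.

Lemma discrete_measureE A : measurable A ->
  discrete_measure a t A = (\sum_(k < s) a k * \1_A (t k))%:E.
Proof. by move=> mA; rewrite /discrete_measure -sumEFin; apply: eq_bigr => k _; rewrite EFinM diracE. Qed.

Lemma discrete_measure_on_I : signed_measure_on_I (discrete_measure a t : {charge set R -> \bar R}).
Proof.
move=> A mA A0; rewrite /= discrete_measureE // big1 // => k _.
rewrite indicE memNset ?mulr0 // => At.
have : (A `&` `[-1, 1]%classic) (t k) by split => //; exact: tI.
by rewrite A0.
Qed.

Let measurable_range : measurable (range t).
Proof.
apply: countable_measurable; first by move=> ?; exact: measurable_set1.
by apply: finite_set_countable; apply: finite_image; exact: finite_finset.
Qed.

(** A measure that gives no mass outside finitely many points integrates like a sum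
of point masses. This is used for the Jordan parts of a discrete measure, which
are only known up to the choice of a Hahn decomposition. *)
Lemma Rintegral_atoms (mu : {finite_measure set R -> \bar R}) (f : R -> R) :
  measurable_fun I11 f -> mu (~` range t) = 0%E ->
  \int[mu]_(x in I11) f x = \sum_(k < s) f (t k) * fine (mu [set t k]).
Proof.
move=> mf mu0; have mI : measurable I11 by exact: measurable_itv.
have mr : measurable (~` range t).
  by apply: measurableC; exact: measurable_range.
pose g x := \sum_(k < s) f (t k) * \1_[set t k] x.
have -> : \int[mu]_(x in I11) f x = \int[mu]_(x in I11) g x.
  congr fine; apply: ae_eq_integral => //.
  - exact/measurable_EFinP.
  - apply/measurable_EFinP; apply: measurable_sum => k.
    by apply: measurable_funM; [exact: measurable_cst | exact: measurable_indic].
  - exists (~` range t); split => //.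
    move=> x /= h; apply: contrapT => /contrapT [k _ tk]; apply: h => _.
    congr EFin; rewrite /g (bigD1 k) //= indicE mem_set // mulr1 -tk big1 ?addr0 // => j jk.
    rewrite indicE memNset ?mulr0 //= => /t_inj kj.
    by rewrite kj eqxx in jk.
have gk k : mu.-integrable I11 (EFin \o (fun x => f (t k) * \1_[set t k] x)).
  apply: measurable_bounded_integrable => //.
  - by rewrite ltey_eq fin_num_measure.
  - by apply: measurable_funM; [exact: measurable_cst | exact: measurable_indic].
  exists `|f (t k)|; split; first exact: num_real.
  move=> M M2 x _ /=; rewrite normrM (le_trans _ (ltW M2)) // ler_piMr //.
  by rewrite indicE; case: (_ \in _); rewrite ?normr1 ?normr0.
rewrite /g /Rintegral.
under eq_integral do rewrite -sumEFin.
rewrite integral_sum // -sum_fine; last by move=> k _; exact: integrable_fin_num (gk k).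
apply: eq_bigr => k _.
rewrite -[LHS]/(\int[mu]_(x in I11) (f (t k) * \1_[set t k] x)) RintegralZl //; last first.
  apply: measurable_bounded_integrable => //.
  - by rewrite ltey_eq fin_num_measure.
  exists 1; split; first exact: num_real.
  move=> M M2 x _ /=; rewrite (le_trans _ (ltW M2)) //.
  by rewrite indicE; case: (_ \in _); rewrite ?normr1 ?normr0.
congr (_ * fine _); rewrite integral_indic // setIidl //.
by move=> x ->; exact: tI.
Qed.

Lemma discrete_atom k : discrete_measure a t [set t k] = (a k)%:E.
Proof.
rewrite discrete_measureE // (bigD1 k) //= indicE mem_set // mulr1 big1 ?addr0 // => j jk.
rewrite indicE memNset ?mulr0 //= => /t_inj kj.
by rewrite kj eqxx in jk.
Qed.

Lemma discrete_disjoint A : measurable A -> A `&` range t = set0 ->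
  discrete_measure a t A = 0%E.
Proof.
move=> mA A0; rewrite discrete_measureE // big1 // => k _.
rewrite indicE memNset ?mulr0 // => At.
have : (A `&` range t) (t k) by split => //; exists k.
by rewrite A0.
Qed.

Let mu : {charge set R -> \bar R} := discrete_measure a t.
Let P := (sval (hahn_sig mu)).1.
Let N := (sval (hahn_sig mu)).2.
Let hPN : hahn_decomposition mu P N := svalP (hahn_sig mu).

Let jpos_null : jordan_pos hPN (~` range t) = 0%E.
Proof.
have [[mP _] _ _ _] := hPN.
rewrite jordan_posE cjordan_posE /crestr0 mem_set; last exact: measurableC.
apply: discrete_disjoint; first by apply: measurableI => //; exact: measurableC.
by rewrite setIAC setICl set0I.
Qed.

Let jneg_null : jordan_neg hPN (~` range t) = 0%E.
Proof.
have [_ [mN _] _ _] := hPN.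
rewrite jordan_negE cjordan_negE /crestr0 mem_set; last exact: measurableC.
apply/eqP; rewrite oppe_eq0; apply/eqP; apply: discrete_disjoint.
  by apply: measurableI => //; exact: measurableC.
by rewrite setIAC setICl set0I.
Qed.

Lemma moment_discrete k : moment k mu = \sum_(j < s) a j * phi k (t j).
Proof.
rewrite /moment /charge_Rintegral !Rintegral_atoms //; try exact: measurable_phi.
rewrite -sumrB; apply: eq_bigr => j _; rewrite -mulrBr mulrC; congr (_ * _).
have mt : measurable [set t j] by exact: measurable_set1.
have := jordan_decomp hPN mt.
rewrite /cadd /= cscaleN1 [X in X = _]discrete_atom => /(congr1 fine) /= ->.
by rewrite fineB ?fin_num_measure.
Qed.

Lemma TV_discrete : TV_norm mu = (\sum_(j < s) `|a j|)%:E.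
Proof.
have [[mP pP] [mN nN] PNT PN0] := hPN.
rewrite /TV_norm /charge_variation /= -/hPN.
rewrite jordan_posE jordan_negE cjordan_posE cjordan_negE /crestr0 !mem_set //.
have muE A : measurable A -> mu A = (\sum_(j < s) a j * \1_A (t j))%:E.
  exact: discrete_measureE.
rewrite /crestr !setTI (muE _ mP) (muE _ mN) -EFinN -EFinD.
congr EFin; rewrite -sumrB; apply: eq_bigr => k _; rewrite -mulrBr.
have mt : measurable [set t k] by exact: measurable_set1.
have [kP|kN] : P (t k) \/ N (t k) by rewrite -[_ \/ _]/((P `|` N) (t k)) PNT.
  have kN : ~ N (t k) by move=> kN; rewrite -[False]/(set0 (t k)) -PN0.
  rewrite !indicE mem_set // memNset // subr0 mulr1 ger0_norm //.
  by have := pP _ mt; rewrite /mu /= discrete_atom lee_fin; apply => x ->.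
have kP : ~ P (t k) by move=> kP; rewrite -[False]/(set0 (t k)) -PN0.
rewrite !indicE memNset // mem_set // sub0r mulrN1 ler0_norm //.
by have := nN _ mt; rewrite /mu /= discrete_atom lee_fin; apply => x ->.
Qed.

End discrete_measures.

(** * Atoms with prescribed moments *)

Section atoms.
Variable R : realType.

(** [phi] as a function of the angle ([phi_cos]). *)
Definition psi (k : nat) (x : R) : R := (if k == 0%N then 1 else Num.sqrt 2) * cos (k%:R * x).

Lemma phi_cos k x : 0 <= x <= pi -> phi k (cos x) = psi k x.
Proof. by move=> xpi; rewrite phi_acos cosK. Qed.

Definition mom N (a x : 'I_N -> R) (k : nat) : R := \sum_j a j * psi k (x j).

(** More unknowns than equations. *)
Lemma kernel_vector (I J : finType) (A : I -> J -> R) : (#|I| < #|J|)%N ->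
  exists2 c : J -> R, (exists j, c j != 0) & forall i, \sum_j c j * A i j = 0.
Proof.
move=> IJ; pose M := \matrix_(j < #|J|, i < #|I|) A (enum_val i) (enum_val j).
have : kermx M != 0.
  rewrite kermx_eq0 /row_free neq_ltn (leq_ltn_trans (rank_leq_col M)) //.
move=> /rowV0Pn[v /sub_kermxP vM /rV0Pn[j vj]].
exists (fun j => v 0 (enum_rank j)); first by exists (enum_val j); rewrite enum_valK.
move=> i; have := congr1 (fun w : 'rV_#|I| => w 0 (enum_rank i)) vM.
rewrite !mxE (reindex _ (onW_bij _ (@enum_rank_bij J))) /= => E; rewrite -[RHS]E.
by apply: eq_bigr => l _; rewrite mxE !enum_rankK.
Qed.

(** Caratheodory's reduction: weights move along a direction [c] that preserves the
moments, until one of them vanishes. No sign changes on the way, so the mass is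
affine along the path and does not increase once [c] is oriented suitably. *)
Lemma drop_atom (J : finType) m (f : 'I_m -> J -> R) (a : J -> R) : (m < #|J|)%N ->
  exists a' i0, [/\ a' i0 = 0, \sum_j `|a' j| <= \sum_j `|a j| &
    forall k, \sum_j a' j * f k j = \sum_j a j * f k j].
Proof.
move=> mJ; have [[i0 ai0]|a0] := pselect (exists i, a i = 0); first by exists a, i0.
have {}a0 i : a i != 0 by apply/eqP => ai; apply: a0; exists i.
have [|c [j0 cj0] cf] := @kernel_vector _ _ f; first by rewrite card_ord.
wlog cs : c cj0 cf / 0 <= \sum_j c j * Num.sg (a j).
  move=> H; have [|/ltW h] := leP 0 (\sum_j c j * Num.sg (a j)); first exact: H.
  apply: (H (fun j => - c j)); first by rewrite oppr_eq0.
    by move=> i; under eq_bigr do rewrite mulNr; rewrite sumrN cf oppr0.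
  by under eq_bigr do rewrite mulNr; rewrite sumrN oppr_ge0.
pose w j := c j * Num.sg (a j).
have [j1 wj1] : exists j, 0 < w j.
  apply: contrapT => nw.
  have w0 j : w j <= 0 by rewrite leNgt; apply/negP => h; apply: nw; exists j.
  have : \sum_j - w j = 0.
    by apply/eqP; rewrite eq_le sumr_ge0 ?andbT => [|j _]; rewrite ?sumrN ?oppr_le0 ?oppr_ge0.
  move/eqP; rewrite psumr_eq0 => [|j _]; last by rewrite oppr_ge0.
  move=> /allP/(_ j0 (mem_index_enum _)); rewrite oppr_eq0 mulf_eq0 (negbTE cj0) /=.
  by rewrite sgr_eq0 (negbTE (a0 _)).
have [j2 wj2 jmin] := @Order.TotalTheory.arg_minP _ _ _ j1 (fun j => 0 < w j) (fun j => `|a j| / w j) wj1.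
(* The first time at which a weight vanishes. *)
pose e := `|a j2| / w j2.
have e0 : 0 <= e by rewrite divr_ge0 // ltW.
have ew j : e * w j <= `|a j|.
  have [wj|wj] := ltP 0 (w j); last by apply: le_trans (normr_ge0 _); rewrite mulr_ge0_le0.
  by rewrite -ler_pdivlMr //; exact: jmin.
have norma' j : `|a j - e * c j| = `|a j| - e * w j.
  have sg1 : `|Num.sg (a j)| = 1 by rewrite normr_sg a0.
  rewrite -[LHS]mul1r -sg1 -normrM mulrBr -normrEsg.
  have -> : Num.sg (a j) * (e * c j) = e * w j by rewrite /w; ring.
  by rewrite ger0_norm // subr_ge0.
exists (fun j => a j - e * c j), j2; split.
- apply/eqP; rewrite -normr_eq0 norma' /e mulfVK ?subrr //; exact: lt0r_neq0.
- under eq_bigr do rewrite norma'.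
  by rewrite sumrB gerBl -mulr_sumr mulr_ge0.
- move=> k; under eq_bigr do rewrite mulrBl -mulrA.
  by rewrite sumrB -mulr_sumr cf mulr0 subr0.
Qed.

(** Weighted atoms are encoded as a row that holds the weights and then the angles,
so that compactness can be used in a space of row vectors. *)
Definition wt N (v : 'rV[R]_(N + N)) (j : 'I_N) : R := v 0 (lshift N j).
Definition ang N (v : 'rV[R]_(N + N)) (j : 'I_N) : R := v 0 (rshift N j).
Definition atoms N (a x : 'I_N -> R) : 'rV[R]_(N + N) :=
  row_mx (\row_j a j) (\row_j x j).

Lemma wt_atoms N (a x : 'I_N -> R) : wt (atoms a x) = a.
Proof. by apply/funext => j; rewrite /wt /atoms row_mxEl mxE. Qed.

Lemma ang_atoms N (a x : 'I_N -> R) : ang (atoms a x) = x.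
Proof. by apply/funext => j; rewrite /ang /atoms row_mxEr mxE. Qed.

Definition mass N (v : 'rV[R]_(N + N)) : R := \sum_j `|wt v j|.

Definition atom_set N r : set 'rV[R]_(N + N) :=
  [set v | mass v <= r /\ forall j, 0 <= ang v j <= pi].

Lemma continuous_sum (T : topologicalType) (I : finType) (F : I -> T -> R) :
  (forall i, continuous (F i)) -> continuous (fun v => \sum_i F i v).
Proof.
by move=> cF; apply: (continuous_big add_continuous) => i _; exact: cF.
Qed.

Lemma continuous_mass N : continuous (@mass N).
Proof.
apply: continuous_sum => j v; apply: continuous_comp; last exact: norm_continuous.
exact: coord_continuous.
Qed.

Lemma continuous_mom N k : continuous (fun v : 'rV[R]_(N + N) => mom (wt v) (ang v) k).
Proof.
apply: continuous_sum => j v.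
apply: (@continuousM _ _ (fun v : 'rV[R]_(N + N) => wt v j) (fun v => psi k (ang v j))).
  exact: coord_continuous.
apply: continuousM; first exact: cst_continuous.
apply: (@continuous_comp _ _ _ (fun v : 'rV[R]_(N + N) => k%:R * ang v j) cos).
  apply: (@continuousM _ _ (fun=> k%:R) (fun v : 'rV[R]_(N + N) => ang v j)).
    exact: cst_continuous.
  exact: coord_continuous.
exact: continuous_cos.
Qed.

Lemma compact_atom_set N r : compact (@atom_set N r).
Proof.
pose B (i : 'I_(N + N)) : set R := if (i < N)%N then `[-r, r]%classic else `[0, pi]%classic.
have cB : compact [set v : 'rV[R]_(N + N) | forall i, B i (v ord0 i)].
  by apply: rV_compact => i; rewrite /B; case: ifP => _; exact: segment_compact.
have clm : closed [set v : 'rV[R]_(N + N) | mass v <= r].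
  apply: (@preimage_closed _ _ (@mass N) [set y | y <= r]); last exact: closed_le.
  by move=> v _; exact: continuous_mass.
suff -> : @atom_set N r =
    [set v : 'rV[R]_(N + N) | forall i, B i (v ord0 i)] `&` [set v : 'rV[R]_(N + N) | mass v <= r].
  exact: compact_closedI.
apply/seteqP; split => v.
  move=> [mv xv]; split => // i; rewrite /B.
  case: (split_ordP i) => j -> /=.
    rewrite in_itv /= -ler_norml; apply: le_trans mv.
    by rewrite /mass (bigD1 j) //= lerDl sumr_ge0.
  by rewrite in_itv /=; exact: xv.
move=> [Bv mv]; split => // j; have := Bv (rshift N j).
by rewrite /B /= ltnNge leq_addr /= in_itv.
Qed.

Lemma atom_set0 N r : 0 <= r -> @atom_set N r !=set0.
Proof.
move=> r0; exists (atoms (fun=> 0) (fun=> 0)); split.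
  by rewrite /mass wt_atoms big1 // => j _; rewrite normr0.
by move=> j; rewrite ang_atoms lexx pi_ge0.
Qed.

Lemma atom_min N r (C : set 'rV[R]_(N + N)) (F : 'rV[R]_(N + N) -> R) :
  continuous F -> closed C -> @atom_set N r `&` C !=set0 ->
  exists2 v, (@atom_set N r `&` C) v & forall w, (@atom_set N r `&` C) w -> F v <= F w.
Proof.
move=> cF cC ne.
have [|v] := compact_EVT_min ne (compact_closedI (@compact_atom_set N r) cC) (f := F).
  exact: continuous_subspaceT.
rewrite inE => Kv vmin; exists v => // w Kw; apply: vmin.
by rewrite inE.
Qed.

Lemma reduce_atoms m N (a x : 'I_N.+1 -> R) : (m < N)%N ->
  exists b y : 'I_N -> R, [/\ \sum_j `|b j| <= \sum_j `|a j|,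
    forall k : 'I_m.+1, mom b y k = mom a x k & forall j, exists i, y j = x i].
Proof.
move=> mN; have [|a' [i0 [a'0 a'a a'm]]] :=
  @drop_atom _ _ (fun (k : 'I_m.+1) j => psi k (x j)) a; first by rewrite card_ord.
exists (fun j => a' (lift i0 j)), (fun j => x (lift i0 j)); split.
- by move: a'a; rewrite (bigD1_ord i0) //= a'0 normr0 add0r.
- by move=> k; rewrite /mom -a'm (bigD1_ord i0) //= a'0 mul0r add0r.
- by move=> j; exists (lift i0 j).
Qed.

(** The first-order condition at an end point of a segment. *)
Lemma quadratic_ge0 (b c : R) : (forall t, 0 < t <= 1 -> 0 <= 2 * t * b + t ^+ 2 * c) -> 0 <= b.
Proof.
move=> h; rewrite leNgt; apply/negP => b0.
have c0 : 0 < `|c| + - b + 1 by rewrite -addrA ltr_wpDl // addr_gt0 // oppr_gt0.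
pose t := - b / (`|c| + - b + 1).
have t0 : 0 < t by rewrite divr_gt0 // oppr_gt0.
have t1 : t <= 1 by rewrite ler_pdivrMr // mul1r; have := normr_ge0 c; lra.
have := h t; rewrite t0 t1 => /(_ isT).
have tc : t * c <= - b.
  apply: (@le_trans _ _ (t * (`|c| + - b + 1))).
    by rewrite ler_wpM2l ?(ltW t0) //; have := ler_norm c; lra.
  by rewrite /t mulfVK // gt_eqF.
have -> : 2 * t * b + t ^+ 2 * c = t * (2 * b + t * c) by ring.
by rewrite pmulr_rge0 //; lra.
Qed.

(** The hypothesis says that no affine functional separates [c] from the moments of
the measures of mass at most [r]. Among the families of [m + 1] atoms, which
form a compact set, pick the one whose moments are closest to [c], with error
[d]. Moving a little mass to any angle and returning to [m + 1] atoms by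
[reduce_atoms] gives first-order conditions, which with the hypothesis for
[q = - d] yield [\sum_k d k ^ 2 <= 0]. *)
Lemma represent m r (c : nat -> R) : 0 <= r ->
  (forall (q : nat -> R) S, (forall x, 0 <= x <= pi -> r * `|\sum_(k < m.+1) q k * psi k x| <= S) ->
     \sum_(k < m.+1) q k * c k <= S) ->
  exists a x : 'I_m.+1 -> R, [/\ \sum_j `|a j| <= r, forall j, 0 <= x j <= pi &
    forall k : 'I_m.+1, mom a x k = c k].
Proof.
move=> r0 hc; pose F (v : 'rV[R]_(m.+1 + m.+1)) := \sum_(k < m.+1) (mom (wt v) (ang v) k - c k) ^+ 2.
have cF : continuous F.
  apply: continuous_sum => k v.
  apply: (@continuous_comp _ _ _ (fun v => mom (wt v) (ang v) k - c k) (fun y => y ^+ 2)).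
    by apply: continuousB; [exact: continuous_mom | exact: cst_continuous].
  exact: exprn_continuous.
have [|v [[mv xv] _] vmin] := atom_min cF closedT (r := r).
  by rewrite setIT; exact: atom_set0.
exists (wt v), (ang v); split => // k0.
pose d (k : nat) := mom (wt v) (ang v) k - c k.
(* Optimality against the mass [sg] at the angle [th], where [|sg| <= r]. *)
have opt th (sg : R) : 0 <= th <= pi -> `|sg| <= r ->
    0 <= \sum_(k < m.+1) d k * (sg * psi k th - mom (wt v) (ang v) k).
  move=> thpi sgr; apply: (@quadratic_ge0 _
    (\sum_(k < m.+1) (sg * psi k th - mom (wt v) (ang v) k) ^+ 2)) => t /andP[t0 t1].
  pose a1 (j : 'I_m.+2) := if unlift ord0 j is Some i then (1 - t) * wt v i else t * sg.
  pose x1 (j : 'I_m.+2) := if unlift ord0 j is Some i then ang v i else th.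
  have [b [y [by1 by2 by3]]] := reduce_atoms a1 x1 (ltnSn m).
  have Kb : (@atom_set m.+1 r `&` setT) (atoms b y).
    split => //; split.
      rewrite /mass wt_atoms; apply: le_trans by1 _.
      rewrite big_ord_recl /a1 unlift_none /=.
      under eq_bigr do rewrite liftK normrM (ger0_norm (_ : 0 <= 1 - t)) ?subr_ge0 //.
      rewrite -mulr_sumr normrM (ger0_norm (ltW t0)).
      have h1 := ler_wpM2l (ltW t0) sgr.
      have t1' : 0 <= 1 - t by rewrite subr_ge0.
      by have h2 := ler_wpM2l t1' mv; rewrite /mass in h2; lra.
    move=> j; rewrite ang_atoms; have [i ->] := by3 j; rewrite /x1.
    by case: unliftP => [i' _|_].
  have := vmin _ Kb; rewrite /F wt_atoms ang_atoms -subr_ge0.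
  have momE (k : 'I_m.+1) : mom b y k - c k = d k + t * (sg * psi k th - mom (wt v) (ang v) k).
    rewrite by2 /mom big_ord_recl /a1 /x1 unlift_none /= /d.
    under eq_bigr do rewrite liftK -mulrA.
    by rewrite -mulr_sumr -/(mom _ _ _); ring.
  under eq_bigr do rewrite momE.
  congr (0 <= _); rewrite -sumrB !mulr_sumr -big_split /=; apply: eq_bigr => k _.
  by rewrite /d; ring.
(* The separation hypothesis in the direction of the error. *)
have := hc (fun k => - d k) (- \sum_(k < m.+1) d k * mom (wt v) (ang v) k).
have -> : \sum_(k < m.+1) - d k * c k = \sum_(k < m.+1) d k ^+ 2 - \sum_(k < m.+1) d k * mom (wt v) (ang v) k.
  by rewrite -sumrB; apply: eq_bigr => k _; rewrite /d; ring.
rewrite gerDr => h.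
have /eqP : \sum_(k < m.+1) d k ^+ 2 = 0.
  apply/eqP; rewrite eq_le sumr_ge0 ?andbT => [|k _]; last exact: sqr_ge0.
  apply: h => th thpi.
  have dE (sg : R) : \sum_(k < m.+1) d k * (sg * psi k th - mom (wt v) (ang v) k) =
      sg * (\sum_(k < m.+1) d k * psi k th) - \sum_(k < m.+1) d k * mom (wt v) (ang v) k.
    by rewrite mulr_sumr -sumrB; apply: eq_bigr => k _; ring.
  have h1 : 0 <= r * (\sum_(k < m.+1) d k * psi k th) - \sum_(k < m.+1) d k * mom (wt v) (ang v) k.
    by rewrite -dE; apply: opt; rewrite ?ger0_norm.
  have h2 : 0 <= - r * (\sum_(k < m.+1) d k * psi k th) - \sum_(k < m.+1) d k * mom (wt v) (ang v) k.
    by rewrite -dE; apply: opt; rewrite ?normrN ?ger0_norm.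
  have -> : \sum_(k < m.+1) - d k * psi k th = - \sum_(k < m.+1) d k * psi k th.
    by rewrite -sumrN; apply: eq_bigr => k _; rewrite mulNr.
  rewrite normrN; move: h1 h2; move: (\sum_(k < m.+1) d k * psi k th) => p h1 h2.
  by have [p0|p0] := leP 0 p; [rewrite ger0_norm //; lra | rewrite ltr0_norm //; lra].
rewrite psumr_eq0 => [/allP/(_ k0 (mem_index_enum _))|k _]; last exact: sqr_ge0.
by rewrite sqrf_eq0 subr_eq0 => /eqP.
Qed.

(** Atoms at the same point are added up and null weights dropped, so that the
spikes become admissible. *)
Lemma merge_atoms N (a x : 'I_N -> R) : (forall j, 0 <= x j <= pi) ->
  exists s (a' t' : 'I_s -> R), [/\ admissible_spikes a' t',
    \sum_j `|a' j| <= \sum_j `|a j| & forall k, \sum_j a' j * phi k (t' j) = mom a x k].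
Proof.
move=> xpi; pose S := undup [seq cos (x j) | j <- enum 'I_N].
pose b u := \sum_(j | cos (x j) == u) a j.
pose L := [seq u <- S | b u != 0].
have uL : uniq L by rewrite filter_uniq // undup_uniq.
have inL (j : 'I_(size L)) : nth 0 L j \in L by rewrite mem_nth.
have sumL (F : R -> R) : \sum_(j < size L) F (nth 0 L j) = \sum_(u <- L) F u.
  by rewrite (big_nth 0) big_mkord.
have sumS (F : R -> R -> R) : \sum_(u <- S) \sum_(j | cos (x j) == u) F (a j) u = \sum_j F (a j) (cos (x j)).
  under eq_bigr do rewrite big_mkcond.
  rewrite exchange_big /=; apply: eq_bigr => j _.
  have jS : cos (x j) \in S by rewrite mem_undup map_f ?mem_enum.
  rewrite (bigD1_seq (cos (x j))) ?undup_uniq //= eqxx big1 ?addr0 // => u uj.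
  by rewrite eq_sym (negbTE uj).
exists (size L), (fun j => b (nth 0 L j)), (fun j => nth 0 L j); split.
- split.
  + by move=> i j /eqP; rewrite nth_uniq // => /eqP/val_inj.
  + by move=> j; have := inL j; rewrite mem_filter => /andP[].
  + move=> j; have := inL j; rewrite mem_filter mem_undup => /andP[_ /mapP[i _ ->]].
    by rewrite cos_geN1 cos_le1.
- rewrite (sumL (fun u => `|b u|)) big_filter.
  apply: (@le_trans _ _ (\sum_(u <- S) `|b u|)).
    by rewrite [X in _ <= X](bigID (fun u => b u != 0)) /= lerDl sumr_ge0.
  rewrite -(sumS (fun y _ => `|y|)); apply: ler_sum => u _; exact: ler_norm_sum.
- move=> k; rewrite (sumL (fun u => b u * phi k u)) big_filter.
  have -> : mom a x k = \sum_j a j * phi k (cos (x j)).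
    by apply: eq_bigr => j _; rewrite phi_cos.
  rewrite -(sumS (fun y u => y * phi k u)) [RHS](bigID (fun u => b u != 0)) /=.
  rewrite [X in _ + X]big1 ?addr0 => [|u /negPn/eqP bu].
    by apply: eq_bigr => u _; rewrite /b mulr_suml.
  by rewrite -mulr_suml -/(b u) bu mul0r.
Qed.

End atoms.

(** * Existence of a discrete solution *)

Section existence.
Variable R : realType.

(** The duality bound [moment_bound] is the hypothesis of [represent] for
[r = TV_norm mu]. *)
Lemma charge_atoms m (mu : {charge set R -> \bar R}) :
  exists a x : 'I_m.+1 -> R, [/\ \sum_j `|a j| <= fine (TV_norm mu), forall j, 0 <= x j <= pi &
    forall k : 'I_m.+1, mom a x k = moment k mu].
Proof.
have r0 : 0 <= fine (TV_norm mu) by rewrite fine_ge0 // TV_norm_ge0.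
apply: (@represent R m _ (fun k => moment k mu)) => // q S hS.
apply: le_trans (ler_norm _) _.
have phiE x : `[-1, 1]%classic x ->
    \sum_(k < m.+1) q k * phi k x = \sum_(k < m.+1) q k * psi k (acos x).
  move=> _; apply: eq_bigr => k _; by rewrite phi_acos.
have [rE|r_neq0] := eqVneq (fine (TV_norm mu)) 0.
  have C0 : 0 <= \sum_(k < m.+1) `|q k| * 2 by apply: sumr_ge0 => k _; rewrite mulr_ge0.
  apply: (@le_trans _ _ ((\sum_(k < m.+1) `|q k| * 2) * fine (TV_norm mu))).
    apply: moment_bound => // x _; apply: le_trans (ler_norm_sum _ _ _) _.
    by apply: ler_sum => k _; rewrite normrM ler_wpM2l // phi_bound.
  have := hS 0; rewrite rE mul0r mulr0 lexx pi_ge0; exact.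
have rp : 0 < fine (TV_norm mu) by rewrite lt_neqAle eq_sym r_neq0.
have S0 : 0 <= S.
  by have := hS 0; rewrite lexx pi_ge0 => /(_ isT); apply: le_trans; rewrite mulr_ge0.
rewrite -[S](mulfVK r_neq0); apply: moment_bound; last by rewrite divr_ge0.
move=> x xI; rewrite phiE // ler_pdivlMr // mulrC; apply: hS.
by move: xI; rewrite /= in_itv /= => xI; rewrite acos_ge0 // acos_lepi.
Qed.

Variables (m : nat) (d : int) (nu : {charge set R -> \bar R}) (y : 'I_m.+1 -> R) (lambda : R).
Hypothesis dm : d < m%:Z.
Hypothesis lambda0 : 0 < lambda.

(** By [charge_atoms] every competitor can be replaced by [m + 1] atoms without
increasing the objective, and a competitor of too large mass is worse than [nu].
The minimum over the remaining compact set is attained, and its atoms are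
merged. *)
Lemma blasso_solution : exists (s : nat) (a t : 'I_s -> R),
  admissible_spikes a t /\ is_solution d nu y lambda (discrete_measure a t).
Proof.
pose J (v : 'rV[R]_(m.+1 + m.+1)) : R :=
  2^-1 * (\sum_(k < m.+1) (mom (wt v) (ang v) k - y k) ^+ 2) + lambda * mass v.
pose Q (v : 'rV[R]_(m.+1 + m.+1)) : R :=
  \sum_(k < m.+1) (if k%:Z <= d then 1 else 0) * (mom (wt v) (ang v) k - moment k nu) ^+ 2.
have csq (c : 'I_m.+1 -> R) (k : 'I_m.+1) :
    continuous (fun v : 'rV[R]_(m.+1 + m.+1) => (mom (wt v) (ang v) k - c k) ^+ 2).
  move=> v; apply: (@continuous_comp _ _ _ (fun v => mom (wt v) (ang v) k - c k) (fun y => y ^+ 2)).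
    by apply: continuousB; [exact: continuous_mom | exact: cst_continuous].
  exact: exprn_continuous.
have cJ : continuous J.
  pose S (v : 'rV[R]_(m.+1 + m.+1)) := \sum_(k < m.+1) (mom (wt v) (ang v) k - y k) ^+ 2.
  have cS : continuous S by apply: continuous_sum => k; exact: csq.
  have c1 : continuous (fun v => 2^-1 * S v).
    move=> v; apply: (@continuousM _ _ (fun=> 2^-1) S); first exact: cst_continuous.
    exact: cS.
  have c2 : continuous (fun v : 'rV[R]_(m.+1 + m.+1) => lambda * mass v).
    move=> v; apply: (@continuousM _ _ (fun=> lambda) (@mass R m.+1)); first exact: cst_continuous.
    exact: continuous_mass.
  by move=> v; have := continuousD (c1 v) (c2 v); exact.
have cQ : continuous Q.
  apply: continuous_sum => k v.
  apply: (@continuousM _ _ (fun=> if k%:Z <= d then 1 else 0)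
    (fun v => (mom (wt v) (ang v) k - moment k nu) ^+ 2)); first exact: cst_continuous.
  exact: (csq (fun k : 'I_m.+1 => moment k nu) k v).
have QP v : Q v = 0 <-> forall k : 'I_m.+1, k%:Z <= d -> mom (wt v) (ang v) k = moment k nu.
  split=> [/eqP|h].
    rewrite psumr_eq0 => [/allP h k kd|k _]; last first.
      by rewrite mulr_ge0 ?sqr_ge0 //; case: ifP.
    have := h k (mem_index_enum _); rewrite kd mul1r sqrf_eq0 subr_eq0.
    by move/eqP.
  rewrite /Q big1 // => k _; case: ifPn => [/h ->|_]; last by rewrite mul0r.
  by rewrite subrr expr0n mulr0.
have clC : closed [set v | Q v = 0].
  apply: (@preimage_closed _ _ Q [set 0]); last exact: closed_eq.
  by move=> v _; exact: cQ.
have objE (mu : {charge set R -> \bar R}) : objective y lambda mu =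
    (2^-1 * (\sum_(k < m.+1) (moment k mu - y k) ^+ 2) + lambda * fine (TV_norm mu))%:E.
  by rewrite /objective TV_norm_fine -EFinM -EFinD.
(* Beyond this mass the penalty alone exceeds the objective at [nu]. *)
pose r := 2^-1 * (\sum_(k < m.+1) (moment k nu - y k) ^+ 2) / lambda + fine (TV_norm nu).
have TV0 : 0 <= fine (TV_norm nu) by rewrite fine_ge0 // TV_norm_ge0.
have sq0 (c : 'I_m.+1 -> R) : 0 <= 2^-1 * (\sum_(k < m.+1) c k ^+ 2) :> R.
  by rewrite mulr_ge0 // sumr_ge0 // => k _; exact: sqr_ge0.
have rTV : fine (TV_norm nu) <= r by rewrite lerDr divr_ge0 // ltW.
have ne : @atom_set R m.+1 r `&` [set v | Q v = 0] !=set0.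
  have [a [x [ha hx hm]]] := charge_atoms m nu.
  exists (atoms a x); split; first split.
  - by rewrite /mass wt_atoms; exact: le_trans ha rTV.
  - by move=> j; rewrite ang_atoms; exact: hx.
  - by apply/QP => k _; rewrite wt_atoms ang_atoms.
have [v [[mv xv] /QP Qv] vmin] := atom_min cJ clC ne.
have [s [a [t [adm at_le at_m]]]] := merge_atoms (wt v) xv.
exists s, a, t; split => //.
have momE k : moment k (discrete_measure a t : {charge set R -> \bar R}) = mom (wt v) (ang v) k.
  by rewrite moment_discrete // at_m.
split.
  split; first exact: discrete_measure_on_I.
  move=> k kd; rewrite momE.
  have km : (k < m.+1)%N by move: (le_lt_trans kd dm); lia.
  exact: (Qv (Ordinal km)).
have sol_le : (objective y lambda (discrete_measure a t : {charge set R -> \bar R}) <= (J v)%:E)%E.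
  rewrite objE lee_fin; apply: lerD.
    by under eq_bigr do rewrite momE.
  by rewrite TV_discrete //= ler_wpM2l // ltW.
move=> mu [muI muf]; apply: le_trans sol_le _.
have [b [x [hb hx hm]]] := charge_atoms m mu.
have Jb : J (atoms b x) <= 2^-1 * (\sum_(k < m.+1) (moment k mu - y k) ^+ 2)
    + lambda * fine (TV_norm mu).
  rewrite /J wt_atoms ang_atoms /mass wt_atoms; apply: lerD; last by rewrite ler_wpM2l // ltW.
  by under eq_bigr do rewrite hm.
rewrite objE lee_fin; have [br|br] := leP (\sum_j `|b j|) r.
  apply: le_trans Jb; apply: vmin; split; first split.
  - by rewrite /mass wt_atoms.
  - by move=> j; rewrite ang_atoms; exact: hx.
  - apply/QP => k kd; rewrite wt_atoms ang_atoms hm; exact: muf.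
have [c [z [hc hz hcm]]] := charge_atoms m nu.
apply: (@le_trans _ _ (J (atoms c z))).
  apply: vmin; split; first split.
  - by rewrite /mass wt_atoms; exact: le_trans hc rTV.
  - by move=> j; rewrite ang_atoms; exact: hz.
  - by apply/QP => k _; rewrite wt_atoms ang_atoms.
apply: (@le_trans _ _ (lambda * r)).
  rewrite /J wt_atoms ang_atoms /mass wt_atoms /r mulrDr mulrCA mulfV ?gt_eqF // mulr1.
  apply: lerD; last by rewrite ler_wpM2l // ltW.
  by under eq_bigr do rewrite hcm.
apply: (@le_trans _ _ (lambda * fine (TV_norm mu))); last by rewrite lerDr.
by rewrite ler_wpM2l ?(ltW lambda0) // (le_trans (ltW br)).
Qed.

End existence.

(** * From certificates to recovery *)

Section recovery_numeric.
Variable R : realFieldType.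

(** [ca] and [ce] stand for the scalar products of the residual with the certificate
and with the noise. The premise gives [rho^2 / 2 + lam g <= 3/2 lam rho], and
[3/2 lam rho - rho^2 / 2] is at most [9/8 lam^2]. *)
Lemma num_optimality (lam g rho ca ce : R) : 0 < lam -> 0 <= rho -> 0 <= g ->
  `|ca| <= rho -> `|ce| <= rho * (lam / 2) ->
  2^-1 * rho ^+ 2 - ce + lam * (g + ca) <= 0 -> g <= 9 / 8 * lam /\ rho <= 3 * lam.
Proof.
move=> l0 r0 g0; rewrite !ler_norml => /andP[ca1 ca2] /andP[ce1 ce2] h.
have h1 := ler_wpM2l (ltW l0) ca1.
have h2 : 2^-1 * rho ^+ 2 + lam * g <= 3 / 2 * lam * rho by lra.
have lg := mulr_ge0 (ltW l0) g0.
split.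
  rewrite -(ler_pM2l l0); have := sqr_ge0 (rho - 3 / 2 * lam); lra.
have [->|rn0] := eqVneq rho 0; first by rewrite mulr_ge0 // ltW.
have rp : 0 < rho by rewrite lt_neqAle eq_sym rn0.
by rewrite -(ler_pM2l rp); lra.
Qed.

(** For [n = m./2.+1]: the passage from the scale [1 / n] of the kernels
to the scale [1 / m]. *)
Lemma num_half_m (m n : R) : 128 <= m -> m <= 2 * n -> 2 * n <= m + 2 ->
  4^-1 * m ^+ 2 <= n ^+ 2 /\ n ^+ 2 <= 3 / 10 * m ^+ 2 /\ n <= 52 / 100 * m.
Proof. by move=> *; split; [|split]; nra. Qed.

Lemma num_gap_near (u2 n2 m2 : R) : 0 <= u2 -> 4^-1 * m2 <= n2 ->
  975 / 10 ^+ 5 * (m2 * u2) <= 39 / 10 ^+ 3 * (n2 * u2).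
Proof. by move=> u0 h; have := ler_wpM2r u0 h; lra. Qed.

Lemma num_gap_far (c : R) : 0 <= c <= 11 / 10 -> 975 / 10 ^+ 5 * c ^+ 2 <= 1 - 983 / 10 ^+ 3.
Proof. by move=> /andP[h0 h1]; have := ler_pM h0 h0 h1 h1; rewrite -!expr2; lra. Qed.

Lemma num_err_near (u2 n2 m2 : R) : 0 <= u2 -> 0 <= m2 -> n2 <= 3 / 10 * m2 ->
  26 / 100 * (n2 * u2) <= m2 * u2.
Proof. by move=> u0 m0 h; have := ler_wpM2r u0 h; have := mulr_ge0 m0 u0; lra. Qed.

Lemma num_dev (v d d' x : R) : v = 1 \/ v = -1 -> 1 - x <= v * d <= 1 -> 1 - x <= v * d' <= 1 ->
  `|(d - d') / 2| <= x.
Proof.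
by move=> [->|->]; rewrite ?mul1r ?mulN1r ler_norml => /andP[h1 h2] /andP[h3 h4];
  apply/andP; split; lra.
Qed.

Lemma num_dev' (v d d' x : R) : v = 1 \/ v = -1 -> 1 - x <= v * d <= 1 -> 1 - x <= - v * d' <= 1 ->
  `|(d - d') / 2 - v| <= x.
Proof.
by move=> [->|->]; rewrite ?opprK ?mul1r ?mulN1r ler_norml => /andP[h1 h2] /andP[h3 h4];
  apply/andP; split; lra.
Qed.

Lemma num_negative (X Y : R) : 1 - X <= Y -> Y <= 1 - 975 / 10 ^+ 5 * X -> X <= (11 / 10) ^+ 2 ->
  Y < 0 -> 975 / 10 ^+ 5 * X <= 1 - - Y.
Proof. lra. Qed.

Lemma num_total (lam S g : R) : 0 < lam -> 975 / 10 ^+ 5 * S <= g -> g <= 9 / 8 * lam -> S <= 116 * lam.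
Proof. lra. Qed.

End recovery_numeric.

Section certificate_in_phi_basis.
Variables (R : realType) (m s : nat) (th : 'I_s -> R).
Hypothesis m128 : (128 <= m)%N.
Let delta : R := 5 * pi / m%:R.
Hypothesis th_itv : forall i, 0 <= th i <= pi.
Hypothesis th_sep : forall i j, i != j -> delta <= `|th i - th j|.
Hypothesis th_edge : forall i, th i != 0 -> th i != pi -> delta <= 2 * th i <= 2 * pi - delta.

(** A certificate expressed in the functions [phi k] of the angle; its coefficients
are what is paired with moments. *)
Definition dual (al : nat -> R) x := \sum_(k < m.+1) al k * psi k x.

Let mR : 128 <= m%:R :> R. Proof. by rewrite (ler_nat R 128). Qed.
Let m0 : 0 < m%:R :> R. Proof. by apply: lt_le_trans mR. Qed.

(** [even_certificate] rescaled: the factor [sqrt 2] in [phi] makes the weighted sum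
of squares of Parseval's formula the Euclidean norm of the coefficients. *)
Lemma dual_certificate (v : 'I_s -> R) : (forall i, v i = 1 \/ v i = -1) ->
  exists al : nat -> R, [/\ \sum_(k < m.+1) al k ^+ 2 <= 1, forall x, `|dual al x| <= 1,
    forall i x, m%:R * `|x - th i| <= 11 / 10 ->
      1 - (m%:R * (x - th i)) ^+ 2 <= v i * dual al x <= 1 - 975 / 10 ^+ 5 * (m%:R * (x - th i)) ^+ 2 &
    forall x c, 0 <= x <= pi -> 0 <= c <= 11 / 10 -> (forall i, c <= m%:R * `|x - th i|) ->
      975 / 10 ^+ 5 * c ^+ 2 <= 1 - `|dual al x|].
Proof.
move=> hv; have [p [p1 pnear pfar]] := even_certificate m128 th_itv th_sep th_edge hv.
pose al k := p k / (if k == 0%N then 1 else Num.sqrt 2).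
have s2 : Num.sqrt 2 != 0 :> R by rewrite gt_eqF // sqrtr_gt0.
have alE x : dual al x = cos_sum m p x.
  apply: eq_bigr => k _; rewrite /al /psi mulrA; congr (_ * _).
  by case: ifP => _; rewrite mulfVK // oner_eq0.
set n : R := m./2.+1%:R in pnear pfar.
have [nm [mn nm']] : 4^-1 * m%:R ^+ 2 <= n ^+ 2 /\ n ^+ 2 <= 3 / 10 * m%:R ^+ 2 /\ n <= 52 / 100 * m%:R.
  apply: num_half_m => //; rewrite /n -natrM ?(ler_nat R) -?(natrD R m 2) ?(ler_nat R);
    by have := odd_double_half m; lia.
have n0 : 0 < n by rewrite ltr0n.
have scale x i : (m%:R * (x - th i)) ^+ 2 = m%:R ^+ 2 * (x - th i) ^+ 2 by rewrite exprMn.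
have near i x : `|n * (x - th i)| <= 1 ->
    1 - (m%:R * (x - th i)) ^+ 2 <= v i * dual al x <= 1 - 975 / 10 ^+ 5 * (m%:R * (x - th i)) ^+ 2.
  move=> nx; have /andP[h1 h2] := pnear i x nx; rewrite alE.
  have := num_gap_near (sqr_ge0 (x - th i)) nm.
  have := num_err_near (sqr_ge0 (x - th i)) (sqr_ge0 m%:R) mn.
  rewrite -!exprMn => h3 h4; apply/andP; split.
    by apply: le_trans h1; rewrite lerD2l lerN2.
  by apply: le_trans h2 _; rewrite lerD2l lerN2.
exists al; split.
- have := parseval_cos p1; congr (_ <= 1); apply: eq_bigr => k _.
  rewrite /al /cos_weight expr_div_n; case: ifP => _; first by rewrite expr1n; field.
  by rewrite sqr_sqrtr // mulrC.
- by move=> x; rewrite alE.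
- move=> i x mx; apply: near; rewrite normrM (ger0_norm (ltW n0)).
  apply: le_trans (ler_wpM2r (normr_ge0 _) nm') _; rewrite -(mulrA (52 / 100)).
  by move: mx; move: (m%:R * _) => z; lra.
- move=> x c xpi cI cx; have c0 : 0 <= c by case/andP: cI.
  have [[i ni]|no] := pselect (exists i, `|n * (x - th i)| <= 1).
    have /andP[h1 h2] := pnear i x ni; rewrite alE.
    have n2 : (n * (x - th i)) ^+ 2 <= 1 by rewrite -real_normK ?num_real // expr_le1.
    have pos : `|cos_sum m p x| = v i * cos_sum m p x.
      rewrite -[RHS]ger0_norm; last by apply: le_trans h1; lra.
      by rewrite normrM; case: (hv i) => ->; rewrite ?normrN normr1 mul1r.
    have := num_gap_near (sqr_ge0 (x - th i)) nm; rewrite -!exprMn => h4.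
    have h5 : c ^+ 2 <= (m%:R * (x - th i)) ^+ 2.
      by rewrite -[X in _ <= X]real_normK ?num_real // ler_sqr ?nnegrE // normrM (ger0_norm (ltW m0)).
    rewrite pos lerBrDr addrC -lerBrDr; apply: le_trans h2 _; rewrite lerD2l lerN2.
    exact: le_trans (ler_wpM2l (decimal_ge0 R 975 5) h5) h4.
  rewrite alE; apply: le_trans (num_gap_far cI) _; rewrite lerD2l lerN2; apply: pfar => // i.
  by rewrite leNgt; apply/negP => /ltW h; apply: no; exists i.
Qed.

End certificate_in_phi_basis.

Section recovery.
Variables (R : realType) (m s s' : nat) (a th : 'I_s -> R) (a' th' : 'I_s' -> R).
Hypothesis m128 : (128 <= m)%N.
Let delta : R := 5 * pi / m%:R.
Hypothesis a_neq0 : forall i, a i != 0.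
Hypothesis th_itv : forall i, 0 <= th i <= pi.
Hypothesis th_sep : forall i j, i != j -> delta <= `|th i - th j|.
Hypothesis th_edge : forall i, th i != 0 -> th i != pi -> delta <= 2 * th i <= 2 * pi - delta.
Hypothesis th'_itv : forall i, 0 <= th' i <= pi.
Variables (lambda c : R) (e : 'I_m.+1 -> R) (M : 'I_s' -> R).
Hypothesis lambda0 : 0 < lambda.
Hypothesis c_itv : 1 <= c <= 11 / 10.
Hypothesis e_le : \sum_(k < m.+1) e k ^+ 2 <= (lambda / 2) ^+ 2.
Hypothesis M_cases : forall j,
  (exists l, m%:R * `|th' j - th l| <= c /\ M j = (m%:R * (th' j - th l)) ^+ 2) \/
  (M j = c ^+ 2 /\ forall l, c < m%:R * `|th' j - th l|).
Let r (k : 'I_m.+1) : R := mom a' th' k - mom a th k.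
Hypothesis optimal :
  2^-1 * (\sum_(k < m.+1) (r k - e k) ^+ 2) + lambda * \sum_j `|a' j| <=
  2^-1 * (\sum_(k < m.+1) e k ^+ 2) + lambda * \sum_i `|a i|.

Let m0 : 0 < m%:R :> R. Proof. by rewrite ltr0n (leq_trans _ m128). Qed.
Let rho := Num.sqrt (\sum_(k < m.+1) r k ^+ 2).

Let rho2 : rho ^+ 2 = \sum_(k < m.+1) r k ^+ 2.
Proof. by rewrite sqr_sqrtr // sumr_ge0 // => k _; exact: sqr_ge0. Qed.

Let sgv i : Num.sg (a i) = 1 \/ Num.sg (a i) = -1.
Proof. by have [h|h|h] := ltgtP (a i) 0; [right; rewrite ltr0_sg | left; rewrite gtr0_sg |
  have := a_neq0 i; rewrite h eqxx]. Qed.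

Lemma cauchy_schwarz (u w : 'I_m.+1 -> R) (A B : R) : 0 <= A -> 0 <= B ->
  \sum_k u k ^+ 2 <= A ^+ 2 -> \sum_k w k ^+ 2 <= B ^+ 2 -> `|\sum_k u k * w k| <= A * B.
Proof.
move=> A0 B0 hu hw.
have [A00|An0] := eqVneq A 0.
  rewrite big1 ?normr0 ?mulr_ge0 // => k _.
  have /eqP : \sum_k u k ^+ 2 = 0.
    by apply/eqP; rewrite eq_le (le_trans hu) ?A00 ?expr0n //= sumr_ge0 // => j _; exact: sqr_ge0.
  rewrite psumr_eq0 => [/allP/(_ k (mem_index_enum _))|j _]; last exact: sqr_ge0.
  by rewrite sqrf_eq0 => /eqP ->; rewrite mul0r.
have [B00|Bn0] := eqVneq B 0.
  rewrite big1 ?normr0 ?mulr_ge0 // => k _.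
  have /eqP : \sum_k w k ^+ 2 = 0.
    by apply/eqP; rewrite eq_le (le_trans hw) ?B00 ?expr0n //= sumr_ge0 // => j _; exact: sqr_ge0.
  rewrite psumr_eq0 => [/allP/(_ k (mem_index_enum _))|j _]; last exact: sqr_ge0.
  by rewrite sqrf_eq0 => /eqP ->; rewrite mulr0.
have Ap : 0 < A by rewrite lt_neqAle eq_sym An0.
have Bp : 0 < B by rewrite lt_neqAle eq_sym Bn0.
apply: le_trans (ler_norm_sum _ _ _) _.
apply: (@le_trans _ _ (\sum_k (B / (2 * A) * u k ^+ 2 + A / (2 * B) * w k ^+ 2))).
  apply: ler_sum => k _; rewrite normrM.
  have -> : B / (2 * A) * u k ^+ 2 + A / (2 * B) * w k ^+ 2 =
     `|u k| * `|w k| + (B * `|u k| - A * `|w k|) ^+ 2 / (2 * A * B).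
    rewrite -(real_normK (num_real (u k))) -(real_normK (num_real (w k))).
    by field; rewrite An0 Bn0.
  by rewrite lerDl divr_ge0 ?sqr_ge0 // !mulr_ge0.
rewrite big_split -!mulr_sumr /=.
apply: (@le_trans _ _ (B / (2 * A) * A ^+ 2 + A / (2 * B) * B ^+ 2)).
  by apply: lerD; rewrite ler_wpM2l // divr_ge0 ?mulr_ge0.
by rewrite le_eqVlt; apply/orP; left; apply/eqP; field; rewrite An0 Bn0.
Qed.

Lemma dual_pairing (al : nat -> R) : \sum_(k < m.+1) al k * r k =
  \sum_j a' j * dual m al (th' j) - \sum_i a i * dual m al (th i).
Proof.
have E N (b x : 'I_N -> R) : \sum_(k < m.+1) al k * mom b x k = \sum_j b j * dual m al (x j).
  rewrite /mom /dual; under eq_bigr do rewrite mulr_sumr.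
  rewrite exchange_big /=; apply: eq_bigr => j _; rewrite mulr_sumr.
  by apply: eq_bigr => k _; rewrite mulrCA.
by rewrite -!E -sumrB; apply: eq_bigr => k _; rewrite mulrBr.
Qed.

Lemma dual_pairing_le (al : nat -> R) : \sum_(k < m.+1) al k ^+ 2 <= 1 ->
  `|\sum_(k < m.+1) al k * r k| <= rho.
Proof.
move=> h; rewrite -[rho]mul1r; apply: (cauchy_schwarz (u := fun k => al k)) => //.
- exact: sqrtr_ge0.
- by rewrite expr1n.
- by rewrite rho2.
Qed.

Lemma at_spike al v i : v = 1 \/ v = -1 ->
  (forall x, m%:R * `|x - th i| <= 11 / 10 ->
      1 - (m%:R * (x - th i)) ^+ 2 <= v * dual m al x <= 1 - 975 / 10 ^+ 5 * (m%:R * (x - th i)) ^+ 2) ->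
  dual m al (th i) = v.
Proof.
move=> hv /(_ (th i)); rewrite subrr normr0 mulr0 (expr0n _ 2) /= mulr0 subr0.
move=> /(_ ltac:(lra)) h; have vd : v * dual m al (th i) = 1 by apply/eqP; rewrite eq_le andbC.
by case: hv vd => ->; rewrite ?mul1r // mulN1r => <-; rewrite opprK.
Qed.

(** Optimality against the true spikes, paired with the certificate whose signs are
those of the weights. *)
Lemma gap_and_residual : \sum_j `|a' j| * M j <= 116 * lambda /\ rho <= 3 * lambda.
Proof.
have [al [al1 alb alnear alfar]] := dual_certificate m128 th_itv th_sep th_edge sgv.
have at_th i : dual m al (th i) = Num.sg (a i) by apply: at_spike (sgv i) (alnear i).
pose g := \sum_j (`|a' j| - a' j * dual m al (th' j)).
have gM : 975 / 10 ^+ 5 * (\sum_j `|a' j| * M j) <= g.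
  rewrite mulr_sumr; apply: ler_sum => j _.
  have h : 975 / 10 ^+ 5 * M j <= 1 - `|dual m al (th' j)|.
    have cI : 0 <= c <= 11 / 10 by case/andP: c_itv => c1 ->; rewrite (le_trans ler01 c1).
    have c11 : c <= 11 / 10 by case/andP: cI.
    case: (M_cases j) => [[l [lc ->]]|[-> far]]; last first.
      by apply: alfar => // l; exact: ltW.
    have /andP[h1 h2] := alnear l _ (le_trans lc c11).
    have pos : `|dual m al (th' j)| = `|Num.sg (a l) * dual m al (th' j)|.
      by rewrite normrM; case: (sgv l) => ->; rewrite ?normrN normr1 mul1r.
    have [p0|p0] := leP 0 (Num.sg (a l) * dual m al (th' j)).
      by rewrite pos ger0_norm // lerBrDr addrC -lerBrDr.
    have h3 : (m%:R * (th' j - th l)) ^+ 2 <= (11 / 10) ^+ 2.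
      rewrite -real_normK ?num_real // ler_sqr ?nnegrE //.
      by rewrite normrM (ger0_norm (ltW m0)) (le_trans lc).
    rewrite pos ltr0_norm //; move: h1 h2 h3 p0.
    move: ((m%:R * (th' j - th l)) ^+ 2) (Num.sg (a l) * dual m al (th' j)) => X Y.
    exact: num_negative.
  have a'd : a' j * dual m al (th' j) <= `|a' j| * `|dual m al (th' j)|.
    by rewrite -normrM ler_norm.
  rewrite mulrCA; apply: le_trans (ler_wpM2l (normr_ge0 (a' j)) h) _.
  by rewrite mulrBr mulr1 lerD2l lerN2.
have g0 : 0 <= g.
  apply: sumr_ge0 => j _; rewrite subr_ge0 (le_trans (ler_norm _)) // normrM.
  by rewrite ler_piMr.
have gE : \sum_j `|a' j| - \sum_i `|a i| = g + \sum_(k < m.+1) al k * r k.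
  rewrite dual_pairing /g sumrB addrA subrK; congr (_ - _).
  by apply: eq_bigr => i _; rewrite at_th mulrC -normrEsg.
have hopt : 2^-1 * rho ^+ 2 - \sum_(k < m.+1) r k * e k + lambda * (g + \sum_(k < m.+1) al k * r k) <= 0.
  rewrite -gE rho2 mulrBr; move: optimal.
  have -> : \sum_(k < m.+1) (r k - e k) ^+ 2 =
     \sum_(k < m.+1) r k ^+ 2 - 2 * (\sum_(k < m.+1) r k * e k) + \sum_(k < m.+1) e k ^+ 2.
    by rewrite mulr_sumr -sumrB -big_split /=; apply: eq_bigr => k _; ring.
  by move: (lambda * _) (lambda * _) (\sum_k _) (\sum_k _) (\sum_k _) => A B C D E; lra.
have re : `|\sum_(k < m.+1) r k * e k| <= rho * (lambda / 2).
  apply: cauchy_schwarz => //; rewrite ?sqrtr_ge0 ?rho2 //.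
  by rewrite divr_ge0 // ltW.
have [gl rl] := num_optimality lambda0 (sqrtr_ge0 _) g0 (dual_pairing_le al1) re hopt.
by split => //; exact: num_total lambda0 gM gl.
Qed.

(** Half the difference [q] of the certificates for two sign patterns that differ at
[i] only is [v] at [th i] and 0 at the other spikes, and deviates from
[v] times the indicator of the neighbourhood of [th i] by at most [M j] at the
atom [j]. Its integrals against the two measures differ by a pairing with the
residual. *)
Lemma local_control i : `|a i - \sum_(j | m%:R * `|th i - th' j| <= c) a' j| <= 119 * lambda.
Proof.
pose near (j : 'I_s') : bool := m%:R * `|th i - th' j| <= c.
have -> : \sum_(j | m%:R * `|th i - th' j| <= c) a' j = \sum_(j | near j) a' j by [].
have [gapM rl] := gap_and_residual.
have c1 : 1 <= c by case/andP: c_itv.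
have c11 : c <= 11 / 10 by case/andP: c_itv.
pose v := Num.sg (a i); have hv : v = 1 \/ v = -1 by exact: sgv.
pose v' l := if l == i then - v else Num.sg (a l).
have hv' l : v' l = 1 \/ v' l = -1.
  rewrite /v'; case: ifP => _; last exact: sgv.
  by case: hv => ->; [right | left; rewrite opprK].
have [al [al1 alb alnear _]] := dual_certificate m128 th_itv th_sep th_edge sgv.
have [be [be1 beb benear _]] := dual_certificate m128 th_itv th_sep th_edge hv'.
pose q x := (dual m al x - dual m be x) / 2.
have q1 x : `|q x| <= 1.
  rewrite /q; have := alb x; have := beb x; rewrite !ler_norml => /andP[h1 h2] /andP[h3 h4].
  by apply/andP; split; lra.
have dnear al' w l x : w = 1 \/ w = -1 ->
    (forall x, m%:R * `|x - th l| <= 11 / 10 ->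
      1 - (m%:R * (x - th l)) ^+ 2 <= w * dual m al' x <= 1 - 975 / 10 ^+ 5 * (m%:R * (x - th l)) ^+ 2) ->
    m%:R * `|x - th l| <= c -> 1 - (m%:R * (x - th l)) ^+ 2 <= w * dual m al' x <= 1.
  move=> hw h xc; have /andP[-> h2] := h x (le_trans xc c11); apply: le_trans h2 _.
  by rewrite gerBl; exact: mulr_ge0 (decimal_ge0 R 975 5) (sqr_ge0 _).
have qth l : q (th l) = (l == i)%:R * v.
  rewrite /q (at_spike (sgv l) (alnear l)) (at_spike (hv' l) (benear l)) /v'.
  case: eqVneq => [->|_]; last by rewrite subrr !mul0r.
  by rewrite -/v mul1r; field.
have err j : `|q (th' j) - (near j)%:R * v| <= M j.
  case: (M_cases j) => [[l [lc ->]]|[-> far]]; last first.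
    have -> : near j = false by rewrite /near distrC leNgt far.
    rewrite mul0r subr0 (le_trans (q1 _)) //.
    by rewrite expr_ge1 // (le_trans ler01).
  have hal := dnear al (Num.sg (a l)) l _ (sgv l) (alnear l) lc.
  have hbe := dnear be (v' l) l _ (hv' l) (benear l) lc.
  have [li|li] := eqVneq l i.
    rewrite li in lc hal hbe *; have -> : near j by rewrite /near distrC.
    rewrite mul1r; apply: num_dev' hv hal _.
    by move: hbe; rewrite /v' eqxx.
  have -> : near j = false.
    apply/negP => ic; have := th_sep li; rewrite /delta ler_pdivrMr // => h.
    have p31 := pi_ge31 R.
    have : `|th l - th i| * m%:R <= c + c.
      apply: le_trans (lerD ic lc); rewrite -mulrDr mulrC ler_wpM2l ?(ltW m0) //.
      rewrite (_ : th l - th i = - (th i - th' j + (th' j - th l))); last by ring.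
      by rewrite normrN; exact: ler_normD.
    lra.
  rewrite mul0r subr0; apply: num_dev (sgv l) hal _.
  by move: hbe; rewrite /v' (negbTE li).
have E : v * (a i - \sum_(j | near j) a' j) =
    \sum_j a' j * (q (th' j) - (near j)%:R * v)
    - (\sum_(k < m.+1) al k * r k - \sum_(k < m.+1) be k * r k) / 2.
  have -> : (\sum_(k < m.+1) al k * r k - \sum_(k < m.+1) be k * r k) / 2 =
      \sum_j a' j * q (th' j) - \sum_l a l * q (th l).
    have h N (b x : 'I_N -> R) : \sum_j b j * q (x j) =
       (\sum_j b j * dual m al (x j) - \sum_j b j * dual m be (x j)) / 2.
      by rewrite -sumrB mulr_suml; apply: eq_bigr => j _; rewrite /q; ring.
    by rewrite !dual_pairing !h; field.
  have -> : \sum_l a l * q (th l) = a i * v.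
    rewrite (bigD1 i) //= qth eqxx mul1r big1 ?addr0 // => l li.
    by rewrite qth (negbTE li) mul0r mulr0.
  have -> : \sum_j a' j * (q (th' j) - (near j)%:R * v) =
     \sum_j a' j * q (th' j) - v * \sum_(j | near j) a' j.
    rewrite [X in v * X]big_mkcond mulr_sumr -sumrB; apply: eq_bigr => j _.
    by case: ifP => _ /=; ring.
  by ring.
have -> : `|a i - \sum_(j | near j) a' j| =
    `|v * (a i - \sum_(j | near j) a' j)|.
  by rewrite [RHS]normrM; case: hv => ->; rewrite ?normrN normr1 mul1r.
rewrite E; apply: le_trans (ler_normB _ _) _.
have h1 : `|\sum_j a' j * (q (th' j) - (near j)%:R * v)| <= 116 * lambda.
  apply: le_trans gapM; apply: le_trans (ler_norm_sum _ _ _) _; apply: ler_sum => j _.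
  by rewrite normrM ler_wpM2l.
have h2 : `|(\sum_(k < m.+1) al k * r k - \sum_(k < m.+1) be k * r k) / 2| <= rho.
  have := dual_pairing_le al1; have := dual_pairing_le be1; rewrite !ler_norml.
  by move: (\sum_(k < _) _) (\sum_(k < _) _) => X Y /andP[? ?] /andP[? ?]; apply/andP; split; lra.
by apply: le_trans (lerD h1 (le_trans h2 rl)) _; rewrite -mulrDl -natrD.
Qed.

(** Otherwise the atoms near [th i], whose mass is at least [|a i| - C2 * lambda] by
[local_control], would all be far enough from [th i] to contradict
[gap_and_residual]. *)
Lemma large_spike i (C1 C2 : R) : 116 < C1 -> 119 <= C2 -> C2 * lambda < `|a i| ->
  exists j, m%:R * `|th i - th' j| <= Num.sqrt (C1 * lambda / (`|a i| - C2 * lambda)).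
Proof.
move=> hC1 hC2 ai; set A := `|a i| - C2 * lambda.
have A0 : 0 < A by rewrite subr_gt0.
have [gapM _] := gap_and_residual; have loc := local_control i.
have c11 : c <= 11 / 10 by case/andP: c_itv.
apply: contrapT => no.
have far j : C1 * lambda / A < (m%:R * (th i - th' j)) ^+ 2.
  have : Num.sqrt (C1 * lambda / A) < m%:R * `|th i - th' j|.
    by rewrite ltNge; apply/negP => h; apply: no; exists j.
  rewrite -[X in _ < X ^+ 2]/(m%:R * (th i - th' j)) -real_normK ?num_real // normrM (ger0_norm (ltW m0)).
  move=> h; have q0 : 0 <= C1 * lambda / A.
    by rewrite divr_ge0 ?(ltW A0) // mulr_ge0 ?(ltW lambda0) // (le_trans _ (ltW hC1)).
  rewrite -[X in X < _](sqr_sqrtr q0) ltr_sqr ?nnegrE ?sqrtr_ge0 //.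
have MN j : m%:R * `|th i - th' j| <= c -> M j = (m%:R * (th i - th' j)) ^+ 2.
  move=> ic; case: (M_cases j) => [[l [lc ->]]|[_ /(_ i)]]; last first.
    by rewrite distrC ltNge ic.
  have [->|li] := eqVneq l i; first by rewrite -opprB mulrN sqrrN.
  have := th_sep li; rewrite /delta ler_pdivrMr // => h.
  have p31 := pi_ge31 R.
  have : `|th l - th i| * m%:R <= c + c.
    apply: le_trans (lerD ic lc); rewrite -mulrDr mulrC ler_wpM2l ?(ltW m0) //.
    rewrite (_ : th l - th i = - (th i - th' j + (th' j - th l))); last by ring.
    by rewrite normrN; exact: ler_normD.
  lra.
have M0 j : 0 <= M j by case: (M_cases j) => [[l [_ ->]]|[-> _]]; exact: sqr_ge0.
have sumA : A <= \sum_(j | m%:R * `|th i - th' j| <= c) `|a' j|.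
  apply: le_trans (ler_norm_sum _ _ _); rewrite /A lerBlDr -lerBlDl.
  apply: le_trans (le_trans loc _); last by rewrite ler_wpM2r // ltW.
  by apply: le_trans (lerB_dist _ _).
have : C1 * lambda <= \sum_j `|a' j| * M j.
  apply: (@le_trans _ _ (C1 * lambda / A * \sum_(j | m%:R * `|th i - th' j| <= c) `|a' j|)).
    rewrite -{1}(mulfVK (lt0r_neq0 A0) (C1 * lambda)) ler_wpM2l //.
    by rewrite divr_ge0 ?(ltW A0) // mulr_ge0 ?(ltW lambda0) // (le_trans _ (ltW hC1)).
  rewrite mulr_sumr [X in _ <= X](bigID (fun j => m%:R * `|th i - th' j| <= c)) /=.
  rewrite -[X in X <= _]addr0; apply: lerD; last by apply: sumr_ge0 => j _; rewrite mulr_ge0.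
  by apply: ler_sum => j jc; rewrite mulrC ler_wpM2l // MN // ltW.
move=> h; have := le_trans h gapM; rewrite leNgt => /negP; apply.
by rewrite ltr_pM2r.
Qed.

End recovery.

(** * Gaussian noise *)

Section gaussian_noise.
Variable R : realType.

(** Exponential tilting: on [A] the centred density is at most
[exp (- v^2 / (2 sigma^2))] times the density centred at [v]. *)
Lemma normal_tail (sigma v : R) (A : set R) : sigma != 0 -> measurable A ->
  (forall x, A x -> v ^+ 2 <= v * x) ->
  (normal_prob 0 sigma A <= (expR (- v ^+ 2 / (sigma ^+ 2 *+ 2)))%:E)%E.
Proof.
move=> s0 mA vA; pose C := expR (- v ^+ 2 / (sigma ^+ 2 *+ 2)).
have mpdf u B : measurable B -> measurable_fun B (fun x => (normal_pdf u sigma x)%:E).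
  move=> mB; apply/measurable_EFinP.
  exact: measurable_funS measurableT (@subsetT _ B) (measurable_normal_pdf u sigma).
have pdf0 u x : (0 <= (normal_pdf u sigma x)%:E)%E by rewrite lee_fin normal_pdf_ge0.
apply: (@le_trans _ _ (\int[lebesgue_measure]_(x in A) (C%:E * (normal_pdf v sigma x)%:E))%E).
  apply: ge0_le_integral => //.
  - exact: mpdf.
  - by apply: measurable_funeM; exact: mpdf.
  move=> x Ax; rewrite -EFinM lee_fin !normal_pdfE //= mulrCA ler_wpM2l ?normal_peak_ge0 //.
  rewrite /normal_fun /C -expRD ler_expR -mulrDl ler_wpM2r //.
    by rewrite invr_ge0 mulrn_wge0 // sqr_ge0.
  have := vA x Ax; rewrite subr0 sqrrB; lra.
rewrite ge0_integralZl_EFin ?expR_ge0 //; last exact: mpdf.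
rewrite -[leRHS]mule1 lee_pmul2l ?lte_fin ?expR_gt0 //.
rewrite -(integral_normal_pdf v sigma); apply: ge0_subset_integral => //.
exact: mpdf.
Qed.

Lemma normal_outside (sigma u : R) : sigma != 0 -> 0 <= u ->
  (normal_prob 0 sigma [set x | (u < `|x|)%R] <= (2 * expR (- u ^+ 2 / (sigma ^+ 2 *+ 2)))%:E)%E.
Proof.
move=> s0 u0.
have -> : [set x | u < `|x|] = `]u, +oo[%classic `|` `]-oo, (-u)[%classic :> set R.
  apply/seteqP; split => x /=; rewrite !in_itv /= ?andbT ltr_normr.
    by move=> /orP[h|h]; [left | right; rewrite ltrNr].
  by move=> [->//|h]; rewrite orbC ltrNr h.
apply: le_trans (measureU2 _ _ _) _ => //.
rewrite mulr_natl mulr2n EFinD; apply: leeD.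
  apply: normal_tail => // x /=; rewrite in_itv /= andbT => /ltW ux.
  by rewrite expr2 ler_wpM2l.
rewrite -(sqrrN u); apply: normal_tail => // x /=; rewrite in_itv /= => /ltW ux.
by rewrite expr2 ler_wnM2l // oppr_le0.
Qed.

Lemma count_noisy (m : nat) (d : int) : -1 <= d < m%:Z ->
  #|[pred k : 'I_m.+1 | d < k%:Z]|%:Z = m%:Z - d.
Proof.
move=> hd; pose p := absz (d + 1).
have E n : (\sum_(k < n) (p <= k : nat) = n - p)%N.
  elim: n => [|n IHn]; first by rewrite big_ord0.
  by rewrite big_ord_recr /= IHn; lia.
have -> : #|[pred k : 'I_m.+1 | d < k%:Z]| = (\sum_(k < m.+1) (p <= k : nat))%N.
  rewrite -sum1_card big_mkcond; apply: eq_bigr => k _.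
  by rewrite inE (_ : (d < k%:Z) = (p <= k)%N); [case: leqP | lia].
by rewrite E; lia.
Qed.

Lemma union_bound (disp : measure_display) (Omega : measurableType disp)
    (P : probability Omega R) (I : finType) (D : pred I) (A : I -> set Omega) (b : R) :
  (forall i, measurable (A i)) -> (forall i, D i -> (P (A i) <= b%:E)%E) ->
  (P (\big[setU/set0]_(i | D i) A i) <= (#|D|%:R * b)%:E)%E.
Proof.
move=> mA hA; rewrite -sum1_card natr_sum mulr_suml -sumEFin.
apply: (@le_trans _ _ (\sum_(i | D i) P (A i))%E); last first.
  by apply: lee_sum => i Di; rewrite mul1r; exact: hA.
have mU (s : seq I) : measurable (\big[setU/set0]_(i <- s | D i) A i).
  by apply: bigsetU_measurable.
elim: (index_enum I) => [|i s IHs]; first by rewrite !big_nil measure0.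
rewrite !big_cons; case: ifP => // _; apply: le_trans (measureU2 _ _ _) _ => //.
exact: leeD.
Qed.

(** Each of the [m - d] noisy coordinates exceeds
[u = sigma sqrt (2 (1 + eta) L)], with [L = ln (5 (m + d + 1))], with probability
at most [2 exp (- (1 + eta) L)]. The union bound is [2 (m - d) exp (- L)], which is
less than 1, times [exp (- eta L)]. *)
Lemma noise_event (disp : measure_display) (Omega : measurableType disp)
    (P : probability Omega R) (m : nat) (d : int) (sigma eta : R)
    (eps : 'I_m.+1 -> {RV P >-> R}) :
  (128 <= m)%N -> -1 <= d < m%:Z -> 0 < sigma -> 0 < eta ->
  (forall (k : 'I_m.+1) (w : Omega), k%:Z <= d -> eps k w = 0) ->
  (forall (k : 'I_m.+1), d < k%:Z -> forall A : set R, measurable A ->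
     distribution P (eps k) A = normal_prob 0 sigma A) ->
  exists E : set Omega, [/\ measurable E,
    ((1 - (1 / (5 * (m%:Z + d)%:~R)) `^ eta)%:E < P E)%E &
    forall w, E w -> \sum_(k < m.+1) eps k w ^+ 2 <=
      (sigma * Num.sqrt (2 * (1 + eta) * (m%:Z - d)%:~R * ln (5 * (m%:Z + d + 1)%:~R))) ^+ 2].
Proof.
move=> hm hd s0 eta0 eps0 epsN.
set L := ln _; pose D := [pred k : 'I_m.+1 | d < k%:Z].
have nE : (m%:Z - d)%:~R = #|D|%:R :> R by rewrite -(count_noisy hd).
have md : (127 : R) <= (m%:Z + d)%:~R.
  by rewrite (_ : 127 = 127%:Z%:~R) // ler_int; lia.
have dm : (#|D|%:R : R) <= (m%:Z + d)%:~R + 2.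
  by rewrite -nE (_ : 2 = 2%:Z%:~R) // -intrD ler_int; lia.
have L0 : 0 <= L by rewrite ln_ge0 // intrD; lra.
pose u := sigma * Num.sqrt (2 * (1 + eta) * L).
have u0 : 0 <= u by rewrite mulr_ge0 ?sqrtr_ge0 // ltW.
have u2 : u ^+ 2 = sigma ^+ 2 * (2 * (1 + eta) * L).
  by rewrite exprMn sqr_sqrtr // !mulr_ge0 // addr_ge0 // ltW.
pose A (k : 'I_m.+1) := eps k @^-1` [set x | u < `|x|].
have mu : measurable [set x : R | u < `|x|].
  rewrite (_ : [set x | _] = Num.norm @^-1` `]u, +oo[%classic).
    by rewrite -[X in measurable X]setTI; exact: normr_measurable.
  by apply/seteqP; split => x /=; rewrite in_itv /= andbT.
have mA k : measurable (A k) by exact: measurable_sfunP.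
have mB : measurable (\big[setU/set0]_(k | D k) A k) by exact: bigsetU_measurable.
exists (~` \big[setU/set0]_(k | D k) A k); split.
- exact: measurableC.
- rewrite probability_setC //.
  have : (P (\big[setU/set0]_(k | D k) A k) <=
      (#|D|%:R * (2 * expR (- u ^+ 2 / (sigma ^+ 2 *+ 2))))%:E)%E.
    apply: union_bound => // k Dk; rewrite -[P _]/(distribution P (eps k) _) epsN //.
    exact: normal_outside (lt0r_neq0 s0) u0.
  rewrite -[P (bigop _ _ _)]fineK ?fin_num_measure //.
  move: (fine _) => p; rewrite -EFinB lee_fin lte_fin ltrD2l ltrN2 => hp.
  apply: le_lt_trans hp _.
  have -> : - u ^+ 2 / (sigma ^+ 2 *+ 2) = - L + eta * - L.
    by rewrite u2 -mulr_natr; field; rewrite lt0r_neq0.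
  rewrite expRD expRN lnK ?posrE; last by rewrite intrD; lra.
  apply: (@lt_le_trans _ _ (expR (eta * - L))).
    rewrite !mulrA -[X in _ < X]mul1r ltr_pM2r ?expR_gt0 //.
    rewrite ltr_pdivrMr ?mul1r; last by rewrite intrD; lra.
    by rewrite intrD; lra.
  rewrite /powR ifF; last by apply/negbTE; rewrite gt_eqF // divr_gt0 //; lra.
  rewrite ler_expR ler_wpM2l ?(ltW eta0) // div1r lnV ?posrE; last by lra.
  by rewrite lerN2 ler_ln ?posrE intrD; lra.
- move=> w Ew; have le_u k : D k -> `|eps k w| <= u.
    move=> Dk; rewrite leNgt; apply/negP => h; apply: Ew.
    by rewrite (bigD1 k) //=; left.
  rewrite exprMn sqr_sqrtr; last first.
    by rewrite nE !mulr_ge0 // addr_ge0 // ltW.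
  rewrite (bigID D) /= [X in _ + X]big1 ?addr0; last first.
    by move=> k; rewrite -leNgt => kd; rewrite eps0 // expr0n.
  apply: (@le_trans _ _ (\sum_(k | D k) u ^+ 2)).
    apply: ler_sum => k Dk; rewrite -real_normK ?num_real // ler_sqr ?nnegrE //.
    exact: le_u.
  by rewrite sumr_const u2 nE -mulr_natr le_eqVlt; apply/orP; left; apply/eqP; ring.
Qed.

End gaussian_noise.

(** * Separation and distance of the spikes *)

Section extended_minima.
Variable R : realType.
Local Open Scope ereal_scope.

Lemma bigmin_le (I : eqType) (r : seq I) (Q : pred I) (F : I -> \bar R) (b : \bar R) i :
  b <= \big[mine/+oo]_(j <- r | Q j) F j -> i \in r -> Q i -> b <= F i.
Proof.
elim: r => // j r IHr; rewrite big_cons; case: ifP => Qj.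
  rewrite le_min => /andP[bj br]; rewrite inE => /orP[/eqP ->//|]; exact: IHr.
move=> br; rewrite inE => /orP[/eqP ->|]; first by rewrite Qj.
exact: IHr.
Qed.

Lemma bigmin_attained (I : eqType) (r : seq I) (F : I -> \bar R) :
  \big[mine/+oo]_(j <- r) F j = +oo \/
  exists2 i, i \in r & \big[mine/+oo]_(j <- r) F j = F i.
Proof.
elim: r => [|j r IHr]; first by left; rewrite big_nil.
right; rewrite big_cons; case: leP => [_|h]; first by exists j; rewrite ?mem_head.
case: IHr => [E|[i ir E]]; first by rewrite E ltNge leey in h.
by exists i => //; rewrite inE ir orbT.
Qed.

End extended_minima.

Section spikes.
Variables (R : realType) (s : nat) (t : 'I_s -> R).
Hypothesis t_inj : injective t.
Hypothesis t_itv : forall i, -1 <= t i <= 1.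
Let T : {fset R} := [fset t i | i in 'I_s]%fset.

Let memT i : t i \in T. Proof. exact: in_imfset. Qed.

Lemma acos_itv i : 0 <= acos (t i) <= pi.
Proof. by rewrite acos_ge0 ?acos_lepi. Qed.

Lemma Delta_sep (x : R) i j : (x%:E <= Delta T)%E -> i != j ->
  x <= `|acos (t i) - acos (t j)|.
Proof.
move=> h ij; have tij : t i != t j by apply: contraNneq ij => /t_inj ->.
have := bigmin_le (bigmin_le h (memT i) isT) (memT j) tij.
by rewrite lee_fin le_min => /andP[].
Qed.

(** The distance of [th] to the edges is half the distance on the circle between
[th] and [- th]. *)
Lemma edge_dist_sep (x : R) i : (x%:E <= 2%:E * edge_dist T)%E ->
  acos (t i) != 0 -> acos (t i) != pi -> x <= 2 * acos (t i) <= 2 * pi - x.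
Proof.
rewrite -lee_pdivrMl // => h ti0 tipi.
have ti : (t i != -1) && (t i != 1).
  by apply/andP; split; [apply: contraNneq tipi | apply: contraNneq ti0] => ->;
     rewrite ?acosN1 ?acos1.
have := bigmin_le h (memT i) ti; rewrite /rho acos1 acosN1 lee_fin le_min.
have /andP[h0 hpi] := acos_itv i.
rewrite subr0 ger0_norm // ler0_norm ?subr_le0 //.
by move=> /andP[h1 h2]; apply/andP; split; lra.
Qed.

(** The minimum over the spikes is attained at a nearest one, unless there are no
spikes and the minimum is infinite; then only the cap [c ^+ 2] remains. *)
Lemma localization_penalty (n c u : R) : 0 < n -> 0 < c ->
  exists M : R,
    mine ((n ^+ 2)%:E * \big[mine/+oo%E]_(v <- T) (rho v u ^+ 2)%:E)%E (c ^+ 2)%:E = M%:E /\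
    ((exists l, n * `|acos u - acos (t l)| <= c /\ M = (n * (acos u - acos (t l))) ^+ 2) \/
     (M = c ^+ 2 /\ forall l, c < n * `|acos u - acos (t l)|)).
Proof.
move=> n0 c0; have nrho l : n ^+ 2 * rho (t l) u ^+ 2 = (n * `|acos u - acos (t l)|) ^+ 2.
  by rewrite /rho distrC exprMn.
have sq l : (n * `|acos u - acos (t l)|) ^+ 2 = (n * (acos u - acos (t l))) ^+ 2.
  by rewrite !exprMn real_normK ?num_real.
have nn l : 0 <= n * `|acos u - acos (t l)| by rewrite mulr_ge0 // ltW.
have mlt (x : \bar R) l : (x <= \big[mine/+oo%E]_(v <- T) (rho v u ^+ 2)%:E)%E ->
    (x <= (rho (t l) u ^+ 2)%:E)%E.
  by move=> h; exact: (bigmin_le h (memT l) isT).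
have [E|[v vT E]] := bigmin_attained T (fun v => (rho v u ^+ 2)%:E).
  exists (c ^+ 2); rewrite E gt0_muley ?lte_fin ?exprn_gt0 // minEle leye_eq /=.
  split => //; right; split => // l.
  by have := mlt +oo%E l; rewrite E => /(_ (lexx _)); rewrite leye_eq.
have /imfsetP[l _ vl] := vT; rewrite vl in E; rewrite E -EFinM nrho.
have [h|h] := leP (n * `|acos u - acos (t l)|) c.
  exists ((n * (acos u - acos (t l))) ^+ 2); split; last by left; exists l.
  by rewrite -sq minEle lee_fin ler_sqr ?nnegrE ?(ltW c0) // h.
exists (c ^+ 2); split.
  by rewrite minEle lee_fin ler_sqr ?nnegrE ?(ltW c0) // leNgt h.
right; split => // l'.
have := mlt _ l' (lexx _); rewrite E lee_fin => hl.
apply: lt_le_trans h _; rewrite -ler_sqr ?nnegrE // -!nrho.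
by rewrite ler_wpM2l // sqr_ge0.
Qed.

End spikes.

Section numeric_constants.
Variable R : realFieldType.

Lemma radius_itv : 1 <= (10361 / 10 ^+ 4 : R) <= 11 / 10.
Proof. lra. Qed.

Lemma global_constant : 116 < (23585 / 10 ^+ 2 : R).
Proof. lra. Qed.

Lemma local_constant : 119 <= (22072 / 10 ^+ 2 : R).
Proof. lra. Qed.

End numeric_constants.

Theorem theorem1 (R : realType) (disp : measure_display)
    (Omega : measurableType disp) (P : probability Omega R)
    (s m : nat) (d : int) (a t : 'I_s -> R) (sigma eta : R)
    (eps : 'I_m.+1 -> {RV P >-> R})
    (hm : (128 <= m)%N) (hd : -1 <= d < m%:Z)
    (hx : admissible_spikes a t)
    (hsigma : 0 < sigma) (heta : 0 < eta)
    (heps0 : forall (k : 'I_m.+1) (w : Omega), k%:Z <= d -> eps k w = 0)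
    (hepsN : forall (k : 'I_m.+1), d < k%:Z ->
       forall A : set R, measurable A ->
       distribution P (eps k) A = normal_prob 0 sigma A)
    (hepsI : mutually_independent [set k : 'I_m.+1 | d < k%:Z]%SET eps) :
  let x : {charge set R -> \bar R} := discrete_measure a t in
  let T : {fset R} := [fset t i | i in 'I_s]%fset in
  let y (w : Omega) (k : 'I_m.+1) : R := moment k x + eps k w in
  let lambda0 : R := 2 * sigma *
    Num.sqrt (2 * (1 + eta) * (m%:Z - d)%:~R * ln (5 * (m%:Z + d + 1)%:~R)) in
  let c0 : R := 10361 / 10 ^+ 4 in
  let c1 : R := 23585 / 10 ^+ 2 in
  let c2 : R := 22072 / 10 ^+ 2 in
  exists E : set Omega,
    [/\ measurable E,
        ((1 - (1 / (5 * (m%:Z + d)%:~R)) `^ eta)%:E < P E)%E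
      & forall w, E w -> forall lambda : R, 0 < lambda -> lambda0 <= lambda ->
        ((5 * pi / m%:R)%:E <= mine (Delta T) (2%:E * edge_dist T))%E ->
        exists (s' : nat) (a' t' : 'I_s' -> R),
          [/\ admissible_spikes a' t',
              is_solution d x (y w) lambda (discrete_measure a' t'),
              (\sum_(k < s') `|a' k|%:E *
                 mine ((m%:R ^+ 2)%:E *
                       \big[mine/+oo]_(u <- T) (rho u (t' k) ^+ 2)%:E)
                      (c0 ^+ 2)%:E
               <= (c1 * lambda)%:E)%E,
              (forall i : 'I_s,
                 `|a i - \sum_(k < s' | rho (t i) (t' k) <= c0 / m%:R) a' k|
                 <= c2 * lambda)
            & (forall i : 'I_s, c2 * lambda < `|a i| ->
                 exists k : 'I_s',
                   rho (t i) (t' k)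
                   <= Num.sqrt (c1 * lambda / (`|a i| - c2 * lambda))
                      * (1 / m%:R))]].
Proof.
move=> x T y lambda0 c0 c1 c2.
have [t_inj a_neq0 t_itv] := hx.
have m0 : 0 < m%:R :> R by rewrite ltr0n (leq_trans _ hm).
have [E [mE PE Enoise]] := noise_event hm hd hsigma heta heps0 hepsN.
exists E; split => // w /Enoise noise lambda lambda_gt0 lambda0_le.
rewrite le_min => /andP[DeltaT edgeT].
have [_ dm] := andP hd.
have [s' [a' [t' [adm' sol]]]] := blasso_solution x (y w) dm lambda_gt0.
exists s', a', t'.
have [t'_inj a'_neq0 t'_itv] := adm'.
pose th i := acos (t i); pose th' j := acos (t' j).
have momE N (b u : 'I_N -> R) : admissible_spikes b u ->
    forall k, moment k (discrete_measure b u) = mom b (fun j => acos (u j)) k.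
  by move=> adm k; rewrite moment_discrete //; apply: eq_bigr => j _; rewrite phi_acos.
have c0_itv : 1 <= c0 <= 11 / 10 := radius_itv R.
have c0_gt0 : 0 < c0 by rewrite (lt_le_trans ltr01) //; case/andP: c0_itv.
(* [M j] is the capped squared distance, in units of [1 / m], of the atom [j]. *)
have [M penaltyE] := choice (fun j => localization_penalty t (t' j) m0 c0_gt0).
have M_cases j := (penaltyE j).2.
have noise_le : \sum_(k < m.+1) eps k w ^+ 2 <= (lambda / 2) ^+ 2.
  apply: le_trans noise _; rewrite ler_sqr ?nnegrE; last 2 first.
  - by rewrite mulr_ge0 ?sqrtr_ge0 // ltW.
  - by rewrite divr_ge0 // ltW.
  by rewrite ler_pdivlMr // mulrC mulrA.
(* The true spikes are feasible, and their residual is the noise. *)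
have optimal : 2^-1 * (\sum_(k < m.+1) ((mom a' th' k - mom a th k) - eps k w) ^+ 2)
      + lambda * \sum_j `|a' j| <=
    2^-1 * (\sum_(k < m.+1) eps k w ^+ 2) + lambda * \sum_i `|a i|.
  have xx : feasible d x x by split => //; exact: discrete_measure_on_I.
  have := sol.2 x xx; rewrite /objective !TV_discrete // -!EFinM -!EFinD lee_fin.
  rewrite /y; under eq_bigr do rewrite momE // /x momE // opprD addrA.
  by under [X in _ <= _ * X + _ -> _]eq_bigr do rewrite opprD addrA subrr add0r sqrrN.
have th_sep i j : i != j -> 5 * pi / m%:R <= `|th i - th j| by exact: Delta_sep.
have th_edge i : th i != 0 -> th i != pi -> 5 * pi / m%:R <= 2 * th i <= 2 * pi - 5 * pi / m%:R.
  exact: edge_dist_sep.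
have th_itv := acos_itv t_itv; have th'_itv := acos_itv t'_itv.
have near_c0 i j : (rho (t i) (t' j) <= c0 / m%:R) = (m%:R * `|th i - th' j| <= c0).
  by rewrite ler_pdivlMr // mulrC.
split => //.
- have [gap _] := gap_and_residual hm a_neq0 th_itv th_sep th_edge th'_itv
    lambda_gt0 c0_itv noise_le M_cases optimal.
  under eq_bigr do rewrite (penaltyE _).1 -EFinM.
  rewrite sumEFin lee_fin; apply: le_trans gap _.
  by rewrite ler_wpM2r ?(ltW lambda_gt0) // ltW // global_constant.
- move=> i; under eq_bigl do rewrite near_c0.
  apply: le_trans (local_control hm a_neq0 th_itv th_sep th_edge th'_itv
    lambda_gt0 c0_itv noise_le M_cases optimal i) _.
  by rewrite ler_wpM2r ?(ltW lambda_gt0) // local_constant.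
- move=> i ai; have [j hj] := large_spike hm a_neq0 th_itv th_sep th_edge th'_itv
    lambda_gt0 c0_itv noise_le M_cases optimal (global_constant R) (local_constant R) ai.
  by exists j; rewrite div1r ler_pdivlMr // mulrC.
Qed.
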